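(* Let $\mathfrak{g}=\mathfrak{g}_0\oplus\mathfrak{g}_1$, $\theta$, $\mathfrak{h}_0$, $G_0$ and the characteristics $h_1,\ldots,h_t\in\mathfrak{h}_0$ be as described in the context. Let $h\in\mathfrak{g}_0$ be a homogeneous characteristic, lying in a homogeneous $\mathfrak{sl}_2$-triple $(h,e,f)$ of $\mathfrak{g}$ (so $e,f\in\mathfrak{g}_1$). Then there are $g\in G_0$ and $i\in\{1,\ldots,t\}$ such that $g(h)=h_i$ and $(g(h),g(e),g(f))$ is a real Cayley triple.
   Context: Setting. $\mathfrak{g}$ is a split real semisimple Lie algebra (it has a Cartan subalgebra split over $\mathbb{R}$), $\varphi\colon\mathfrak{g}\to\mathfrak{g}$ is an automorphism of order $2$, and $\mathfrak{g}=\mathfrak{g}_0\oplus\mathfrak{g}_1$ is its eigenspace decomposition, with $\varphi$ acting as $(-1)^i$ on $\mathfrak{g}_i$. $\theta$ is a Cartan involution of $\mathfrak{g}$ commuting with $\varphi$, with Cartan decomposition $\mathfrak{g}=\mathfrak{k}\oplus\mathfrak{p}$. $\mathfrak{g}^c=\mathbb{C}\otimes_{\mathbb{R}}\mathfrak{g}=\mathfrak{g}_0^c\oplus\mathfrak{g}_1^c$ denotes the complexification. Groups. $G^c$ is the adjoint group of $\mathfrak{g}^c$ (identity component of $\mathrm{Aut}(\mathfrak{g}^c)$), and $G_0^c\le G^c$ is the connected algebraic subgroup with Lie algebra $\mathrm{ad}(\mathfrak{g}_0^c)$; $G_0^c(\mathbb{R})$ is the group of elements of $G_0^c$ whose matrix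 with respect to a basis of $\mathfrak{g}^c$ contained in $\mathfrak{g}$ is real. Let $\widetilde G_0^c\le\mathrm{GL}_k(\mathbb{C})$ be a connected algebraic subgroup and $R^c\colon\widetilde G_0^c\to G_0^c$ an isomorphism of algebraic groups, both defined over $\mathbb{R}$, and let $\widetilde G_0^c(\mathbb{R})$ be the group of elements of $\widetilde G_0^c$ with real entries. Define $G_0=R^c(\widetilde G_0^c(\mathbb{R}))$; then $(G_0^c(\mathbb{R}))^\circ\le G_0\le G_0^c(\mathbb{R})\le\mathrm{Aut}(\mathfrak{g})$. Cartan subalgebra. $\mathfrak{h}_0$ is a fixed Cartan subalgebra of $\mathfrak{g}_0$ that is split (that is, $\mathrm{ad}_{\mathfrak{g}}(x)$ is diagonalisable over $\mathbb{R}$ for every $x\in\mathfrak{h}_0$) and $\theta$-stable; then $\mathfrak{h}_0\subseteq\mathfrak{g}_0\cap\mathfrak{p}$. It is contained in a split $\theta$-stable Cartan subalgebra $\mathfrak{h}$ of $\mathfrak{g}$. Triples. An $\mathfrak{sl}_2$-triple is a tuple $(h,e,f)$ with $[h,e]=2e$, $[h,f]=-2f$, $[e,f]=h$ (with $e\neq 0$). It is homogeneous if $h$ lies in the degree-$0$ part and $e,f$ lie in the degree-$1$ part of the grading ($h\in\mathfrak{g}_0$, $e,f\in\mathfrak{g}_1$ for triples in $\mathfrak{g}$; $h\in\mathfrak{g}_0^c$, $e,f\in\mathfrak{g}_1^c$ for triples in $\mathfrak{g}^c$). An element $h$ is a homogeneous characteristic if it is the first entry of some homogeneous $\mathfrak{sl}_2$-triple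 $(h,e,f)$. A homogeneous $\mathfrak{sl}_2$-triple $(h,e,f)$ in $\mathfrak{g}$ is a real Cayley triple if $\theta(e)=-f$ (hence $\theta(f)=-e$ and $\theta(h)=-h$). Fixed characteristics. Let $e_1,\ldots,e_t$ be representatives of the nonzero nilpotent $G_0^c$-orbits in $\mathfrak{g}_1^c$, with corresponding homogeneous $\mathfrak{sl}_2$-triples $(h_i,e_i,f_i)$ in $\mathfrak{g}^c$, chosen so that each $h_i\in\mathfrak{h}_0$ (each $h_i$ may be assumed to lie in $\mathfrak{h}_0$). *)

(* Defs.v *)
From HB Require Import structures.
From mathcomp Require Import all_boot all_order all_algebra.
From mathcomp Require Import reals complex mpoly ring.

Set Implicit Arguments.
Unset Strict Implicit.
Unset Printing Implicit Defensive.

Import Order.TTheory GRing.Theory Num.Theory VectorInternalTheory.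

Local Open Scope ring_scope.

HB.mixin Record Vector_isLie (K : fieldType) L of Vector K L := {
  lie : L -> L -> L;
  lie_linearl : forall (a : K) (x x' y : L),
    lie (a *: x + x') y = a *: lie x y + lie x' y;
  lie_linearr : forall (a : K) (x y y' : L),
    lie x (a *: y + y') = a *: lie x y + lie x y';
  liexx : forall x : L, lie x x = 0;
  lie_jacobi : forall x y z : L,
    lie x (lie y z) + lie y (lie z x) + lie z (lie x y) = 0
}.

#[short(type="lieAlgType")]
HB.structure Definition LieAlgebra (K : fieldType) :=
  { L of Vector_isLie K L & Vector K L }.

Section LieTheory.
Variables (K : fieldType) (L : lieAlgType K).
Implicit Types (x y h e f : L) (U V I M H : {vspace L}).

Definition ad x : 'End(L) := linfun (lie x).

Definition endmx (u : 'End(L)) :=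
  passmx.mxof (vbasis {:L}) (vbasis {:L}) u.

Definition killing x y : K := \tr (endmx (ad x \o ad y)%VF).

Definition lieprod U V : {vspace L} :=
  <<[seq lie u v | u <- vbasis U, v <- vbasis V]>>%VS.

Definition lie_subalgebra U := (lieprod U U <= U)%VS.

Definition lie_ideal I := (lieprod {:L} I <= I)%VS.

Definition lie_solvable U :=
  exists n, iter n (fun W => lieprod W W) U = 0%VS.

Definition lie_nilpotent U :=
  exists n, iter n (lieprod U) U = 0%VS.

Definition semisimple :=
  forall I, lie_ideal I -> lie_solvable I -> I = 0%VS.

(* [H] is a Cartan subalgebra of the subalgebra [M]: nilpotent and equal to
   its own normaliser in [M]. *)
Definition cartan_subalgebra M H :=
  [/\ (H <= M)%VS, lie_subalgebra H, lie_nilpotent H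
    & forall x, x \in M -> (forall y, y \in H -> lie x y \in H) -> x \in H].

(* Diagonalisability is that of [ad x] on all of [L], over the ground field
   [K], even when [H] is a subalgebra of a smaller algebra. *)
Definition split_subspace H :=
  forall x, x \in H -> diagonalizable (endmx (ad x)).

Definition split_lie_algebra :=
  exists2 H, cartan_subalgebra {:L} H & split_subspace H.

Definition lie_aut (u : 'End(L)) :=
  lker u = 0%VS /\ forall x y, u (lie x y) = lie (u x) (u y).

Definition ad_nilpotent x := exists n, forall y, iter n (lie x) y = 0.

Definition sl2_triple h e f :=
  [/\ lie h e = 2%:R *: e, lie h f = - (2%:R *: f), lie e f = h & e != 0].

Definition homogeneous_triple (L0 L1 : {vspace L}) h e f :=
  [/\ sl2_triple h e f, h \in L0, e \in L1 & f \in L1].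

Definition lie_involution (u : 'End(L)) :=
  [/\ lie_aut u, (u \o u)%VF = \1%VF & u <> \1%VF].

Definition grade (phi : 'End(L)) (i : nat) := passmx.leigenspace phi ((-1) ^+ i).

End LieTheory.

Definition cartan_involution (R : realFieldType) (g : lieAlgType R)
    (theta : 'End(g)) :=
  [/\ lie_aut theta, (theta \o theta)%VF = \1%VF
    & forall x : g, x != 0 -> 0 < - killing x (theta x)].

Definition real_cayley_triple (R : realFieldType) (g : lieAlgType R)
    (phi theta : 'End(g)) (h e f : g) :=
  homogeneous_triple (grade phi 0) (grade phi 1) h e f /\ theta e = - f.

Section Coordinates.
Variables (K : fieldType) (V : vectType K).

Fact v2rD (x y : V) : v2r (x + y) = v2r x + v2r y. Proof. exact: raddfD. Qed.
Fact v2rN (x : V) : v2r (- x) = - v2r x. Proof. exact: raddfN. Qed.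
Fact v2rZ a (x : V) : v2r (a *: x) = a *: v2r x. Proof. exact: linearZZ. Qed.
Fact v2r0 : v2r (0 : V) = 0. Proof. exact: raddf0. Qed.

End Coordinates.

(* Decides linear identities in a vector space by passing to coordinates. *)
Local Ltac vring :=
  apply: (can_inj v2rK); apply/rowP=> ?;
  rewrite ?(v2rD, v2rN, v2rZ, v2r0, mxE) /=; ring.

(* The pair [(x, y)] stands for [x + i y]. *)

Definition complexification (R : rcfType) (V : vectType R) : Type :=
  (V * V)%type.

Section ComplexVect.
Variables (R : rcfType) (V : vectType R).
Local Notation VC := (complexification V).

HB.instance Definition _ := GRing.Zmodule.on VC.

Definition cscale (a : R[i]) (z : VC) : VC :=
  (complex.Re a *: z.1 - complex.Im a *: z.2,
   complex.Re a *: z.2 + complex.Im a *: z.1).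

Fact cscaleA a b z : cscale a (cscale b z) = cscale (a * b) z.
Proof. by case: a b z => [a1 a2] [b1 b2] [x y]; congr (_, _) => /=; vring. Qed.

Fact cscale1 : left_id 1 cscale.
Proof. by case=> x y; congr (_, _) => /=; vring. Qed.

Fact cscaleDr : right_distributive cscale +%R.
Proof. by case=> a b [x y] [x' y']; congr (_, _) => /=; vring. Qed.

Fact cscaleDl z : {morph cscale^~ z : a b / a + b}.
Proof. by case: z => x y [a b] [a' b']; congr (_, _) => /=; vring. Qed.

HB.instance Definition _ :=
  GRing.Zmodule_isLmodule.Build R[i] VC cscaleA cscale1 cscaleDr cscaleDl.

Fact complexification_vect_iso : Vector.axiom (dim V) VC.
Proof.
pose F (z : VC) : 'rV[R[i]]_(dim V) :=
  \row_j Complex (v2r z.1 0 j)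
                 (v2r z.2 0 j).
exists F.
  move=> [a b] [x y] [x' y']; apply/rowP=> j; rewrite !mxE /=.
  by rewrite !(v2rD, v2rN, v2rZ) !mxE.
pose G (w : 'rV[R[i]]_(dim V)) : VC :=
  (r2v (map_mx (@complex.Re R) w), r2v (map_mx (@complex.Im R) w)).
exists G.
  move=> [x y]; congr pair; rewrite -[RHS]v2rK;
  by congr r2v; apply/rowP=> j; rewrite !mxE.
move=> w; apply/rowP=> j; rewrite !mxE !r2vK !mxE.
by case: (w 0 j).
Qed.

HB.instance Definition _ :=
  Lmodule_hasFinDim.Build R[i] VC complexification_vect_iso.

Definition cinj (x : V) : VC := (x, 0).

Definition cplxv (U : {vspace V}) : {vspace VC} :=
  <<[seq cinj u | u <- vbasis U]>>%VS.

Definition cplx_end (u : 'End(V)) : 'End(VC) :=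
  linfun (fun z : VC => (u z.1, u z.2) : VC).

Definition cbasis : (\dim {:V}).-tuple VC :=
  [tuple of [seq cinj u | u <- vbasis {:V}]].

(* The matrix of [u] in a basis of the complexification contained in [V]. *)
Definition cmx (u : 'End(VC)) : 'M[R[i]]_(\dim {:V}) :=
  \matrix_(i, j) coord cbasis i (u (tnth cbasis j)).

Definition mxset (G : 'End(VC) -> Prop) (A : 'M[R[i]]_(\dim {:V})) : Prop :=
  exists2 u, G u & A = cmx u.

End ComplexVect.

Section ComplexLie.
Variables (R : rcfType) (g : lieAlgType R).
Local Notation gC := (complexification g).

Definition clie (z w : gC) : gC :=
  (lie z.1 w.1 - lie z.2 w.2, lie z.1 w.2 + lie z.2 w.1).

Let lieDl (x x' y : g) : lie (x + x') y = lie x y + lie x' y.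
Proof. by have := lie_linearl 1 x x' y; rewrite !scale1r. Qed.

Let lieDr (x y y' : g) : lie x (y + y') = lie x y + lie x y'.
Proof. by have := lie_linearr 1 x y y'; rewrite !scale1r. Qed.

Let lie0l (y : g) : lie 0 y = 0.
Proof. by apply: (addrI (lie 0 y)); rewrite -lieDl !addr0. Qed.

Let lie0r (x : g) : lie x 0 = 0.
Proof. by apply: (addrI (lie x 0)); rewrite -lieDr !addr0. Qed.

Let lieZl a (x y : g) : lie (a *: x) y = a *: lie x y.
Proof. by have := lie_linearl a x 0 y; rewrite !addr0 lie0l addr0. Qed.

Let lieZr a (x y : g) : lie x (a *: y) = a *: lie x y.
Proof. by have := lie_linearr a x y 0; rewrite !addr0 lie0r addr0. Qed.

Let lieNl (x y : g) : lie (- x) y = - lie x y.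
Proof. by rewrite -scaleN1r lieZl scaleN1r. Qed.

Let lieNr (x y : g) : lie x (- y) = - lie x y.
Proof. by rewrite -scaleN1r lieZr scaleN1r. Qed.

Let lieC (x y : g) : lie x y = - lie y x.
Proof.
apply/eqP; rewrite -addr_eq0; apply/eqP.
by have := liexx (x + y); rewrite lieDl !lieDr !liexx add0r addr0.
Qed.

Fact clie_linearr a (z w w' : gC) :
  clie z (a *: w + w') = a *: clie z w + clie z w'.
Proof.
case: a z w w' => [a b] [x y] [u v] [u' v']; congr (_, _) => /=;
by rewrite !(lieDr, lieNr, lieZr); vring.
Qed.

Fact clie_linearl a (z z' w : gC) :
  clie (a *: z + z') w = a *: clie z w + clie z' w.
Proof.
case: a z z' w => [a b] [x y] [u v] [u' v']; congr (_, _) => /=;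
by rewrite !(lieDl, lieNl, lieZl); vring.
Qed.

Fact cliexx (z : gC) : clie z z = 0.
Proof.
by case: z => x y; rewrite /clie /= !liexx subr0 (lieC x y) addNr.
Qed.

Fact clie_jacobi (x y z : gC) :
  clie x (clie y z) + clie y (clie z x) + clie z (clie x y) = 0.
Proof.
case: x y z => [x x'] [y y'] [z z'].
have J (u v w : g) : lie u (lie v w) = - lie v (lie w u) - lie w (lie u v).
  by apply/eqP; rewrite -opprD -addr_eq0 addrA lie_jacobi.
congr (_, _) => /=; rewrite !(lieDr, lieNr).
  rewrite (J x y z) (J x y' z') (J x' y z') (J x' y' z); vring.
rewrite (J x y z') (J x y' z) (J x' y z) (J x' y' z'); vring.
Qed.

HB.instance Definition _ :=
  Vector_isLie.Build R[i] gC clie_linearl clie_linearr cliexx clie_jacobi.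

End ComplexLie.

Section Zariski.
Variables (K : fieldType) (n : nat).
Implicit Types (p : {mpoly K[n * n]}) (A X : 'M[K]_n) (G : 'M[K]_n -> Prop).

Definition mxeval p A : K := p.@[fun i => mxvec A 0 i].

Definition zero_locus (S : {mpoly K[n * n]} -> Prop) A :=
  forall p, S p -> mxeval p A = 0.

Definition vanishes_on p G := forall A, G A -> mxeval p A = 0.

(* Connectedness for the topology induced by the Zariski topology. *)
Definition zconnected G :=
  forall S T : {mpoly K[n * n]} -> Prop,
    (forall A, G A -> zero_locus S A \/ zero_locus T A) ->
    (forall A, G A -> ~ (zero_locus S A /\ zero_locus T A)) ->
    (forall A, G A -> zero_locus S A) \/ (forall A, G A -> zero_locus T A).

(* The union of the connected subsets of [G] that contain the identity. *)
Definition identity_component G A :=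
  exists B : 'M[K]_n -> Prop,
    [/\ forall X, B X -> G X, zconnected B, B 1%:M & B A].

(* Subgroups of GL_n that are Zariski-closed in GL_n. *)
Definition algebraic_group G :=
  [/\ forall A, G A -> A \in unitmx,
      G 1%:M,
      forall A B, G A -> G B -> G (A *m B),
      forall A, G A -> G (invmx A)
    & exists S, forall A, A \in unitmx -> (G A <-> zero_locus S A)].

(* The Lie algebra of [G]: its Zariski tangent space at the identity. *)
Definition group_lie_algebra G X :=
  forall p, vanishes_on p G ->
    \sum_i mxvec X 0 i * mxeval p^`M(i) 1%:M = 0.

(* The vanishing ideal of [G] is generated by polynomials over [D]. *)
Definition defined_over (D : {pred K}) G :=
  forall p, vanishes_on p G ->
    exists2 s : seq ({mpoly K[n * n]} * {mpoly K[n * n]}),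
      forall u, u \in s -> u.2 \is a mpolyOver (n * n) D /\ vanishes_on u.2 G
      & p = \sum_(u <- s) u.1 * u.2.

End Zariski.

(* The coordinate ring of GL_k is generated by the entries and [1 / \det]. *)
Definition regular_map_over (K : fieldType) (D : {pred K}) (k n : nat)
    (G : 'M[K]_k -> Prop) (F : 'M[K]_k -> 'M[K]_n) :=
  exists (P : 'I_n -> 'I_n -> {mpoly K[k * k]}) (N : nat),
    (forall i j, P i j \is a mpolyOver (k * k) D) /\
    (forall A, G A -> forall i j, F A i j = mxeval (P i j) A / \det A ^+ N).

(* Only the values of [F] on [G] matter. *)
Definition algebraic_group_iso_over (K : fieldType) (D : {pred K}) (k n : nat)
    (G : 'M[K]_k -> Prop) (H : 'M[K]_n -> Prop) (F : 'M[K]_k -> 'M[K]_n) :=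
  [/\ forall A B, G A -> G B -> F (A *m B) = F A *m F B,
      regular_map_over D G F
    & exists F' : 'M[K]_n -> 'M[K]_k,
      [/\ regular_map_over predT H F',
          forall A, G A -> H (F A) /\ F' (F A) = A
        & forall B, H B -> G (F' B) /\ F (F' B) = B]].

Section Groups.
Variables (R : rcfType) (g : lieAlgType R).
Local Notation gC := (complexification g).
Implicit Types (phi : 'End(g)) (G : 'End(gC) -> Prop).

Definition adjoint_group (u : 'End(gC)) :=
  identity_component (mxset (@lie_aut _ gC)) (cmx u).

(* [G] is the connected algebraic subgroup of the adjoint group whose Lie
   algebra is [ad] of the complexification of the degree-zero part of [g]. *)
Definition is_G0c phi G :=
  [/\ forall u, G u -> adjoint_group u,
      algebraic_group (mxset G),
      zconnected (mxset G)
    & forall X, group_lie_algebra (mxset G) X <->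
        exists2 z : gC, z \in cplxv (grade phi 0) & X = cmx (ad z)].

(* The image under [Rc] of the real points of [Gt], each real automorphism of
   the complexification being identified with its restriction to [g]. *)
Definition real_points_image (k : nat) (Gt : 'M[R[i]]_k -> Prop)
    (Rc : 'M[R[i]]_k -> 'End(gC)) (a : 'End(g)) :=
  exists2 A, Gt A /\ A \is a mxOver Num.real & Rc A = cplx_end a.

(* [e] is an irredundant system of representatives of the nonzero nilpotent
   [G]-orbits in [M]. *)
Definition nilpotent_orbit_reps G (M : {vspace gC}) (t : nat)
    (e : 'I_t -> gC) :=
  (forall i, [/\ e i \in M, e i != 0 & ad_nilpotent (e i)]) /\
  (forall x : gC, x \in M -> x != 0 -> ad_nilpotent x ->
     exists! i, exists2 u, G u & u (e i) = x).

End Groups.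

(* Main.v *)
(* Minimising a norm over the real points of G_0^c conjugates (h, e, f) to a real
   Cayley triple, as in the Kempf-Ness theorem. Its characteristic lies in the
   -1-eigenspace of theta, and maximising the Killing pairing with a generic
   element s of h_0, over the compact group of real points commuting with theta,
   moves it to an element y of h_0 that is dominant for the roots of g_0 positive
   on s. Each h_i is moved in the same way to a dominant x in h_0. Choose i
   such that e lies in the G_0^c-orbit of e_i. Then some u in G_0^c maps the
   nilpotent element attached to x to the one attached to y, and u^-1 y - x is a
   sum of vectors of positive weight for x. Since the eigenvalues of a conjugate
   of y on an exterior power of g are constant on the connected group G_0^c, this
   bounds the largest weight of y by that of x, and conversely; hence x = y.
   Neither the Weyl group nor the conjugacy of sl2-triples with a given nilpotent
   element is needed. *)
From HB Require Import structures.
Require Import Defs.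
From mathcomp Require Import all_boot all_order all_algebra.
From mathcomp Require mpoly.
From mathcomp Require Import boolp complex.
From mathcomp Require Import ring lra zify.

Set Implicit Arguments.
Unset Strict Implicit.
Unset Printing Implicit Defensive.

Import Order.TTheory GRing.Theory Num.Theory.

Local Open Scope ring_scope.

(** * Representations of sl2 *)

(** The groups are known only through polynomial equations and Zariski tangent spaces, which shapes
    both halves. Minimising needs the real points of G_0^c to be closed among all matrices and to
    contain the exponentials of ad y for y in g_0. Closedness is obtained by adding the equations of
    invariance of the Killing form. For the exponentials, a left-invariant derivation preserves the
    vanishing ideal and does not raise degrees, so a polynomial along a one-parameter group solves a
    linear differential equation. The norm pairs the Cartan inner product with a form making e and f
    adjoint, built by splitting off isotypic components. Every real point of G_0^c used here lies in
    G_0, because R^c is defined over the reals and the preimage of a real matrix is fixed by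
    conjugation. In the comparison, the submodule of the exterior algebra is stable under the Lie
    algebra, but no group action on it is available. The group therefore acts on the operators, y
    becoming A^-1 y A, whose eigenvalues are subset sums of the weights of y, a finite set. Each
    upper set of values of s gives one inequality; together they determine all weights. *)

Section SL2.
Variables (R : rcfType) (n : nat).
Implicit Types (e f h A B : 'M[R]_n).

Fact mxsclMl (a : R) A B : (a *: A) * B = a *: (A * B).
Proof. exact: esym (scalemxAl _ _ _). Qed.

Fact mxsclMr (a : R) A B : A * (a *: B) = a *: (A * B).
Proof. exact: esym (scalemxAr _ _ _). Qed.

Definition sl2_relations e f h :=
  [/\ h * e - e * h = 2%:R *: e, h * f - f * h = - (2%:R *: f)
    & e * f - f * e = h].

(** Transposition reverses products, so it turns identities for [f ^+ i * e ^+ k] into identities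
    for [e ^+ k * f ^+ i]. *)
Lemma sl2_relations_tr e f h :
  sl2_relations e f h -> sl2_relations e^T f^T (- h^T).
Proof.
case=> he hf ef; split.
- rewrite -!mulmxE mulNmx mulmxN opprK -!trmx_mul addrC -linearB /=.
  by rewrite mulmxE he linearZ.
- rewrite -!mulmxE mulNmx mulmxN opprK -!trmx_mul addrC -linearB /=.
  by rewrite mulmxE hf linearN linearZ.
by rewrite -!mulmxE -!trmx_mul -linearB /= -ef -[in RHS]opprB linearN opprK.
Qed.

Section Relations.
Variables e f h : 'M[R]_n.
Hypothesis efh : sl2_relations e f h.

Let he : h * e = e * h + 2%:R *: e.
Proof. by case: efh => <- _ _; rewrite addrC subrK. Qed.
Let hf : h * f = f * h - 2%:R *: f.
Proof. by case: efh => _ <- _; rewrite addrC subrK. Qed.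
Let ef : e * f = f * e + h.
Proof. by case: efh => _ _ <-; rewrite addrC subrK. Qed.

Lemma sl2_hX i : h * e ^+ i = e ^+ i * h + (2 * i)%:R *: e ^+ i.
Proof.
elim: i => [|i IH]; first by rewrite expr0 mulr1 mul1r muln0 scale0r addr0.
rewrite exprSr mulrA IH mulrDl mxsclMl -[_ * h * e]mulrA he mulrDr mxsclMr mulrA.
by rewrite -addrA -scalerDl -natrD; congr (_ + _%:R *: _); lia.
Qed.

Lemma sl2_efX i : e * f ^+ i.+1 =
  f ^+ i.+1 * e + i.+1%:R *: (f ^+ i * h) - (i.+1 * i)%:R *: f ^+ i.
Proof.
elim: i => [|i IH].
  by rewrite expr0 expr1 mul1r muln0 scale0r subr0 scale1r.
rewrite exprSr mulrA IH mulrBl mulrDl !mxsclMl -[_ * e * f]mulrA ef mulrDr.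
rewrite -[_ * h * f]mulrA hf mulrBr mxsclMr !mulrA -!exprSr.
move: (f ^+ i.+2 * e) (f ^+ i.+1 * h) (f ^+ i.+1) => X Y Z.
by apply/matrixP=> a b; rewrite !mxE; ring.
Qed.

Lemma sl2_eXf i : e ^+ i.+1 * f =
  f * e ^+ i.+1 + i.+1%:R *: (e ^+ i * h) + (i.+1 * i)%:R *: e ^+ i.
Proof.
elim: i => [|i IH].
  by rewrite expr0 expr1 mul1r muln0 scale0r addr0 scale1r.
rewrite [in LHS]exprS -mulrA IH !mulrDr !mxsclMr !mulrA ef mulrDl -[f * e * _]mulrA -!exprS sl2_hX.
move: (f * e ^+ i.+2) (e ^+ i.+1 * h) (e ^+ i.+1) => X Y Z.
by apply/matrixP=> a b; rewrite !mxE; ring.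
Qed.

Variable k : nat.
Hypothesis ek : e ^+ k.+1 = 0.

(** As [e ^+ k.+1 = 0], the formula for [e ^+ k.+1 * f] reduces to its last two terms, which must
    cancel, and [k.+1] divides out. *)
Lemma sl2_eXh : e ^+ k * h = - (k%:R *: e ^+ k).
Proof.
have := sl2_eXf k; rewrite ek mul0r mulr0 add0r => /esym/eqP.
rewrite addr_eq0 natrM -scalerA -scalerN => /eqP E.
by apply: (scalerI _ E); rewrite pnatr_eq0.
Qed.

Lemma sl2_heX : h * e ^+ k = k%:R *: e ^+ k.
Proof. by rewrite sl2_hX sl2_eXh -scaleNr -scalerDl natrM; congr (_ *: _); ring. Qed.

Lemma sl2_efXeX i : e * (f ^+ i.+1 * e ^+ k) =
  (i.+1%:R * (k%:R - i%:R)) *: (f ^+ i * e ^+ k).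
Proof.
rewrite mulrA sl2_efX !mulrBl mulrDl !mxsclMl -[_ * e * _]mulrA -exprS ek mulr0 add0r.
rewrite -[_ * h * _]mulrA sl2_heX mxsclMr scalerA -scalerBl natrM.
by congr (_ *: _); ring.
Qed.

(** Applying [e] to [f ^+ i.+1 * e ^+ k] gives [f ^+ i * e ^+ k] times [i.+1 * (k - i)], a factor
    that is nonzero for [i > k]. Vanishing at a large exponent therefore descends to [k.+1]. *)
Lemma sl2_fXeX_eq0 : (exists m, f ^+ m = 0) -> f ^+ k.+1 * e ^+ k = 0.
Proof.
case=> m fm; have {fm}: f ^+ (k.+1 + m) * e ^+ k = 0.
  by rewrite exprD fm mulr0 mul0r.
elim: m => [|m IH]; first by rewrite addn0.
rewrite addnS => E; apply: IH; have := sl2_efXeX (k.+1 + m).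
rewrite E mulr0 => /esym/eqP; rewrite scaler_eq0 mulf_eq0 pnatr_eq0 /= subr_eq0 eqr_nat.
by case/orP=> [|/eqP//]; lia.
Qed.

End Relations.
End SL2.

(** * Positive forms, and contravariant forms for sl2 *)

Section Psd.
Variable R : rcfType.

Lemma rowsq_ge0 n (v : 'rV[R]_n) : 0 <= (v *m v^T) 0 0.
Proof. by rewrite mxE sumr_ge0 // => i _; rewrite mxE -expr2 sqr_ge0. Qed.

Lemma rowsq_eq0 n (v : 'rV[R]_n) : (v *m v^T) 0 0 = 0 -> v = 0.
Proof.
rewrite mxE => E; apply/rowP=> i; apply/eqP; rewrite [X in _ == X]mxE.
have /psumr_eq0P : forall j, true -> 0 <= v 0 j * v^T j 0.
  by move=> j _; rewrite mxE -expr2 sqr_ge0.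
by move=> /(_ E i isT); rewrite mxE -expr2 => /eqP; rewrite sqrf_eq0.
Qed.

(** A factorisation of free inner size builds in the symmetry and makes sums (concatenate the
    factors) and congruences immediate. *)
Definition psd n (S : 'M[R]_n) := exists N (B : 'M_(n, N)), S = B *m B^T.

Lemma psd_ge0 n (S : 'M[R]_n) (w : 'rV_n) : psd S -> 0 <= (w *m S *m w^T) 0 0.
Proof. by case=> N [B ->]; rewrite mulmxA -[_ *m w^T]mulmxA -trmx_mul rowsq_ge0. Qed.

Lemma psd_mul n m (B : 'M[R]_(n, m)) : psd (B *m B^T).
Proof. by exists m, B. Qed.

Lemma psd_add n (S T : 'M[R]_n) : psd S -> psd T -> psd (S + T).
Proof.
by case=> N [B ->] [N' [B' ->]]; exists (N + N')%N, (row_mx B B'); rewrite tr_row_mx mul_row_col.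
Qed.

Lemma psd_sum n m (S : 'I_m -> 'M[R]_n) : (forall i, psd (S i)) -> psd (\sum_i S i).
Proof.
move=> pS; elim/big_ind: _ => [|A B|//]; last exact: psd_add.
by exists 0%N, 0; rewrite mul0mx.
Qed.

Lemma psd_conj n m (A : 'M[R]_(n, m)) S : psd S -> psd (A *m S *m A^T).
Proof. by case=> N [B ->]; exists N, (A *m B); rewrite trmx_mul !mulmxA. Qed.

Lemma psd_scale n a (S : 'M[R]_n) : 0 <= a -> psd S -> psd (a *: S).
Proof.
move=> a0 [N [B ->]]; exists N, (Num.sqrt a *: B).
by rewrite linearZ /= -scalemxAl -scalemxAr scalerA -expr2 sqr_sqrtr.
Qed.

Definition posdef n (S : 'M[R]_n) :=
  psd S /\ forall w : 'rV_n, (w *m S *m w^T) 0 0 = 0 -> w = 0.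

End Psd.

Lemma trmxX (R : comPzRingType) n (A : 'M[R]_n) i : (A ^+ i)^T = A^T ^+ i.
Proof.
elim: i => [|i IH]; first by rewrite !expr0 trmx1.
by rewrite exprSr exprS -mulmxE trmx_mul IH.
Qed.

Section Isotypic.
Variables (R : rcfType) (n : nat) (e f h phi : 'M[R]_n) (k : nat).
Hypothesis efh : sl2_relations e f h.
Hypothesis ek : e ^+ k.+1 = 0.
Hypothesis fm : exists m, f ^+ m = 0.

Let ekT : e^T ^+ k.+1 = 0. Proof. by rewrite -trmxX ek trmx0. Qed.
Let fmT : exists m, f^T ^+ m = 0.
Proof. by case: fm => m fm0; exists m; rewrite -trmxX fm0 trmx0. Qed.

Let cf i : R := i.+1%:R * (k%:R - i%:R).

Let feX0 : f ^+ k.+1 * e ^+ k = 0. Proof. exact (sl2_fXeX_eq0 efh ek fm). Qed.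

Let eXf0 : e ^+ k * f ^+ k.+1 = 0.
Proof.
apply: trmx_inj; rewrite -mulmxE trmx_mul !trmxX trmx0 mulmxE.
exact (sl2_fXeX_eq0 (sl2_relations_tr efh) ekT fmT).
Qed.

Let eXfXe i : e ^+ k * f ^+ i.+1 * e = cf i *: (e ^+ k * f ^+ i).
Proof.
apply: trmx_inj; rewrite -!mulmxE linearZ /= !trmx_mul !trmxX !mulmxE.
exact (sl2_efXeX (sl2_relations_tr efh) ekT i).
Qed.

Let efXeX i : e * (f ^+ i.+1 * e ^+ k) = cf i *: (f ^+ i * e ^+ k).
Proof. exact (sl2_efXeX efh ek i). Qed.

Let cprod j := \prod_(i < j) cf i.

Let cprod_gt0 j : (j <= k)%N -> 0 < cprod j.
Proof.
move=> jk; apply: prodr_gt0 => i _; rewrite /cf mulr_gt0 ?ltr0n // subr_gt0 ltr_nat.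
exact: leq_trans (ltn_ord i) jk.
Qed.

Let eXfXeX j : e ^+ j * f ^+ j * e ^+ k = cprod j *: e ^+ k.
Proof.
elim: j => [|j IH]; first by rewrite /cprod big_ord0 !expr0 !mul1r scale1r.
rewrite exprSr -[_ * e ^+ k]mulrA -[_ * e * _]mulrA efXeX mxsclMr mulrA IH scalerA.
by rewrite /cprod big_ord_recr /= mulrC.
Qed.

(* The idempotent of the isotypic component of highest weight [k]: on that
   component the terms of the sum project onto the successive weight spaces. *)
Definition isoproj : 'M[R]_n :=
  (cprod k)^-1 *: \sum_(i < k.+1) f ^+ i * e ^+ k * f ^+ (k - i).

Lemma isoproj_f : isoproj * f = f * isoproj.
Proof.
rewrite /isoproj mxsclMl mxsclMr; congr (_ *: _).
rewrite mulr_suml mulr_sumr big_ord_recl big_ord_recr /=.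
rewrite subn0 expr0 mul1r -mulrA -exprSr eXf0 add0r subnn expr0 mulr1 mulrA -exprS feX0 addr0.
apply: eq_bigr => i _; rewrite /bump /= add1n !mulrA -exprS -mulrA -exprSr.
by rewrite subnSK.
Qed.

(** Multiplication by [e] shifts the summation index. The factors it produces on the two sides agree
    because [cf i = i.+1 * (k - i)] is invariant under [i |-> k - i.+1]. *)
Lemma isoproj_e : isoproj * e = e * isoproj.
Proof.
rewrite /isoproj mxsclMl mxsclMr; congr (_ *: _).
rewrite mulr_suml mulr_sumr big_ord_recr big_ord_recl /=.
rewrite subnn !expr0 mulr1 -mulrA -exprSr ek mulr0 addr0 subn0 mul1r mulrA -exprS ek mul0r add0r.
apply: eq_bigr => i _; rewrite /bump /= add1n !mulrA -[e * _ * _]mulrA efXeX.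
have ->: (k - i = (k - i.+1).+1)%N by rewrite subnSK.
rewrite -mulrA -mulrA [e ^+ k * _]mulrA eXfXe mxsclMr mxsclMl mulrA; congr (_ *: _).
by rewrite /cf subnSK // !natrB ?ltn_ord // 1?ltnW ?ltn_ord //; rewrite -natr1; ring.
Qed.

(** Only the term [i = 0] contributes: [e ^+ k * f ^+ j * e ^+ k] is a multiple of
    [e ^+ (k - j) * e ^+ k], which vanishes for [j < k]. *)
Lemma isoproj_eX : isoproj * e ^+ k = e ^+ k.
Proof.
rewrite /isoproj mxsclMl mulr_suml big_ord_recl /= subn0 expr0 mul1r eXfXeX.
rewrite big1 => [|i _].
  by rewrite addr0 scalerA mulVf ?scale1r // gt_eqF ?cprod_gt0.
rewrite /bump /= add1n; set j := (k - i.+1)%N.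
have kj : (k = (k - j).-1.+1 + j)%N by rewrite /j; have := ltn_ord i; lia.
rewrite -[X in X * e ^+ k]mulrA [X in _ * (e ^+ X * _)]kj exprD -!mulrA [e ^+ j * _]mulrA.
have e0 m : e ^+ m.+1 * e ^+ k = 0 by rewrite exprSr -mulrA -exprS ek mulr0.
by rewrite eXfXeX mxsclMr e0 scaler0 mulr0.
Qed.

Let pifX i : isoproj * f ^+ i = f ^+ i * isoproj.
Proof. by elim: i => [|i IH]; rewrite ?expr0 ?mulr1 ?mul1r // exprSr mulrA IH -mulrA isoproj_f mulrA. Qed.

Let pifXeX i : isoproj * (f ^+ i * e ^+ k) = f ^+ i * e ^+ k.
Proof. by rewrite mulrA pifX -mulrA isoproj_eX. Qed.

Lemma isoproj_idem : isoproj * isoproj = isoproj.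
Proof.
rewrite {2 3}/isoproj mxsclMr mulr_sumr; congr (_ *: _); apply: eq_bigr => i _.
by rewrite mulrA pifXeX.
Qed.

Hypothesis phie : phi * e = - (e * phi).
Hypothesis phif : phi * f = - (f * phi).
Hypothesis phi2 : phi * phi = 1.

Let phieX i : phi * e ^+ i = (-1) ^+ i *: (e ^+ i * phi).
Proof.
elim: i => [|i IH]; first by rewrite !expr0 mulr1 mul1r scale1r.
by rewrite exprSr mulrA IH mxsclMl -mulrA phie mulrN mulrA exprSr mulrN1 scaleNr scalerN.
Qed.

Let phifX i : phi * f ^+ i = (-1) ^+ i *: (f ^+ i * phi).
Proof.
elim: i => [|i IH]; first by rewrite !expr0 mulr1 mul1r scale1r.
by rewrite exprSr mulrA IH mxsclMl -mulrA phif mulrN mulrA exprSr mulrN1 scaleNr scalerN.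
Qed.

(** Each summand has total degree [2 * k] in [e] and [f], so the signs met by [phi] cancel. *)
Lemma isoproj_phi : phi * isoproj = isoproj * phi.
Proof.
rewrite /isoproj mxsclMl mxsclMr; congr (_ *: _); rewrite mulr_suml mulr_sumr.
apply: eq_bigr => i _; rewrite 2!mulrA phifX mxsclMl -[_ * phi * _]mulrA phieX mxsclMr.
rewrite mxsclMl mxsclMl -2!mulrA phifX !mxsclMr !scalerA !mulrA -!exprD.
have ->: (i + k + (k - i) = k + k)%N by have := ltn_ord i; lia.
by rewrite addnn -mul2n exprM sqrrN !expr1n scale1r.
Qed.

(** This is the standard form summed over the group [{1, phi}], which makes it invariant under [phi]
    as well. *)
Lemma posdef_1phi : posdef (1 + phi *m phi^T).
Proof.
split; first by apply: psd_add; [exists n, 1; rewrite trmx1 mulmx1 | exact: psd_mul].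
move=> w; rewrite mulmxDr mulmxDl mulmx1 mxE mulmxA -[_ *m phi^T *m w^T]mulmxA -trmx_mul.
have := rowsq_ge0 w; have := rowsq_ge0 (w *m phi) => H1 H2 E.
by apply: rowsq_eq0; lra.
Qed.

Lemma conj_1phi : phi * (1 + phi *m phi^T) * phi^T = 1 + phi *m phi^T.
Proof.
rewrite mulmxE mulrDr mulr1 mulrDl !mulrA phi2 mul1r.
by rewrite -!mulmxE -trmx_mul !mulmxE phi2 trmx1 addrC.
Qed.

(* Given such a form [S] on the complement of the isotypic component, add the
   orthogonal sum of the weight spaces, scaled so as to make [e] and [f] adjoint. *)
Lemma isotypic_form S : posdef S ->
    let p : 'M[R]_n := 1 - isoproj in
    e * p * S = S * (f * p)^T -> phi * S * phi^T = S ->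
  exists2 T, posdef T & e * T = T * f^T /\ phi * T * phi^T = T.
Proof.
move=> [pS dS] p eS phiS.
have pe : p * e = e * p by rewrite mulrBl mulrBr isoproj_e mulr1 mul1r.
have pf : p * f = f * p by rewrite mulrBl mulrBr isoproj_f mulr1 mul1r.
have pp : p * p = p by rewrite {1}/p mulrBl mul1r mulrBr mulr1 isoproj_idem subrr subr0.
have pphi : phi * p = p * phi by rewrite mulrBl mulrBr isoproj_phi mulr1 mul1r.
set P : 'M[R]_n := 1 + phi *m phi^T; have [psdP dP] : posdef P := posdef_1phi.
pose U (i : nat) : 'M[R]_n := f ^+ i * e ^+ k *m P *m (f ^+ i * e ^+ k)^T.
pose T := \sum_(i < k.+1) (cprod i)^-1 *: U i + p *m S *m p^T.
have dpos (i : 'I_k.+1) : 0 < (cprod i)^-1 by rewrite invr_gt0 cprod_gt0 // -ltnS.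
have psdU (i : 'I_k.+1) : psd ((cprod i)^-1 *: U i).
  by apply: psd_scale; [exact: ltW | exact: psd_conj].
exists T; [split|split].
- by apply: psd_add; [exact: psd_sum | exact: psd_conj].
- move=> w; rewrite mulmxDr mulmxDl mxE mulmx_sumr mulmx_suml summxE => E.
  have ge0 (i : 'I_k.+1) : 0 <= (w *m ((cprod i)^-1 *: U i) *m w^T) 0 0 by exact: psd_ge0.
  have sge0 : 0 <= \sum_(i < k.+1) (w *m ((cprod i)^-1 *: U i) *m w^T) 0 0 by exact: sumr_ge0.
  have pge0 : 0 <= (w *m (p *m S *m p^T) *m w^T) 0 0 by apply: psd_ge0; exact: psd_conj.
  move/eqP: E; rewrite paddr_eq0 // => /andP[/eqP s0 /eqP p0].
  (* A null vector is killed by every [f ^+ i * e ^+ k], hence by [isoproj]; it is also killed by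
     [p = 1 - isoproj]. *)
  have wU (i : 'I_k.+1) : w *m (f ^+ i * e ^+ k) = 0.
    have /psumr_eq0P/(_ s0 i isT) := fun (j : 'I_k.+1) (_ : true) => ge0 j.
    rewrite -scalemxAr -scalemxAl mxE => /eqP; rewrite mulf_eq0 gt_eqF ?dpos //= => /eqP.
    rewrite /U; move: (f ^+ i * e ^+ k) => F.
    by rewrite !mulmxA -[_ *m w^T]mulmxA -trmx_mul => /dP.
  have wp : w *m p = 0.
    apply: dS; move: p0.
    by rewrite !mulmxA -[_ *m w^T]mulmxA -trmx_mul.
  have wpi : w *m isoproj = 0.
    rewrite /isoproj -scalemxAr mulmx_sumr big1 ?scaler0 // => i _.
    by rewrite -mulmxE mulmxA mulmxE wU mul0mx.
  by move: wp; rewrite mulmxBr mulmx1 wpi subr0.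
- rewrite mulrDr mulrDl; congr (_ + _).
    rewrite mulr_sumr mulr_suml big_ord_recl big_ord_recr /=.
    rewrite mxsclMr mxsclMl {1 3}/U /= expr0 mul1r -!mulmxE !mulmxA -[_ *m f^T]mulmxA -trmx_mul.
    rewrite !mulmxE -exprS ek !mul0r scaler0 add0r mulrA -exprS feX0 trmx0 mulr0 scaler0 addr0.
    apply: eq_bigr => i _; rewrite mxsclMr mxsclMl /U /= /bump /= add1n.
    rewrite -!mulmxE !mulmxA -[_ *m f^T]mulmxA -trmx_mul !mulmxE !mulrA -exprS.
    rewrite -[e * _ * _]mulrA efXeX !mxsclMl scalerA; congr (_ *: _).
    rewrite /cprod big_ord_recr /= invfM -mulrA mulVf ?mulr1 //.
    by rewrite mulf_neq0 ?pnatr_eq0 // subr_eq0 eqr_nat gtn_eqF.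
  have epS : e * p * S = p * (e * p * S) by rewrite !mulrA pe -[e * p * p]mulrA pp.
  have fpT : (f * p)^T * p^T = (f * p)^T.
    by rewrite -mulmxE -trmx_mul mulmxE mulrA pf -mulrA pp.
  have pfT : p^T * f^T = (f * p)^T by rewrite -[in RHS]mulmxE trmx_mul.
  by rewrite !mulmxE -[RHS]mulrA pfT !mulrA epS eS !mulrA -mulrA fpT.
rewrite mulrDr mulrDl; congr (_ + _).
  rewrite mulr_sumr mulr_suml; apply: eq_bigr => i _; rewrite mxsclMr mxsclMl; congr (_ *: _).
  rewrite /U !mulmxE !mulrA phifX mxsclMl -[_ * phi * _]mulrA phieX mxsclMr !scalerA -exprD.
  rewrite mxsclMl mxsclMl mxsclMl -[_ * _^T * phi^T]mulrA.
  have ->: (f ^+ i * e ^+ k)^T * phi^T = (-1) ^+ (i + k) *: (phi^T * (f ^+ i * e ^+ k)^T).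
    rewrite -!mulmxE -!trmx_mul !mulmxE mulrA phifX mxsclMl -[_ * phi * _]mulrA phieX mxsclMr.
    by rewrite scalerA -exprD mulrA linearZ.
  rewrite mxsclMr scalerA -exprD addnn -mul2n exprM sqrrN !expr1n scale1r !mulrA.
  by rewrite -[_ * phi * P]mulrA -[_ * (phi * P) * _]mulrA conj_1phi.
rewrite !mulmxE !mulrA pphi -[_ * p^T * _]mulrA.
have ->: p^T * phi^T = phi^T * p^T by rewrite -!mulmxE -!trmx_mul !mulmxE pphi.
by rewrite mulrA -[p * phi * S]mulrA -[p * _ * phi^T]mulrA phiS.
Qed.

End Isotypic.

(** A nonzero power [e ^+ i] is an eigenvector of the commutator with [h], of eigenvalue [i * a].
    These eigenvalues are distinct, and an operator on the [n * n]-dimensional space of matrices has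
    at most [n * n] of them. *)
Lemma nilp_of_sl2 (R : numFieldType) n (e h : 'M[R]_n) (a : R) :
  a != 0 -> h * e - e * h = a *: e -> exists m, e ^+ m = 0.
Proof.
move=> a0 he.
have sclMl c (A B : 'M[R]_n) : (c *: A) * B = c *: (A * B) by exact: esym (scalemxAl _ _ _).
have sclMr c (A B : 'M[R]_n) : A * (c *: B) = c *: (A * B) by exact: esym (scalemxAr _ _ _).
have heX i : h * e ^+ i - e ^+ i * h = (i%:R * a) *: e ^+ i.
  elim: i => [|i IH]; first by rewrite mul0r scale0r expr0 mulr1 mul1r subrr.
  have ->: h * e ^+ i.+1 - e ^+ i.+1 * h =
      (h * e ^+ i - e ^+ i * h) * e + e ^+ i * (h * e - e * h).
    by rewrite exprSr mulrBl mulrBr !mulrA addrA subrK.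
  by rewrite IH he sclMl sclMr -exprSr -scalerDl -natr1; congr (_ *: _); ring.
exists (n * n)%N; apply/eqP/negPn/negP => en0.
pose M := lin_mulmx h - lin_mulmxr h.
have rootM i : (i <= n * n)%N -> root (char_poly M) (i%:R * a).
  move=> ni; rewrite -eigenvalue_root_char; apply/eigenvalueP; exists (mxvec (e ^+ i)).
    rewrite mulmxBr !mul_vec_lin /= -linearB /= -linearZ /= -heX.
    by [].
  apply: contra en0; rewrite mxvec_eq0 => /eqP ei.
  by rewrite -(subnK ni) exprD ei mulr0.
have := @max_poly_roots _ (char_poly M) [seq i%:R * a | i <- iota 0 (n * n).+1].
rewrite size_char_poly size_map size_iota ltnn monic_neq0 ?char_poly_monic // => /(_ isT) F.
suff: false by [].
apply: F.
  by apply/allP=> x /mapP[k]; rewrite mem_iota add0n ltnS => /andP[_ ni] ->; exact: rootM.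
rewrite map_inj_uniq ?iota_uniq // => i j /(mulIf a0) /eqP.
by rewrite eqr_nat => /eqP.
Qed.

(** Induction on the nilpotency order of [e], splitting off the top isotypic component. The
    complement is not made a smaller space: the triple is multiplied by the idempotent [p], so it
    still acts in dimension [n], by zero on the split component, and [e * p] has smaller order. *)
Lemma sl2_contravariant_form (R : rcfType) n (e f h phi : 'M[R]_n) :
  sl2_relations e f h ->
  phi * e = - (e * phi) -> phi * f = - (f * phi) -> phi * phi = 1 ->
  exists2 T, posdef T & e * T = T * f^T /\ phi * T * phi^T = T.
Proof.
move=> efh; have [m em] : exists m, e ^+ m.+1 = 0.
  have [||m em] := @nilp_of_sl2 R n e h 2%:R; first by rewrite pnatr_eq0.
    by case: efh.
  by exists m; rewrite exprS em mulr0.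
have [m' fm] : exists m, f ^+ m.+1 = 0.
  have [||m' fm] := @nilp_of_sl2 R n f h (- 2%:R); first by rewrite oppr_eq0 pnatr_eq0.
    by case: efh => _ -> _; rewrite scaleNr.
  by exists m'; rewrite exprS fm mulr0.
elim: m e f h efh em fm => [|k IH] e f h efh em fm phie phif phi2.
  have e0 : e = 0 by rewrite -[e]expr1.
  have h0 : h = 0 by case: efh => _ _ <-; rewrite e0 mul0r mulr0 subr0.
  have f0 : f = 0.
    case: efh => _ /eqP + _; rewrite h0 mul0r mulr0 subr0 eq_sym oppr_eq0 scaler_eq0.
    by rewrite pnatr_eq0 => /eqP.
  exists (1 + phi *m phi^T); first exact: posdef_1phi.
  by rewrite conj_1phi // e0 f0 mul0r trmx0 mulr0.
have fm' : exists m, f ^+ m = 0 by exists m'.+1.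
set pi := isoproj e f k.+1; pose p : 'M[R]_n := 1 - pi.
have pe : p * e = e * p by rewrite mulrBl mulrBr (isoproj_e efh em) mulr1 mul1r.
have pf : p * f = f * p by rewrite mulrBl mulrBr (isoproj_f efh em fm') mulr1 mul1r.
have ph : p * h = h * p.
  by case: efh => _ _ <-; rewrite [LHS]mulrBr [RHS]mulrBl !mulrA pe pf -!mulrA pf pe.
have pp : p * p = p.
  by rewrite {1}/p mulrBl mul1r mulrBr mulr1 (isoproj_idem efh em fm') subrr subr0.
have pphi : phi * p = p * phi.
  by rewrite mulrBl mulrBr isoproj_phi // mulr1 mul1r.
have pc x y : p * x = x * p -> p * y = y * p -> x * p * (y * p) = x * y * p.
  by move=> px py; rewrite -mulrA [p * _]mulrA py -!mulrA pp.
have cX x i : p * x = x * p -> p * x ^+ i = x ^+ i * p.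
  move=> px; elim: i => [|i Hi]; first by rewrite mulr1 mul1r.
  by rewrite exprSr mulrA Hi -mulrA px mulrA.
have pX x i : p * x = x * p -> (x * p) ^+ i.+1 = x ^+ i.+1 * p.
  move=> px; elim: i => [|i Hi]; rewrite ?expr1 // exprSr Hi.
  by rewrite pc -?exprSr //; exact: cX.
have efh' : sl2_relations (e * p) (f * p) (h * p).
  case: efh => he hf ef; split.
  - by rewrite !pc // -mulrBl he mxsclMl.
  - by rewrite !pc // -mulrBl hf mulNr mxsclMl.
  by rewrite !pc // -mulrBl ef.
have [|||||S pS [eS phiS]] := IH _ _ _ efh'.
- by rewrite pX // -cX // mulrBl mul1r (isoproj_eX efh em) subrr.
- by rewrite pX // fm mul0r.
- by rewrite mulrA phie mulNr -!mulrA pphi.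
- by rewrite mulrA phif mulNr -!mulrA pphi.
- by [].
by apply: (isotypic_form efh em fm' phie phif phi2 pS).
Qed.

(** * The fermionic Fock space *)

Section Fock.
Variable F : numFieldType.

(* The canonical anticommutation relations, for operators acting on row vectors. *)
Definition car n N (a b : 'I_n -> 'M[F]_N) :=
  [/\ forall j k, a j *m a k = - (a k *m a j),
      forall j k, b j *m b k = - (b k *m b j)
    & forall j k, a j *m b k = (j == k)%:R%:M - b k *m a j].

(* The action of gl_n on the exterior algebra of its standard module: every
   sum of a set of weights of the latter is a weight of the former. *)
Definition fock n N (a b : 'I_n -> 'M[F]_N) (X : 'M_n) : 'M_N :=
  \sum_j \sum_k X j k *: (b j *m a k).

(* [v] below is the wedge of the basis vectors selected by [I]. *)
Lemma fock_space n : exists N (a b : 'I_n -> 'M[F]_N) (occ : 'I_n -> 'I_N -> bool),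
  [/\ car a b, forall j, b j *m a j = diag_mx (\row_s (occ j s)%:R)
    & forall I : pred 'I_n, exists2 v : 'rV_N, v != 0 &
        forall j, if I j then v *m a j = 0 else v *m b j = 0].
Proof.
elim: n => [|n [N [a [b [occ [[aa bb ab] ba vI]]]]]].
  exists 1%N, (fun=> 0), (fun=> 0), (fun _ _ => false).
  by split; [split; case | case | move=> I; exists 1%:M; [exact: oner_neq0 | case]].
(* The second summand holds the vectors in which the new mode is occupied. The sign there makes the
   old operators anticommute with the new pair. *)
pose lft (M : 'M[F]_N) : 'M[F]_(N + N) := block_mx M 0 0 (- M).
pose a' j := if unlift ord0 j is Some j' then lft (a j') else block_mx 0 1%:M 0 0.
pose b' j := if unlift ord0 j is Some j' then lft (b j') else block_mx 0 0 1%:M 0.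
pose occ' j s := match unlift ord0 j, split s with
  | Some j', inl s' => occ j' s' | Some j', inr s' => occ j' s'
  | None, inl _ => false | None, inr _ => true end.
exists (N + N)%N, a', b', occ'.
have z0 : (false%:R : F)%:M = 0 :> 'M_(N + N) by rewrite raddf0.
split.
- split=> j k; rewrite /a' /b'; case: (unliftP ord0 j) => [j'|] Ej;
    case: (unliftP ord0 k) => [k'|] Ek; rewrite ?Ej ?Ek /lft ?mulmx_block ?opp_block_mx
      ?mul0mx ?mulmx0 ?mul1mx ?mulmx1 ?mulNmx ?mulmxN ?opprK ?addr0 ?add0r ?oppr0 ?opprK //.
  + by rewrite [in LHS]aa.
  + by rewrite [in LHS]bb.
  + by rewrite (inj_eq lift_inj) ab (scalar_mx_block _ _ (_%:R)) add_block_mx !addr0.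
  + by rewrite (_ : _ == _ = false) // z0 add0r.
  + by rewrite (_ : _ == _ = false) // z0 add0r.
  + by rewrite eqxx scalar_mx_block add_block_mx !addr0 subrr.
- move=> j; rewrite /a' /b' /occ'; case: (unliftP ord0 j) => [j'|] Ej.
    rewrite mulmx_block !mul0mx !mulmx0 mulmxN mulNmx opprK !addr0 add0r ba.
    rewrite -diag_mx_row; congr diag_mx; apply/rowP=> s; rewrite !mxE.
    by case: splitP => s' _; rewrite !mxE.
  rewrite mulmx_block !mul0mx !mulmx0 mul1mx !addr0.
  have ->: block_mx 0 0 0 1%:M = block_mx (diag_mx 0) 0 0 (diag_mx (const_mx 1)) :> 'M[F]_(N + N).
    by rewrite raddf0 diag_const_mx.
  rewrite -diag_mx_row.
  congr diag_mx; apply/rowP=> s; rewrite !mxE.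
  by case: splitP => s' _; rewrite !mxE.
move=> I; have [v v0 vab] := vI (fun j => I (lift ord0 j)).
exists (if I ord0 then row_mx 0 v else row_mx v 0).
  by case: (I ord0); rewrite row_mx_eq0 ?eqxx ?andbT //= ?v0.
move=> j; rewrite /a' /b'; case: (unliftP ord0 j) => [j'|] ->.
  have := vab j'; case: ifP => _ E; case: (I ord0);
  by rewrite mul_row_block !mul0mx !mulmx0 ?mulmxN E ?oppr0 ?addr0 row_mx0.
by case: (I ord0); rewrite mul_row_block !mul0mx !mulmx0 ?mulmx1 ?addr0 row_mx0.
Qed.

Section Representation.
Variables (n N : nat) (a b : 'I_n -> 'M[F]_N).
Hypothesis ab_car : car a b.

Let ab j k : a j *m b k = (j == k)%:R%:M - b k *m a j.
Proof. by case: ab_car. Qed.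

Lemma fock_linear c X Y : fock a b (c *: X + Y) = c *: fock a b X + fock a b Y.
Proof.
rewrite /fock scaler_sumr -big_split; apply: eq_bigr => j _.
rewrite scaler_sumr -big_split; apply: eq_bigr => k _ /=.
by rewrite !mxE scalerDl scalerA.
Qed.

HB.instance Definition _ := GRing.isLinear.Build F 'M[F]_n 'M[F]_N _ (fock a b) fock_linear.

Lemma car_comm j k l r : b j *m a k *m (b l *m a r) - b l *m a r *m (b j *m a k) =
  (k == l)%:R *: (b j *m a r) - (r == j)%:R *: (b l *m a k).
Proof.
case: ab_car => aa bb _.
have E x y z t : b x *m a y *m (b z *m a t) =
    (y == z)%:R *: (b x *m a t) - b x *m b z *m (a y *m a t).
  rewrite mulmxA -[_ *m a y *m _]mulmxA ab mulmxBr mulmxBl mul_mx_scalar -scalemxAl.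
  by rewrite !mulmxA.
rewrite !E; have ->: b l *m b j *m (a r *m a k) = b j *m b l *m (a k *m a r).
  by rewrite bb aa mulmxN mulNmx opprK.
by rewrite opprB addrA subrK.
Qed.

Lemma fock_comm X Y :
  fock a b (X *m Y - Y *m X) = fock a b X *m fock a b Y - fock a b Y *m fock a b X.
Proof.
have M (Z T : 'M[F]_n) : fock a b Z *m fock a b T =
    \sum_p \sum_q (Z p.1 p.2 * T q.1 q.2) *: (b p.1 *m a p.2 *m (b q.1 *m a q.2)).
  rewrite /fock [X in X *m _]pair_big [X in _ *m X]pair_big /= mulmx_suml; apply: eq_bigr => p _.
  by rewrite mulmx_sumr; apply: eq_bigr => q _; rewrite -scalemxAl -scalemxAr scalerA.
have H (Z T : 'M[F]_n) : fock a b (Z *m T) =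
    \sum_p \sum_q (Z p.1 p.2 * T q.1 q.2) *: ((p.2 == q.1)%:R *: (b p.1 *m a q.2)).
  rewrite -(pair_bigA _ (fun j k => \sum_q (Z j k * T q.1 q.2) *:
    ((k == q.1)%:R *: (b j *m a q.2)))) /=; apply: eq_bigr => j _.
  transitivity (\sum_r \sum_k (Z j k * T k r) *: (b j *m a r)).
    by apply: eq_bigr => r _; rewrite mxE scaler_suml.
  rewrite exchange_big; apply: eq_bigr => k _.
  rewrite -(pair_bigA _ (fun l r => (Z j k * T l r) *: ((k == l)%:R *: (b j *m a r)))) /=.
  rewrite [RHS](bigD1 k) //= [X in _ + X]big1 ?addr0 => [|l /negPf lk].
    by apply: eq_bigr => r _; rewrite eqxx scale1r.
  by apply: big1 => r _; rewrite eq_sym lk scale0r scaler0.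
have swap (G : 'I_n * 'I_n -> 'I_n * 'I_n -> 'M[F]_N) :
    \sum_p \sum_q (Y p.1 p.2 * X q.1 q.2) *: G p q =
    \sum_p \sum_q (X p.1 p.2 * Y q.1 q.2) *: G q p.
  by rewrite exchange_big; apply: eq_bigr => p _; apply: eq_bigr => q _; rewrite mulrC.
rewrite linearB /= (H X) (H Y) (M X) (M Y) !swap -!sumrB; apply: eq_bigr => p _.
by rewrite -!sumrB; apply: eq_bigr => q _; rewrite -!scalerBr car_comm.
Qed.

Lemma fock_diag occ (d : 'rV[F]_n) :
  (forall j, b j *m a j = diag_mx (\row_s (occ j s : bool)%:R)) ->
  fock a b (diag_mx d) = diag_mx (\row_s \sum_j d 0 j * (occ j s)%:R).
Proof.
move=> ba; rewrite /fock.
transitivity (\sum_j d 0 j *: diag_mx (\row_s (occ j s)%:R)).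
  apply: eq_bigr => j _; rewrite (bigD1 j) //= mxE eqxx mulr1n ba big1 ?addr0 // => k.
  by rewrite mxE eq_sym => /negPf ->; rewrite mulr0n scale0r.
apply/matrixP=> s t; rewrite summxE !mxE.
under eq_bigr do rewrite !mxE.
case: (s == t); rewrite ?mulr1n ?mulr0n.
  by apply: eq_bigr => j _; rewrite mulr1n.
by rewrite big1 // => j _; rewrite mulr0n mulr0.
Qed.

Lemma car_eigenvalue (y : 'I_n -> F) t (w : 'rV_N) :
  w != 0 -> w *m (\sum_j y j *: (b j *m a j)) = t *: w ->
  exists S : {set 'I_n}, t = \sum_(j in S) y j.
Proof.
pose p j := b j *m a j; set T := \sum_j _.
have bb0 j : b j *m b j = 0.
  case: ab_car => _ /(_ j j) /eqP + _; rewrite -subr_eq0 opprK -mulr2n -scaler_nat scaler_eq0.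
  by rewrite pnatr_eq0 => /eqP.
have pp j : p j *m p j = p j.
  rewrite /p mulmxA -[_ *m a j *m _]mulmxA ab eqxx mulmxBr mulmxBl mulmx1 mulmxA.
  by rewrite bb0 !mul0mx subr0.
have pC j k : p j *m p k = p k *m p j.
  apply/eqP; rewrite -subr_eq0 car_comm [k == j]eq_sym; case: (j =P k) => [->|_].
    by rewrite subrr.
  by rewrite !scale0r subrr.
have pT j : p j *m T = T *m p j.
  by rewrite mulmx_sumr mulmx_suml; apply: eq_bigr => k _; rewrite -scalemxAl -scalemxAr pC.
(* split [w] successively along the commuting idempotents [p j] *)
have split_w (s : seq 'I_n) (w0 : 'rV_N) : w0 != 0 -> w0 *m T = t *: w0 ->
    exists w1 : 'rV_N, exists S : {set 'I_n},
    [/\ w1 != 0, w1 *m T = t *: w1 & {in s, forall j, w1 *m p j = (j \in S)%:R *: w1}].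
  elim: s => [|j s IH] nz wT; first by exists w0, set0.
  have [w1 [S [w1nz w1T w1S]]] := IH nz wT.
  have [w1p|w1p] := eqVneq (w1 *m p j) 0.
    exists w1, (S :\ j); split=> // k; rewrite !inE => /predU1P[->|ks].
      by rewrite eqxx scale0r.
    by have [->|_] := eqVneq k j; rewrite ?w1p ?scale0r // w1S.
  exists (w1 *m p j), (j |: S); split=> //.
    by rewrite -mulmxA pT mulmxA w1T scalemxAl.
  move=> k; rewrite !inE => /predU1P[->|ks]; first by rewrite eqxx -mulmxA pp scale1r.
  have [->|_] := eqVneq k j; first by rewrite -mulmxA pp scale1r.
  by rewrite -mulmxA pC mulmxA w1S // scalemxAl.
move=> nz wT; have [w1 [S [w1nz w1T w1S]]] := split_w (enum 'I_n) w nz wT.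
exists S; apply/eqP; rewrite -subr_eq0.
have: (t - \sum_(j in S) y j) *: w1 = 0.
  rewrite scalerBl -w1T mulmx_sumr scaler_suml [in X in _ - X]big_mkcond -sumrB big1 // => j _.
  rewrite -scalemxAr w1S ?mem_enum // scalerA.
  by case: (j \in S); rewrite ?mulr1 ?mulr0 ?scale0r subrr.
by move/eqP; rewrite scaler_eq0 (negPf w1nz) orbF.
Qed.

End Representation.

(** Mixing the [a j] by [P] and the [b j] by its inverse preserves the anticommutation relations and
    turns the operator of [X] into a diagonal one. This change of family stands in for an action of
    GL_n on the Fock space. *)
Lemma fock_eigenvalue n N (a b : 'I_n -> 'M[F]_N) (P : 'M[F]_n) (y : 'rV_n) X t (w : 'rV_N) :
  car a b -> P \in unitmx -> X = invmx P *m diag_mx y *m P ->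
  w != 0 -> w *m fock a b X = t *: w ->
  exists S : {set 'I_n}, t = \sum_(j in S) y 0 j.
Proof.
move=> ab_car Pu XE w0.
have dist (u v : 'I_n -> 'M[F]_N) (x z : 'I_n -> F) : (\sum_k x k *: u k) *m (\sum_l z l *: v l) =
    \sum_k \sum_l (x k * z l) *: (u k *m v l).
  rewrite mulmx_suml; apply: eq_bigr => k _; rewrite mulmx_sumr; apply: eq_bigr => l _.
  by rewrite -scalemxAl -scalemxAr scalerA.
have anti (u : 'I_n -> 'M[F]_N) (x z : 'I_n -> F) : (forall j k, u j *m u k = - (u k *m u j)) ->
    (\sum_k x k *: u k) *m (\sum_l z l *: u l) = - ((\sum_l z l *: u l) *m (\sum_k x k *: u k)).
  move=> uu; rewrite !dist exchange_big -sumrN; apply: eq_bigr => k _ /=.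
  by rewrite -sumrN; apply: eq_bigr => l _; rewrite uu scalerN mulrC.
pose a' j := \sum_k P j k *: a k; pose b' j := \sum_k invmx P k j *: b k.
have car' : car a' b'.
  case: (ab_car) => aa bb ab; split=> j k; rewrite /a' /b'; [exact: anti | exact: anti |].
  rewrite !dist exchange_big /=; transitivity
      (\sum_l \sum_m (P j m * invmx P l k) *: (m == l)%:R%:M -
       \sum_l \sum_m (P j m * invmx P l k) *: (b l *m a m)).
    rewrite -sumrB; apply: eq_bigr => l _; rewrite -sumrB; apply: eq_bigr => m _.
    by rewrite ab scalerBr.
  congr (_ - _); last first.
    by apply: eq_bigr => l _; apply: eq_bigr => m _; rewrite mulrC.
  have <- : (P *m invmx P) j k = (j == k)%:R by rewrite mulmxV // mxE.
  rewrite mxE raddf_sum; apply: eq_bigr => l _; rewrite (bigD1 l) //= eqxx.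
  rewrite scale_scalar_mx mulr1 big1 ?addr0 // => m /negPf ->.
  by rewrite raddf0 scaler0.
have -> : fock a b X = \sum_j y 0 j *: (b' j *m a' j).
  rewrite /a' /b' /fock; under [RHS]eq_bigr => j _ do rewrite dist scaler_sumr.
  rewrite [RHS]exchange_big /=; apply: eq_bigr => k _.
  under [RHS]eq_bigr => j _ do rewrite scaler_sumr.
  rewrite [RHS]exchange_big /=; apply: eq_bigr => l _.
  under [RHS]eq_bigr => j _ do rewrite scalerA.
  rewrite -scaler_suml XE -mulmxA mxE; congr (_ *: _); apply: eq_bigr => j _.
  by rewrite mul_diag_mx mxE mulrCA mulrA.
exact: car_eigenvalue car' _ _ _ w0.
Qed.

End Fock.

(** * Connected groups and sums of weights *)

Section GenericMatrix.
Import mpoly.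
Variables (K : fieldType) (n : nat).
Local Notation S := {mpoly K[n * n]}.

Definition gmx : 'M[S]_n := \matrix_(i, j) 'X_(mxvec_index i j).

(** The evaluation [mxeval], with the polynomial as last argument so as to carry a ring morphism
    structure. *)
Definition mxev (A : 'M[K]_n) : S -> K := mpoly.meval (fun i => mxvec A 0 i).

HB.instance Definition _ A := GRing.RMorphism.on (mxev A).

Lemma mxevE A p : mxeval p A = mxev A p. Proof. by []. Qed.

Lemma map_gmx A : map_mx (mxev A) gmx = A.
Proof. by apply/matrixP=> i j; rewrite !mxE /mxev mevalXU mxvecE. Qed.

Lemma map_mxevC A m k (B : 'M[K]_(m, k)) : map_mx (mxev A) (map_mx (@mpolyC (n * n) K) B) = B.
Proof. by apply/matrixP=> i j; rewrite !mxE /mxev mevalC. Qed.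

Definition lift_lin d (L : 'M[K]_n -> 'M[K]_d) (Z : 'M[S]_n) : 'M[S]_d :=
  vec_mx (mxvec Z *m map_mx (@mpolyC (n * n) K) (lin_mx L)).

Lemma map_lift_lin A d (L : {linear 'M[K]_n -> 'M[K]_d}) Z :
  map_mx (mxev A) (lift_lin L Z) = L (map_mx (mxev A) Z).
Proof. by rewrite map_vec_mx map_mxM map_mxevC map_mxvec mul_vec_lin mxvecK. Qed.

(** The function [P / Q] takes finitely many values on [G]. Its level set at [v] and the union of
    the other level sets are closed, disjoint and cover [G], so one of them is all of [G]. *)
Lemma zconnected_finite (G : 'M[K]_n -> Prop) (P Q : S) (E : seq K) :
  zconnected G -> (forall A, G A -> mxev A Q != 0) ->
  (forall A, G A -> exists2 v, v \in E & mxev A P = v * mxev A Q) ->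
  forall A B v, G A -> G B -> mxev A P = v * mxev A Q -> mxev B P = v * mxev B Q.
Proof.
move=> Gcon Q0 GE A B v GA GB PA.
pose S1 (p : S) := p = P - v *: Q.
pose S2 (p : S) := p = \prod_(w <- E | w != v) (P - w *: Q).
have evZ X w : mxev X (P - w *: Q) = mxev X P - w * mxev X Q.
  by rewrite rmorphB /= /mxev mevalZ.
have [||S1G|S2G] := Gcon S1 S2.
- move=> X GX; have [w wE Pw] := GE _ GX; have [wv|wv] := eqVneq w v.
    by left=> _ ->; rewrite mxevE evZ Pw wv subrr.
  right=> _ ->; rewrite mxevE rmorph_prod (big_rem w) //= wv.
  by rewrite evZ Pw subrr mul0r.
- move=> X GX [] /(_ _ erefl); rewrite mxevE evZ => /eqP.
  rewrite subr_eq0 => /eqP PX /(_ _ erefl); rewrite mxevE rmorph_prod.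
  apply/eqP; rewrite prodf_seq_neq0; apply/allP=> w _; apply/implyP=> wv.
  by rewrite [X in X != 0]evZ PX -mulrBl mulf_neq0 ?Q0 // subr_eq0 eq_sym.
- by have := S1G _ GB _ erefl; rewrite mxevE evZ => /eqP; rewrite subr_eq0 => /eqP.
have := S2G _ GA _ erefl; rewrite mxevE rmorph_prod => /eqP.
rewrite prodf_seq_eq0 => /hasP[w _ /andP[wv /eqP/(etrans (esym (evZ _ _)))/eqP]]; rewrite PA -mulrBl mulf_eq0 (negPf (Q0 _ GA)).
by rewrite orbF subr_eq0 eq_sym (negPf wv).
Qed.

(** Writing [invmx A] as the adjugate over [\det A] exhibits the determinant as a quotient of
    polynomials with denominator [\det A ^+ d]. *)
Lemma zconnected_det_conj (G : 'M[K]_n -> Prop) d (L : {linear 'M[K]_n -> 'M[K]_d})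
    (y : 'M[K]_n) t (E : seq K) :
  zconnected G -> (forall A, G A -> A \in unitmx) ->
  (forall A, G A -> \det (t%:M - L (invmx A *m y *m A)) \in E) ->
  forall A B, G A -> G B ->
  \det (t%:M - L (invmx A *m y *m A)) = \det (t%:M - L (invmx B *m y *m B)).
Proof.
move=> Gcon Gu GE A B GA GB.
pose Q : S := \det gmx ^+ d.
pose P : S := \det ((t%:MP * \det gmx)%:M -
   lift_lin L (\adj gmx *m map_mx (@mpolyC (n * n) K) y *m gmx)).
have evdet X : mxev X (\det gmx) = \det X by rewrite -det_map_mx map_gmx.
have evQ X : mxev X Q = \det X ^+ d by rewrite rmorphXn /= evdet.
have evP X : X \in unitmx -> mxev X P = \det (t%:M - L (invmx X *m y *m X)) * mxev X Q.
  move=> Xu; rewrite evQ -det_map_mx map_mxB map_scalar_mx /= rmorphM /= evdet map_lift_lin.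
  rewrite !map_mxM map_mx_adj !map_gmx map_mxevC /mxev mevalC.
  have ->: \adj X = \det X *: invmx X by rewrite /invmx Xu scalerA divff ?scale1r // -unitfE.
  rewrite -!scalemxAl linearZ /= mulrC -scale_scalar_mx -scalerBr detZ; exact: mulrC.
have := @zconnected_finite G P Q E Gcon _ _ A B _ GA GB (evP _ (Gu _ GA)).
rewrite evP ?Gu //; move=> /(_ _ _)/mulIf => -> //.
- by rewrite evQ expf_neq0 // -unitfE; exact: Gu GB.
- by move=> X GX; rewrite evQ expf_neq0 // -unitfE; exact: Gu GX.
by move=> X GX; exists (\det (t%:M - L (invmx X *m y *m X))); [exact: GE | rewrite evP ?Gu].
Qed.
End GenericMatrix.

(** Gives a matrix to a submodule that is only described by a predicate. Rows are added while some
    vector of [P] lies outside the row space; the codimension bounds the number of steps. *)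
Lemma subspace_mx (F : fieldType) N (P : 'rV[F]_N -> Prop) :
  P 0 -> (forall c v w, P v -> P w -> P (c *: v + w)) ->
  exists M : 'M[F]_N, forall w, P w <-> (w <= M)%MS.
Proof.
move=> P0 PD.
have PS (M : 'M[F]_N) : (forall i, P (row i M)) -> forall w, (w <= M)%MS -> P w.
  move=> PM w /submxP[u ->]; rewrite mulmx_sum_row.
  apply: (big_ind P) => // [v1 v2 ? ?|i _]; first by rewrite -[v1]scale1r; apply: (PD).
  by rewrite -[_ *: _]addr0; apply: PD.
suff H k : forall M : 'M[F]_N, (forall i, P (row i M)) -> (N - \rank M <= k)%N ->
    exists M : 'M[F]_N, forall w, P w <-> (w <= M)%MS.
  by apply: (H N 0) => [i|]; rewrite ?row0 ?leq_subr.
elim: k => [|k IH] M PM rk.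
  exists M => w; split=> [_|]; last exact: PS.
  by rewrite submx_full // /row_full eqn_leq rank_leq_row -subn_eq0 -leqn0.
have [[w [Pw wM]]|nex] := pselect (exists w, P w /\ ~~ (w <= M)%MS); last first.
  exists M => w; split=> [Pw|]; last exact: PS.
  by apply: contrapT => /negP wM; apply: nex; exists w.
apply: (IH (M + w)%MS).
  move=> i; have: (row i (M + w)%MS <= M + w)%MS by exact: row_sub.
  case/sub_addsmxP=> [[u1 u2] /= ->]; rewrite -[u1 *m M]scale1r; apply: (PD).
    by apply: PS (submxMl _ _).
  by rewrite [u2]mx11_scalar mul_scalar_mx -[_ *: _]addr0; apply: PD.
have: (\rank M < \rank (M + w)%MS)%N.
  apply: rank_ltmx; rewrite ltmxE addsmxSl /=; apply: contra wM; apply: submx_trans.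
  exact: addsmxSr.
have := rank_leq_row (M + w)%MS; lia.
Qed.

Lemma horner_char_poly (F : comNzRingType) d (A : 'M[F]_d) t :
  (char_poly A).[t] = \det (t%:M - A).
Proof.
rewrite /char_poly -[LHS]/(horner_eval t _) -det_map_mx; congr (\det _).
apply/matrixP=> i j; rewrite !mxE /= /horner_eval hornerD hornerN hornerC.
by rewrite hornerMn hornerX.
Qed.

(** * The module generated by a highest weight vector *)

Section HighestWeight.
Variables (R : rcfType) (n : nat).
Local Notation C := R[i].
Local Notation rc := (real_complex R).
Local Notation diagC x := (diag_mx (map_mx (real_complex R) x)).
Variables (l : 'M[C]_n -> Prop) (s x y : 'rV[R]_n).

(** Eigenvectors of eigenvalue [r] for the commutator with the diagonal matrix of [s]; see
    [diagC_homog]. *)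
Definition homog (r : R) (X : 'M[C]_n) := forall j k, X j k != 0 -> s 0 j - s 0 k = r.

Definition hcomp (r : R) (X : 'M[C]_n) : 'M[C]_n :=
  \matrix_(j, k) (if s 0 j - s 0 k == r then X j k else 0).

Hypothesis l_comm : forall X Y, l X -> l Y -> l (X *m Y - Y *m X).
Hypothesis l_hcomp : forall r X, l X -> l (hcomp r X).
Hypothesis l_homog0 : forall X, l X -> homog 0 X -> is_diag_mx X.
Hypothesis x_dom : forall r X, l X -> homog r X -> 0 < r ->
  forall j k, X j k != 0 -> x 0 k <= x 0 j.

Let hcompE X : X = \sum_(r <- undup [seq s 0 p.1 - s 0 p.2 | p : 'I_n * 'I_n]) hcomp r X.
Proof.
apply/matrixP=> j k; rewrite summxE (bigD1_seq (s 0 j - s 0 k)) ?undup_uniq //=; last first.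
  by rewrite mem_undup; apply/mapP; exists (j, k); rewrite ?mem_enum.
by rewrite mxE eqxx big1 ?addr0 // => r /negPf rjk; rewrite mxE eq_sym rjk.
Qed.

Let homog_hcomp r X : homog r (hcomp r X).
Proof. by move=> j k; rewrite mxE; case: (_ =P r) => // _; rewrite eqxx. Qed.

Let homog_comm r r' X Y : homog r X -> homog r' Y -> homog (r + r') (X *m Y - Y *m X).
Proof.
move=> hX hY j k; rewrite !mxE => nz.
have [[m]|] := pselect (exists m, X j m * Y m k != 0 \/ Y j m * X m k != 0).
  rewrite !mulf_eq0 !negb_or => -[/andP[/hX <- /hY <-]|/andP[/hY <- /hX <-]]; ring.
move=> nex; move: nz; rewrite !big1 ?subrr ?eqxx // => m _; apply/eqP/negPn/negP => nz;
  by apply: nex; exists m; auto.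
Qed.

Variables (N : nat) (a b : 'I_n -> 'M[C]_N) (occ : 'I_n -> 'I_N -> bool).
Hypothesis ab_car : car a b.
Hypothesis ba_occ : forall j, b j *m a j = diag_mx (\row_t (occ j t)%:R).
Local Notation rho := (fock a b).

Definition fweight (z : 'rV[R]_n) (t : 'I_N) : R := \sum_(j | occ j t) z 0 j.

Lemma fock_diagE z : rho (diagC z) = diag_mx (\row_t rc (fweight z t)).
Proof.
rewrite (fock_diag _ ba_occ); congr diag_mx; apply/rowP=> t; rewrite !mxE /fweight.
rewrite [in RHS]big_mkcond /= raddf_sum; apply: eq_bigr => j _; rewrite !mxE.
by case: (occ j t); rewrite ?mulr1 ?mulr0.
Qed.

(** Some [b j *m a k] has a nonzero entry at this place. For every [z] it is an eigenvector of the
    commutator with [rho (diagC z)], with eigenvalue [z 0 j - z 0 k]; comparing entries gives the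
    shift, with [j] and [k] independent of [z]. *)
Lemma fock_shift X t t' : rho X t t' != 0 ->
  exists j k, X j k != 0 /\ forall z, fweight z t - fweight z t' = z 0 j - z 0 k.
Proof.
move=> nz; have [[j [k [Xjk bajk]]]|nex] :=
    pselect (exists j k, X j k != 0 /\ (b j *m a k) t t' != 0); last first.
  move: nz; rewrite /fock summxE big1 ?eqxx // => j _; rewrite summxE big1 // => k _.
  rewrite mxE; apply/eqP/negPn/negP; rewrite mulf_eq0 negb_or => /andP[? ?].
  by apply: nex; exists j, k.
exists j, k; split=> // z.
have deltaE : rho (delta_mx j k) = b j *m a k.
  rewrite /fock (bigD1 j) //= (bigD1 k) //= mxE !eqxx scale1r.
  rewrite !big1 ?addr0 // => [j' jj'|k' kk'].
    by rewrite big1 // => k' _; rewrite mxE (negPf jj') scale0r.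
  by rewrite mxE (negPf kk') andbF scale0r.
have /matrixP/(_ t t') := fock_comm ab_car (diagC z) (delta_mx j k).
have -> : diagC z *m delta_mx j k - delta_mx j k *m diagC z =
    rc (z 0 j - z 0 k) *: delta_mx j k.
  rewrite mul_diag_mx mul_mx_diag; apply/matrixP=> p q; rewrite !mxE rmorphB.
  case: (p =P j) => [->|_]; case: (q =P k) => [->|_]; rewrite /= ?mulr1 ?mulr0 ?mul0r ?mul1r ?subrr //.
rewrite linearZ /= deltaE fock_diagE mul_diag_mx mul_mx_diag !mxE => E.
have {}E : (rc (fweight z t) - rc (fweight z t') - rc (z 0 j - z 0 k)) * (b j *m a k) t t' = 0.
  by rewrite mulrBl mulrBl !mxE E; ring.
move/eqP: E; rewrite mulf_eq0 (negPf bajk) orbF -!rmorphB /= => /eqP/complexI /eqP.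
by rewrite subr_eq0 => /eqP.
Qed.

Variables (c : R) (v : 'rV[C]_N).
Let I j := c <= s 0 j.
Hypothesis v_nz : v != 0.
Hypothesis v_top : forall j, if I j then v *m a j = 0 else v *m b j = 0.

Let vba_diag j : v *m (b j *m a j) = (I j)%:R *: v.
Proof.
have := v_top j; case: ifP => _ E; last by rewrite mulmxA E mul0mx scale0r.
have : a j *m b j + b j *m a j = 1%:M by case: ab_car => _ _ ->; rewrite eqxx subrK.
by move/(canRL (addKr _)) ->; rewrite mulmxDr mulmxN mulmxA E mul0mx oppr0 add0r mulmx1 scale1r.
Qed.

(** The occupied indices [I] form an upper set for [s]. If [X j k] is nonzero then [s 0 j < s 0 k],
    so [j] occupied implies [k] occupied, and [b j *m a k] kills [v] in either case. *)
Let v_neg r X : r < 0 -> homog r X -> v *m rho X = 0.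
Proof.
move=> r0 hX; rewrite mulmx_sumr big1 // => j _; rewrite mulmx_sumr big1 // => k _.
rewrite -scalemxAr; have [->|/hX sjk] := eqVneq (X j k) 0; first by rewrite scale0r.
have := v_top j; case: ifP => Ij E; last by rewrite mulmxA E mul0mx scaler0.
have := v_top k; rewrite (_ : I k) => [Ek|]; last by move: Ij; rewrite /I; lra.
have jk : k != j by apply: contraTneq r0 => kj; rewrite -sjk kj subrr ltxx.
have : a k *m b j + b j *m a k = 0 by case: ab_car => _ _ ->; rewrite (negPf jk) raddf0 sub0r addNr.
by move/eqP; rewrite addrC addr_eq0 => /eqP ->; rewrite mulmxN mulmxA Ek mul0mx oppr0 scaler0.
Qed.

Let v_diag X : is_diag_mx X -> exists m, v *m rho X = m *: v.
Proof.
move=> /is_diag_mxP dX; exists (\sum_j X j j * (I j)%:R).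
rewrite mulmx_sumr scaler_suml; apply: eq_bigr => j _; rewrite (bigD1 j) //= mulmxDr.
rewrite big1 ?mulmx0 ?addr0 => [|k kj]; last by rewrite dX ?scale0r // eq_sym.
by rewrite -scalemxAr vba_diag scalerA.
Qed.

(** Row vectors are acted on from the right, so operators of positive degree lower the [s]-weight
    and [v] is the highest weight vector. *)
Inductive hwspan : 'rV[C]_N -> Prop :=
| hwspan_v : hwspan v
| hwspan_lin m w w' : hwspan w -> hwspan w' -> hwspan (m *: w + w')
| hwspan_step r X w : hwspan w -> l X -> homog r X -> 0 < r -> hwspan (w *m rho X).

Let hwspan0 : hwspan 0.
Proof. by rewrite -[0](addNr v) -scaleN1r; apply: hwspan_lin; exact: hwspan_v. Qed.

Let hwspanZ m w : hwspan w -> hwspan (m *: w).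
Proof. by move=> hw; rewrite -[_ *: _]addr0; apply: hwspan_lin. Qed.

Let hwspanD w w' : hwspan w -> hwspan w' -> hwspan (w + w').
Proof. by move=> hw hw'; rewrite -[w]scale1r; apply: hwspan_lin. Qed.

(* As for highest weight modules, operators of nonpositive degree are commuted
   past those of positive degree until they reach [v]. *)
Let hwspan_homog w : hwspan w -> forall r X, l X -> homog r X -> hwspan (w *m rho X).
Proof.
elim=> [|m w1 w2 _ IH1 _ IH2|r1 Y w1 hw1 IH lY hY r1pos] r X lX hX.
- have [r0|r0|r0] := ltrgtP r 0; first by rewrite (v_neg r0 hX).
    exact: hwspan_step hwspan_v lX hX r0.
  by have [|m ->] := @v_diag X; [apply: l_homog0; rewrite -?r0 | apply/hwspanZ/hwspan_v].
- by rewrite mulmxDl -scalemxAl; apply: hwspan_lin; [exact: IH1 hX | exact: IH2 hX].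
have -> : w1 *m rho Y *m rho X = w1 *m rho X *m rho Y + w1 *m rho (Y *m X - X *m Y).
  by rewrite (fock_comm ab_car) mulmxBr !mulmxA addrC subrK.
apply: hwspanD; first exact: hwspan_step (IH _ _ lX hX) lY hY r1pos.
by apply: (IH (r1 + r)); [exact: l_comm | exact: homog_comm].
Qed.

Lemma hwspan_stable w X : hwspan w -> l X -> hwspan (w *m rho X).
Proof.
move=> hw lX; rewrite (hcompE X) (linear_sum (fock a b)) mulmx_sumr /=.
apply: (big_ind hwspan) => [|w1 w2|r _]; [exact: hwspan0 | exact: hwspanD |].
by apply: (hwspan_homog hw (r := r)); [exact: l_hcomp | exact: homog_hcomp].
Qed.

Lemma hwspan_v_weight z : v *m rho (diagC z) = rc (\sum_(j | c <= s 0 j) z 0 j) *: v.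
Proof.
rewrite mulmx_sumr raddf_sum scaler_suml [in RHS]big_mkcond /=; apply: eq_bigr => j _.
rewrite (bigD1 j) //= mulmxDr big1 ?mulmx0 ?addr0 => [|k kj]; last first.
  by rewrite mxE eq_sym (negPf kj) mulr0n scale0r.
rewrite -scalemxAr vba_diag scalerA !mxE eqxx mulr1n /I.
by case: ifP => _; rewrite ?mulr1 ?mulr0 ?scale0r.
Qed.

(** The bound is the [x]-weight of [v]. Each step of positive degree subtracts some [x 0 j - x 0 k],
    which is nonnegative by dominance. *)
Lemma hwspan_weight w t : hwspan w -> w 0 t != 0 ->
  fweight x t <= \sum_(j | c <= s 0 j) x 0 j.
Proof.
move=> hw; elim: hw t => [|m w1 w2 _ IH1 _ IH2|r X w1 _ IH lX hX r0] t.
- move=> vt; have /rowP/(_ t) := hwspan_v_weight x.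
  rewrite fock_diagE mul_mx_diag !mxE mulrC => /(mulIf vt)/complexI ->.
  exact: lexx.
- rewrite !mxE => nz; have [w1t|/IH1//] := eqVneq (w1 0 t) 0.
  by apply: IH2; move: nz; rewrite w1t mulr0 add0r.
rewrite mxE => nz; have [[t']|nex] := pselect (exists t', w1 0 t' * rho X t' t != 0).
  rewrite mulf_eq0 negb_or => /andP[/IH le1 /fock_shift[j [k [Xjk /(_ x) E]]]].
  by have := x_dom lX hX r0 Xjk; lra.
by move: nz; rewrite big1 ?eqxx // => t' _; apply/eqP/negPn/negP => nz; apply: nex; exists t'.
Qed.

End HighestWeight.

Section FockSub.
Variables (F : numFieldType) (n N d : nat) (a b : 'I_n -> 'M[F]_N) (P : 'M[F]_n) (B : 'M[F]_(d, N)).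

(** The restriction of the Fock operator to the row space of [B], in the coordinates given by its
    rows. It is meaningful when that space is stable, but defined and linear for every [X], as
    [zconnected_det_conj] requires. *)
Definition fock_sub (X : 'M[F]_n) : 'M[F]_d :=
  B *m fock a b (P *m X *m invmx P) *m pinvmx B.

Lemma fock_sub_linear c X Y : fock_sub (c *: X + Y) = c *: fock_sub X + fock_sub Y.
Proof.
by rewrite /fock_sub mulmxDr mulmxDl -scalemxAr -scalemxAl linearP mulmxDr mulmxDl -scalemxAr -scalemxAl.
Qed.

HB.instance Definition _ := GRing.isLinear.Build F 'M[F]_n 'M[F]_d _ fock_sub fock_sub_linear.
End FockSub.

Section WeightSum.
Variables (R : rcfType) (n : nat).
Local Notation C := R[i].
Local Notation rc := (real_complex R).
Local Notation diagC x := (diag_mx (map_mx rc x)).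

(** Over the algebraically closed field the determinant is the product of [t - r] over the [d]
    eigenvalues [r], each a subset sum; there are finitely many ways to choose the subsets. *)
Lemma det_finite (d : nat) (A : 'M[C]_d) (y : 'rV[C]_n) t :
  (forall r (w : 'rV_d), w != 0 -> w *m A = r *: w -> exists S : {set 'I_n}, r = \sum_(j in S) y 0 j) ->
  \det (t%:M - A) \in [seq \prod_i (t - \sum_(j in f i) y 0 j) | f : {ffun 'I_d -> {set 'I_n}}].
Proof.
move=> eigA; rewrite -horner_char_poly.
have [r Er] := closed_field_poly_normal (char_poly A).
rewrite (monicP (char_poly_monic A)) scale1r in Er.
have szr : size r = d.
  by have := size_char_poly A; rewrite Er size_prod_XsubC => -[].
have rS (i : 'I_d) : exists S : {set 'I_n}, r`_i = \sum_(j in S) y 0 j.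
  have : root (char_poly A) r`_i by rewrite Er root_prod_XsubC mem_nth ?szr.
  by rewrite -eigenvalue_root_char => /eigenvalueP[w wA w0]; exact: eigA w0 wA.
have [f fE] := fin_all_exists rS.
apply/mapP; exists [ffun i => f i]; first by rewrite mem_enum.
rewrite Er horner_prod (big_nth 0) szr big_mkord; apply: eq_bigr => i _.
by rewrite hornerXsubC ffunE fE.
Qed.

Variables (l : 'M[C]_n -> Prop) (s x y : 'rV[R]_n).
Hypothesis l_comm : forall X Y, l X -> l Y -> l (X *m Y - Y *m X).
Hypothesis l_hcomp : forall r X, l X -> l (hcomp s r X).
Hypothesis l_homog0 : forall X, l X -> homog s 0 X -> is_diag_mx X.
Hypothesis x_dom : forall r X, l X -> homog s r X -> 0 < r ->
  forall j k, X j k != 0 -> x 0 k <= x 0 j.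
Variables (P : 'M[C]_n) (G : 'M[C]_n -> Prop).
Hypothesis Pu : P \in unitmx.
Hypothesis Gcon : zconnected G.
Hypothesis G1 : G 1%:M.
Hypothesis Gu : forall A, G A -> A \in unitmx.
Hypothesis Gl : forall A X, G A -> l X ->
  l (P *m (invmx A *m (invmx P *m X *m P) *m A) *m invmx P).
Hypothesis ly : l (diagC y).

(* On the module generated by the wedge of the weight vectors [j] with
   [c <= s 0 j], the right-hand side is the largest weight of [x]. The left-hand
   side is an eigenvalue of [y] there, hence of every [A^-1 y A] with [A] in [G]:
   the determinants expressing this take finitely many values on the connected
   group [G]. For [A = u] the latter operator is [x] plus a part raising the
   weights of [x]. *)
Lemma weight_sum_le u Z c : G u ->
  P *m (invmx u *m (invmx P *m diagC y *m P) *m u) *m invmx P = diagC x + Z ->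
  (forall j k, Z j k != 0 -> x 0 k < x 0 j) ->
  \sum_(j | c <= s 0 j) y 0 j <= \sum_(j | c <= s 0 j) x 0 j.
Proof.
move=> Guu uE Zpos.
have [N [a [b [occ [ab ba vI]]]]] := fock_space C n.
have [v v0 vtop] := vI (fun j => c <= s 0 j).
pose hw := hwspan l s a b v.
have [M hwM] : exists M : 'M_N, forall w, hw w <-> (w <= M)%MS.
  apply: subspace_mx => [|m w w']; last exact: hwspan_lin.
  by rewrite -[0](addNr v) -scaleN1r; apply: hwspan_lin; exact: hwspan_v.
have [B eqBM freeB] : exists2 B : 'M_(\rank M, N), (B :=: M)%MS & row_free B.
  by exists (row_base M); [exact: eq_row_base | exact: row_base_free].
pose L := fock_sub a b P B; pose Y := invmx P *m diagC y *m P.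
have stabB X : l (P *m X *m invmx P) -> (B *m fock a b (P *m X *m invmx P) <= B)%MS.
  move=> lX; apply/row_subP=> i; rewrite row_mul eqBM; apply/hwM.
  apply: (hwspan_stable l_comm l_hcomp l_homog0 ab vtop _ lX); apply/hwM.
  by have := row_sub i B; rewrite eqBM.
have LE X : l (P *m X *m invmx P) -> L X *m B = B *m fock a b (P *m X *m invmx P).
  by move=> lX; rewrite /L /fock_sub mulmxKpV ?stabB.
have PK X : P *m (invmx P *m X *m P) *m invmx P = X.
  by rewrite !mulmxA mulmxV // mul1mx -mulmxA mulmxV // mulmx1.
have inB w : (w *m B == 0) = (w == 0) :> bool.
  by apply/eqP/eqP=> [E|->]; rewrite ?mul0mx //; apply: (row_free_inj freeB); rewrite mul0mx.
have lA A : G A -> l (P *m (invmx A *m Y *m A) *m invmx P) by move=> GA; exact: Gl.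
pose t := rc (\sum_(j | c <= s 0 j) y 0 j).
pose E := [seq \prod_i (t - \sum_(j in f i) (map_mx rc y) 0 j)
              | f : {ffun 'I_(\rank M) -> {set 'I_n}}].
have detE A : G A -> \det (t%:M - L (invmx A *m Y *m A)) \in E.
  move=> GA; apply: det_finite => r w w0 wL.
  apply: (@fock_eigenvalue _ n N a b (P *m A *m invmx P) (map_mx rc y)
    (P *m (invmx A *m Y *m A) *m invmx P) r (w *m B)) => //.
  - by rewrite !unitmx_mul unitmx_inv Pu Gu.
  - have Au := Gu GA; set T := P *m A *m invmx P.
    have Tu : T \in unitmx by rewrite !unitmx_mul unitmx_inv Pu Au.
    have -> : invmx T = P *m invmx A *m invmx P.
      rewrite -[RHS](mulKmx Tu) /T !mulmxA mulmxKV //.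
      by rewrite !mulmxK.
    by rewrite /T /Y !mulmxA.
  - by rewrite inB.
  by rewrite -[w *m B *m _]mulmxA -(LE _ (lA _ GA)) (mulmxA w) wL scalemxAl.
have det1 : \det (t%:M - L (invmx 1%:M *m Y *m 1%:M)) = 0.
  apply/eqP/det0P; have /submxP[w vw] : (v <= B)%MS.
    by rewrite eqBM; apply/hwM; exact: hwspan_v.
  exists w; first by rewrite -inB -vw.
  rewrite mulmxBr mul_mx_scalar; apply/eqP; rewrite subr_eq0 -subr_eq0 -inB mulmxBl subr_eq0.
  rewrite -scalemxAl -[w *m _ *m B]mulmxA (LE _ (lA _ G1)) (mulmxA w) -vw invmx1 mul1mx mulmx1 PK.
  by rewrite (hwspan_v_weight ab vtop).
have detu : \det (t%:M - L (invmx u *m Y *m u)) = 0.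
  exact: etrans (esym (zconnected_det_conj Gcon Gu detE G1 Guu)) det1.
have /eqP/det0P[w w0 wL] := detu.
set q := w *m B.
have qnz : q != 0 by rewrite inB.
have hwq : hw q by apply/hwM; rewrite -eqBM submxMl.
have {}wL : q *m fock a b (diagC x) + q *m fock a b Z = t *: q.
  rewrite -mulmxDr -linearD /= -uE /q -[w *m B *m _]mulmxA -(LE _ (lA _ Guu)) (mulmxA w) scalemxAl; congr (_ *m B).
  by apply/eqP; rewrite eq_sym -subr_eq0 -mul_mx_scalar -mulmxBr wL.
clearbody q; have /rV0Pn[t0 qt0] := qnz.
(* At an index [t1] of maximal [x]-weight in the support of the eigenvector [q], a contribution of
   [Z] would come from an index of larger weight. So [t] is the [x]-weight of [t1], which
   [hwspan_weight] bounds. *)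
have [t1 qt1 t1max] := arg_maxP (fweight occ x) (P := fun t => q 0 t != 0) qt0.
have Zq : (q *m fock a b Z) 0 t1 = 0.
  rewrite mxE big1 // => t2 _; apply/eqP/negPn/negP; rewrite mulf_eq0 negb_or => /andP[qt2].
  move=> /(fock_shift ab ba)[j [k [/Zpos Zjk /(_ x) E2]]].
  by have := t1max t2 qt2; rewrite /= leNgt -subr_gt0 E2 subr_gt0 Zjk.
have /rowP/(_ t1) := wL; rewrite mxE Zq addr0 (fock_diagE ba) mul_mx_diag !mxE mulrC.
move=> /(mulIf qt1) E3; have <- := complexI E3.
exact: (hwspan_weight x_dom ab ba vtop hwq qt1).
Qed.
End WeightSum.

(** * Tangent spaces of linear groups *)

Section PolynomialInduction.
Import mpoly.

Lemma mpoly_ring_ind (K : comNzRingType) N (Pr : {mpoly K[N]} -> Prop) :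
  (forall c, Pr c%:MP) -> (forall i, Pr 'X_i) ->
  (forall p q, Pr p -> Pr q -> Pr (p + q)) -> (forall p q, Pr p -> Pr q -> Pr (p * q)) ->
  forall p, Pr p.
Proof.
move=> PC PX PD PM; elim/mpolyind => [|c m p _ _ Pp]; first by rewrite -mpolyC0; apply: PC.
apply: (PD) => //; rewrite -mul_mpolyC; apply: (PM); first exact: PC.
rewrite mpolyXE_id; apply: (big_ind Pr) => [|p1 q1|i _]; [by rewrite -mpolyC1; apply: PC|exact: PM|].
elim: (m i) => [|k IH]; first by rewrite expr0 -mpolyC1; apply: PC.
by rewrite exprS; apply: (PM).
Qed.

End PolynomialInduction.

Section Derivations.
Import mpoly.
Variables (K : fieldType) (n : nat).
Local Notation S := {mpoly K[n * n]}.
Implicit Types (p q : S) (A B X Y : 'M[K]_n).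

Definition mxdir X B p : K := \sum_i mxvec X 0 i * mxev B p^`M(i).

Lemma mxdirC X B c : mxdir X B c%:MP = 0.
Proof. by rewrite /mxdir big1 // => i _; rewrite mderivC rmorph0 mulr0. Qed.

Lemma mxdirD X B p q : mxdir X B (p + q) = mxdir X B p + mxdir X B q.
Proof.
by rewrite -big_split; apply: eq_bigr => i _; rewrite mderivD rmorphD mulrDr.
Qed.

Lemma mxdirM X B p q : mxdir X B (p * q) = mxdir X B p * mxev B q + mxev B p * mxdir X B q.
Proof.
rewrite /mxdir mulr_suml mulr_sumr -big_split; apply: eq_bigr => i _ /=.
by rewrite mderivM rmorphD !rmorphM /=; ring.
Qed.

Lemma mxevZ B c p : mxev B (c *: p) = c * mxev B p.
Proof. by rewrite /mxev mevalZ. Qed.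

Lemma mxevXU B k : mxev B 'X_k = mxvec B 0 k.
Proof. by rewrite /mxev mevalXU. Qed.

Lemma mxdirXU X B k : mxdir X B 'X_k = mxvec X 0 k.
Proof.
rewrite /mxdir (bigD1 k) //= big1 => [|i ik]; rewrite mderivX mnm1E.
  rewrite eqxx scale1r addr0 (_ : (U_(k) - U_(k))%MM = 0%MM).
    by rewrite mpolyX0 rmorph1 mulr1.
  by apply/mnmP=> j; rewrite mnmBE mnm0E subnn.
by rewrite eq_sym (negPf ik) scale0r rmorph0 mulr0.
Qed.

Definition lincomp (T : 'M[K]_n -> 'M[K]_n) p : S :=
  p \mPo [tuple mxvec (lift_lin T (gmx K n)) 0 k | k < n * n].

Lemma mxev_lincomp (T : {linear 'M[K]_n -> 'M[K]_n}) B p :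
  mxev B (lincomp T p) = mxev (T B) p.
Proof.
rewrite /mxev /lincomp comp_mpoly_meval; apply: meval_eq => k.
rewrite tnth_mktuple -/(mxev B _).
have := map_lift_lin B T (gmx K n); rewrite map_gmx => <-.
by rewrite -map_mxvec mxE.
Qed.

Lemma mxdir_lincomp (T : {linear 'M[K]_n -> 'M[K]_n}) X B p :
  mxdir X B (lincomp T p) = mxdir (T X) (T B) p.
Proof.
elim/mpoly_ring_ind: p => [c|k|p q IHp IHq|p q IHp IHq].
- by rewrite /lincomp comp_mpolyC !mxdirC.
- rewrite mxdirXU /lincomp comp_mpolyXU -tnth_nth tnth_mktuple.
  rewrite /lift_lin vec_mxK mxE -[RHS]/((mxvec (T X)) 0 k) -mul_vec_lin mxE.
  have sumdir (I : finType) (F : I -> S) :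
      mxdir X B (\sum_i F i) = \sum_i mxdir X B (F i).
    by apply: (big_morph _ (mxdirD X B)); rewrite -mpolyC0 mxdirC.
  rewrite sumdir; apply: eq_bigr => i _; rewrite mxdirM.
  rewrite [map_mx _ _ _ _]mxE mxdirC mulr0 addr0 /mxev mevalC; congr (_ * _).
  by case/mxvec_indexP: i => a b; rewrite !mxvecE mxE mxdirXU mxvecE.
- by rewrite /lincomp comp_mpolyD !mxdirD -/(lincomp T p) -/(lincomp T q) IHp IHq.
rewrite /lincomp rmorphM /= !mxdirM -/(lincomp T p) -/(lincomp T q) IHp IHq.
by rewrite !mxev_lincomp.
Qed.

(* The left-invariant derivation of the coordinate ring of GL_n with value [Y]
   at the identity. *)
Definition mxder Y p : S :=
  \sum_i mxvec (gmx K n *m map_mx (@mpolyC (n * n) K) Y) 0 i * p^`M(i).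

Lemma mxev_der A Y p : mxev A (mxder Y p) = mxdir (A *m Y) A p.
Proof.
rewrite rmorph_sum; apply: eq_bigr => i _; rewrite rmorphM /=; congr (_ * _).
case/mxvec_indexP: i => a b; rewrite !mxvecE.
have : map_mx (mxev A) (gmx K n *m map_mx (@mpolyC (n * n) K) Y) = A *m Y.
  by rewrite map_mxM map_gmx map_mxevC.
by move/matrixP/(_ a b) => <-; rewrite [RHS]mxE.
Qed.

(** The coefficients of the derivation are linear forms and partial derivatives lower the degree, so
    degrees do not grow. [msize] is the degree plus one, whence the bound 2 on the coefficients. *)
Lemma msize_mxder Y p d : (msize p <= d)%N -> (msize (mxder Y p) <= d)%N.
Proof.
move=> pd; apply: (big_ind (fun q : S => msize q <= d)%N) => [|p1 q1 h1 h2|i _].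
- by rewrite msize0.
- by rewrite (leq_trans (msizeD_le _ _)) // geq_max h1.
set l := mxvec _ 0 i; have [->|l0] := eqVneq l 0; first by rewrite mul0r msize0.
have [->|p0] := eqVneq (p^`M(i)) 0; first by rewrite mulr0 msize0.
rewrite msizeM //.
have lsz : (msize l <= 2)%N.
  rewrite /l; case/mxvec_indexP: i {l l0 p0} => a b; rewrite mxvecE mxE.
  apply: (big_ind (fun q : S => msize q <= 2)%N) => [|p1 q1 h1 h2|j _].
  - by rewrite msize0.
  - by rewrite (leq_trans (msizeD_le _ _)) // geq_max h1.
  by rewrite !mxE mulrC mul_mpolyC (leq_trans (msizeZ_le _ _)) // msizeX mdeg1.
have : (msize (p^`M(i)) < msize p)%N.
  rewrite [X in (X < _)%N]msizeE -ltnS.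
  have p1 : (0 < msize p)%N.
    by rewrite lt0n msize_poly_eq0; apply: contraNneq p0 => ->; rewrite mderiv0.
  rewrite -(prednK p1) ltnS ltnS; apply/bigmax_leqP_seq => m mp _.
  have : (m + U_(i))%MM \in msupp p.
    by move: mp; rewrite !mcoeff_msupp mcoeff_mderiv; apply: contraNneq => ->; rewrite mul0rn.
  move/msize_mdeg_lt; rewrite mdegD mdeg1 addn1; lia.
by move: lsz pd; move: (msize l) (msize p^`M(i)) (msize p) => x y z; lia.
Qed.

(** The iterates stay in the finite-dimensional space of polynomials of bounded degree, hence are
    linearly dependent; dividing a relation by its last nonzero coefficient gives the recurrence. *)
Lemma mxder_recurrence Y p : exists r (c : 'I_r -> K),
  iter r (mxder Y) p = \sum_(i < r) c i *: iter i (mxder Y) p.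
Proof.
pose d := msize p; pose N := #|{: bmultinom (n * n) d}|.
have szD i : (msize (iter i (mxder Y) p) <= d)%N.
  by elim: i => [|i IH] //=; apply: msize_mxder.
pose V : 'M[K]_(N.+1, N) :=
    \matrix_(i, j) (iter i (mxder Y) p)@_(enum_val (j : 'I_#|{: bmultinom (n * n) d}|)).
have : (kermx V != 0).
  by rewrite -mxrank_eq0 mxrank_ker subn_eq0 -ltnNge ltnS rank_leq_col.
case/rowV0Pn => w /sub_kermxP wV w0.
have rel : \sum_(i < N.+1) w 0 i *: iter i (mxder Y) p = 0.
  apply/mpolyP=> m; rewrite mcoeff0 raddf_sum /=.
  have [md|md] := ltnP (mdeg m) d.
    have /rowP/(_ (enum_rank (BMultinom md))) := wV; rewrite !mxE => E.
    rewrite -[RHS]E; apply: eq_bigr => i _.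
    by rewrite mcoeffZ mxE enum_rankK.
  rewrite big1 // => i _; rewrite mcoeffZ memN_msupp_eq0 ?mulr0 //.
  by rewrite msize_mdeg_ge // (leq_trans (szD i)).
have /rV0Pn[i0 wi0] := w0.
have [r wr rmax] := arg_maxnP (fun i : 'I_N.+1 => i) (P := fun i => w 0 i != 0) wi0.
exists r, (fun i => - (w 0 (widen_ord (ltnW (ltn_ord r)) i) / w 0 r)).
apply: (scalerI wr); rewrite scaler_sumr; apply/eqP; rewrite -subr_eq0 -sumrN -[X in _ == X]rel.
apply/eqP; rewrite [LHS]addrC [RHS](bigID (fun i : 'I_N.+1 => (i < r)%N)) /=; congr (_ + _).
  rewrite (big_ord_narrow (ltnW (ltn_ord r))) /=; apply: eq_bigr => i _.
  by rewrite scalerA mulrN mulrCA divff // mulr1 scaleNr opprK.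
rewrite (bigD1 r) ?ltnn //= big1 ?addr0 // => i /andP[ir ri].
have [->|wi] := eqVneq (w 0 i) 0; first by rewrite scale0r.
have /= ler := rmax _ wi.
by case/negP: ri; rewrite -val_eqE /= eqn_leq ler leqNgt ir.
Qed.

Section TangentSpace.
Variable G : 'M[K]_n -> Prop.
Hypothesis Galg : algebraic_group G.

Lemma group_lie_algebraE X :
  group_lie_algebra G X <-> forall p, vanishes_on p G -> mxdir X 1%:M p = 0.
Proof. by []. Qed.

(** The linear map [B |-> invmx A *m B *m A] preserves [G] and fixes the identity, so pulling back
    along it keeps the polynomials vanishing on [G]; the chain rule [mxdir_lincomp] does the
    rest. *)
Lemma group_lie_algebra_conj A X : G A -> group_lie_algebra G X ->
  group_lie_algebra G (invmx A *m X *m A).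
Proof.
case: Galg => Gu G1 GM GV _ GA lX; apply/group_lie_algebraE => p pG.
pose T := mulmxr A \o mulmx (invmx A).
have -> : invmx A *m X *m A = T X by [].
have <- : T 1%:M = 1%:M by rewrite /T /= mulmx1 mulVmx // Gu.
rewrite -mxdir_lincomp; apply: lX => B GB; rewrite mxevE mxev_lincomp.
by apply: pG; apply: (GM) => //; apply: GM => //; apply: GV.
Qed.

(** The value of [mxder Y p] at [A] is the derivative at the identity, along [Y], of the translate
    [B |-> p (A *m B)], which vanishes on [G] too. *)
Lemma mxder_vanishes Y p : group_lie_algebra G Y -> vanishes_on p G ->
  vanishes_on (mxder Y p) G.
Proof.
case: Galg => Gu G1 GM GV _ lY pG A GA; rewrite mxevE mxev_der.
have {2}<- : mulmx A 1%:M = A by rewrite mulmx1.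
rewrite -(mxdir_lincomp (mulmx A)); apply: lY => B GB; rewrite mxevE mxev_lincomp.
by apply: pG; apply: GM.
Qed.

Lemma iter_mxder_vanishes Y p k : group_lie_algebra G Y -> vanishes_on p G ->
  vanishes_on (iter k (mxder Y) p) G.
Proof. by move=> lY pG; elim: k => //= k IH; apply: mxder_vanishes. Qed.

End TangentSpace.
End Derivations.

Section RealPart.
Import mpoly.
Variables (R : rcfType) (n : nat) (f : {additive R[i] -> R}).
Hypothesis fR : forall a r, f (a * real_complex R r) = f a * r.
Local Notation SC := {mpoly R[i][n * n]}.
Local Notation SR := {mpoly R[n * n]}.
Implicit Types (p q : SC) (A Y : 'M[R]_n).

(** Applied with [f] the real or the imaginary part: on real matrices a complex equation becomes two
    real ones, to which real analysis applies. *)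
Definition mpart p : SR := \sum_(m <- msupp p) f p@_m *: 'X_[m].

Lemma mcoeff_mpart p m : (mpart p)@_m = f p@_m.
Proof.
rewrite /mpart raddf_sum /=; have [mp|mp] := boolP (m \in msupp p).
  rewrite (bigD1_seq m) ?msupp_uniq //= mcoeffZ mcoeffX eqxx mulr1 big1 ?addr0 // => k /negPf km.
  by rewrite mcoeffZ mcoeffX km mulr0.
rewrite memN_msupp_eq0 // raddf0 big1_seq // => k /andP[_ kp].
rewrite mcoeffZ mcoeffX; case: eqP => [km|_]; last by rewrite mulr0.
by rewrite -km kp in mp.
Qed.

Lemma mpart_is_additive : additive mpart.
Proof. by move=> p q; apply/mpolyP=> m; rewrite mcoeffB !mcoeff_mpart mcoeffB raddfB. Qed.

HB.instance Definition _ := GRing.isAdditive.Build SC SR mpart mpart_is_additive.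

Lemma mpart_ZX c m : mpart (c *: 'X_[m]) = f c *: 'X_[m].
Proof.
apply/mpolyP=> k; rewrite mcoeff_mpart !mcoeffZ !mcoeffX.
by case: eqP; rewrite ?mulr1 ?mulr0 ?raddf0.
Qed.

Lemma mxev_mpart A p : mxev A (mpart p) = f (mxev (map_mx (real_complex R) A) p).
Proof.
rewrite [in RHS](mpolyE p) [in LHS](mpolyE p) (raddf_sum mpart) !rmorph_sum raddf_sum /=.
apply: eq_bigr => m _; rewrite mpart_ZX /mxev !mevalZ !mevalX -fR; congr (f (_ * _)).
by rewrite rmorph_prod; apply: eq_bigr => i _; rewrite rmorphXn -map_mxvec mxE.
Qed.

Lemma mpart_deriv i p : mpart p^`M(i) = (mpart p)^`M(i).
Proof. by apply/mpolyP=> m; rewrite mcoeff_mpart !mcoeff_mderiv mcoeff_mpart raddfMn. Qed.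

Lemma mpart_mulX i r p : mpart ('X_i * (real_complex R r)%:MP * p) = 'X_i * r%:MP * mpart p.
Proof.
rewrite [in RHS](mpolyE p) [in LHS](mpolyE p) mulr_sumr !(raddf_sum mpart) mulr_sumr /=; apply: eq_bigr => m _.
have E (K : comNzRingType) (x y : K) : 'X_i * x%:MP * (y *: 'X_[m]) =
    (y * x) *: 'X_[U_(i) + m] :> {mpoly K[n * n]}.
  by rewrite -mulrA mul_mpolyC scalerA -scalerAr -mpolyXD mulrC.
by rewrite mpart_ZX !E mpart_ZX fR.
Qed.

Lemma mpart_der Y p : mpart (mxder (map_mx (real_complex R) Y) p) = mxder Y (mpart p).
Proof.
rewrite /mxder raddf_sum; apply: eq_bigr => i _ /=.
case/mxvec_indexP: i => a b; rewrite !mxvecE !mxE !mulr_suml raddf_sum; apply: eq_bigr => j _ /=.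
by rewrite !mxE mpart_mulX mpart_deriv.
Qed.

Lemma iter_mpart_der Y p k :
  iter k (mxder Y) (mpart p) = mpart (iter k (mxder (map_mx (real_complex R) Y)) p).
Proof. by elim: k => //= k ->; rewrite mpart_der. Qed.

End RealPart.

(** * Lie algebras in coordinates *)

Section Coordinates.
Variables (K : fieldType) (V : vectType K).
Local Notation n := (\dim {:V}).
Local Notation b := (vbasis {:V}).
Implicit Types (u v : 'End(V)) (x y : V).

Let bb : basis_of {:V} b. Proof. exact: vbasisP. Qed.

(* Matrices act on columns here, whereas [endmx] is meant to act on rows. *)
Definition rmx u : 'M[K]_n := (passmx.mxof b b u)^T.
Definition mxr (a : 'M[K]_n) : 'End(V) := passmx.hommx b b a^T.
Definition cv x : 'cV[K]_n := (passmx.rVof b x)^T.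
Definition vc (c : 'cV[K]_n) : V := passmx.vecof b c^T.

Lemma rmx_linear : linear rmx.
Proof. by move=> c u v; rewrite /rmx passmx.mxof_linear linearP. Qed.
HB.instance Definition _ := GRing.isLinear.Build K 'End(V) 'M[K]_n _ rmx rmx_linear.

Lemma cv_linear : linear cv.
Proof. by move=> c x y; rewrite /cv passmx.rVof_linear linearP. Qed.
HB.instance Definition _ := GRing.isLinear.Build K V 'cV[K]_n _ cv cv_linear.

Lemma cvK : cancel cv vc.
Proof. by move=> x; rewrite /vc /cv trmxK passmx.rVofK. Qed.

Lemma vcK : cancel vc cv.
Proof. by move=> c; rewrite /vc /cv passmx.vecofK ?trmxK. Qed.

Lemma cv_inj : injective cv. Proof. exact: can_inj cvK. Qed.

Lemma cv_eq0 x : (cv x == 0) = (x == 0).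
Proof. by rewrite -(inj_eq cv_inj) raddf0. Qed.

Lemma mxrK : cancel mxr rmx.
Proof. by move=> a; rewrite /rmx /mxr passmx.hommxK ?trmxK. Qed.

Lemma rmxK : cancel rmx mxr.
Proof. by move=> u; rewrite /rmx /mxr trmxK passmx.mxofK. Qed.

Lemma rmx_comp u v : rmx (u \o v)%VF = rmx u *m rmx v.
Proof. by rewrite /rmx (passmx.mxof_comp b b bb) trmx_mul. Qed.

Lemma rmx1 : rmx \1%VF = 1%:M.
Proof. by rewrite /rmx passmx.mxof1 ?trmx1 ?(basis_free bb). Qed.

Lemma cv_app u x : cv (u x) = rmx u *m cv x.
Proof. by rewrite /cv (passmx.rVof_app b bb) trmx_mul. Qed.

Lemma cv_mxr a x : cv (mxr a x) = a *m cv x.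
Proof. by rewrite cv_app mxrK. Qed.

Lemma rmxE u i j : rmx u i j = coord b i (u b`_j).
Proof. by rewrite !mxE /= passmx.vecof_delta. Qed.

Lemma cvE x i : cv x i 0 = coord b i x.
Proof. by rewrite !mxE. Qed.

Lemma mxrM a c x : mxr (a *m c) x = mxr a (mxr c x).
Proof. by apply: cv_inj; rewrite !cv_mxr mulmxA. Qed.

Lemma mxr1 x : mxr 1%:M x = x.
Proof. by apply: cv_inj; rewrite cv_mxr mul1mx. Qed.

End Coordinates.

Section LieBasics.
Variables (K : fieldType) (g : lieAlgType K).
Implicit Types (x y z : g) (u : 'End(g)).

Lemma lieDl x x' y : lie (x + x') y = lie x y + lie x' y.
Proof. by have := lie_linearl 1 x x' y; rewrite !scale1r. Qed.

Lemma lieDr x y y' : lie x (y + y') = lie x y + lie x y'.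
Proof. by have := lie_linearr 1 x y y'; rewrite !scale1r. Qed.

Lemma lie0l y : lie 0 y = 0.
Proof. by apply: (addrI (lie 0 y)); rewrite -lieDl !addr0. Qed.

Lemma lie0r x : lie x 0 = 0.
Proof. by apply: (addrI (lie x 0)); rewrite -lieDr !addr0. Qed.

Lemma lieZl a x y : lie (a *: x) y = a *: lie x y.
Proof. by have := lie_linearl a x 0 y; rewrite !addr0 lie0l addr0. Qed.

Lemma lieZr a x y : lie x (a *: y) = a *: lie x y.
Proof. by have := lie_linearr a x y 0; rewrite !addr0 lie0r addr0. Qed.

Lemma lieNl x y : lie (- x) y = - lie x y.
Proof. by rewrite -scaleN1r lieZl scaleN1r. Qed.

Lemma lieNr x y : lie x (- y) = - lie x y.
Proof. by rewrite -scaleN1r lieZr scaleN1r. Qed.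

Lemma lieC x y : lie x y = - lie y x.
Proof.
apply/eqP; rewrite -addr_eq0; apply/eqP.
by have := liexx (x + y); rewrite lieDl !lieDr !liexx add0r addr0.
Qed.

HB.instance Definition _ x := GRing.isLinear.Build K g g _ (lie x) (fun a y y' => lie_linearr a x y y').

Lemma adE x y : ad x y = lie x y.
Proof. by rewrite /ad lfunE. Qed.

Lemma ad_linear : linear (@ad K g).
Proof. by move=> a x y; apply/lfunP=> z; rewrite adE lie_linearl add_lfunE scale_lfunE !adE. Qed.

Definition Am x : 'M[K]_(\dim {:g}) := rmx (ad x).

Lemma Am_linear : linear Am.
Proof. by move=> a x y; rewrite /Am ad_linear linearP. Qed.
HB.instance Definition _ := GRing.isLinear.Build K g 'M[K]_(\dim {:g}) _ Am Am_linear.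

Lemma cv_lie x y : cv (lie x y) = Am x *m cv y.
Proof. by rewrite -adE cv_app. Qed.

Lemma lie_jacobi' x y z : lie (lie x y) z = lie x (lie y z) - lie y (lie x z).
Proof.
rewrite (lieC (lie x y)) [in RHS](lieC x z) lieNr opprK.
apply/eqP; rewrite eq_sym -subr_eq0 opprK; apply/eqP.
by have := lie_jacobi x y z.
Qed.

Lemma Am_lie x y : Am (lie x y) = Am x *m Am y - Am y *m Am x.
Proof.
rewrite /Am -!rmx_comp -linearB /=; congr rmx; apply/lfunP=> z.
by rewrite add_lfunE opp_lfunE !comp_lfunE !adE lie_jacobi'.
Qed.

Lemma killingE x y : killing x y = \tr (Am x *m Am y).
Proof. by rewrite /killing /Am -rmx_comp /rmx mxtrace_tr. Qed.

Lemma killingC x y : killing x y = killing y x.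
Proof. by rewrite !killingE mxtrace_mulC. Qed.

Lemma killingDr x y z : killing x (y + z) = killing x y + killing x z.
Proof. by rewrite !killingE linearD mulmxDr mxtraceD. Qed.

Lemma killingZr a x y : killing x (a *: y) = a * killing x y.
Proof. by rewrite !killingE linearZ /= -scalemxAr mxtraceZ. Qed.

Lemma killingNr x y : killing x (- y) = - killing x y.
Proof. by rewrite -scaleN1r killingZr mulN1r. Qed.

Lemma killingDl x y z : killing (x + y) z = killing x z + killing y z.
Proof. by rewrite !(killingC _ z) killingDr. Qed.

Lemma killingZl a x y : killing (a *: x) y = a * killing x y.
Proof. by rewrite !(killingC _ y) killingZr. Qed.

Lemma killingNl x y : killing (- x) y = - killing x y.
Proof. by rewrite !(killingC _ y) killingNr. Qed.

Lemma killing_lie x y z : killing (lie x y) z = killing x (lie y z).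
Proof.
rewrite !killingE !Am_lie mulmxBl mulmxBr !linearB /= !mulmxA.
by congr (_ - _); rewrite -[in LHS]mulmxA mxtrace_mulC.
Qed.

Definition mxaut (a : 'M[K]_(\dim {:g})) :=
  a \in unitmx /\ forall x y, mxr a (lie x y) = lie (mxr a x) (mxr a y).

Lemma mxaut_Am a x : mxaut a -> a *m Am x = Am (mxr a x) *m a.
Proof.
case=> _ aL; apply: (can_inj (@mxrK _ _)); apply/lfunP=> y; apply: cv_inj.
by rewrite !cv_mxr -!mulmxA -cv_lie -cv_mxr aL cv_lie cv_mxr.
Qed.

Lemma mxaut_AmV a x : mxaut a -> Am (mxr a x) = a *m Am x *m invmx a.
Proof. by move=> aA; rewrite mxaut_Am // mulmxK //; case: aA. Qed.

Lemma mxaut_killing a x y : mxaut a -> killing (mxr a x) (mxr a y) = killing x y.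
Proof.
move=> aA; have au := aA.1; rewrite !killingE !mxaut_AmV //.
by rewrite !mulmxA mulmxKV // mxtrace_mulC !mulmxA mulVmx // mul1mx.
Qed.

Lemma lie_aut_mxaut u : lie_aut u -> mxaut (rmx u).
Proof.
case=> ku uL; split; last by move=> x y; rewrite rmxK uL.
have uV : (u^-1 \o u)%VF = \1%VF by apply/lker0_compVf/eqP.
have : rmx (u^-1)%VF *m rmx u = 1%:M by rewrite -rmx_comp uV rmx1.
by case/mulmx1_unit.
Qed.

End LieBasics.

(** Cholesky factorisation by induction. The Schur complement [S] is positive because its value at
    [v] is that of [Q] at [(- q^-1 v r^T, v)], the lift of [v] orthogonal to the first basis
    vector. *)
Lemma posdef_factor (R : rcfType) n (Q : 'M[R]_n) :
  Q^T = Q -> (forall v : 'rV_n, v != 0 -> 0 < (v *m Q *m v^T) 0 0) ->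
  exists2 D, D \in unitmx & Q = D^T *m D.
Proof.
elim: n Q => [|n IH] Q Qs Qp.
  exists 1%:M; first exact: unitmx1.
  by apply/matrixP=> -[].
move: Q Qs Qp; rewrite -[n.+1]/(1 + n)%N => Q Qs Qp.
pose r := ursubmx Q; pose q := ulsubmx Q 0 0; pose Q' := drsubmx Q.
have QE : Q = block_mx q%:M r r^T Q'.
  rewrite -[LHS]submxK [ulsubmx Q]mx11_scalar; congr block_mx.
  by rewrite /r trmx_ursub Qs.
have q0 : 0 < q.
  have := Qp (row_mx 1%:M 0); rewrite row_mx_eq0 oner_eq0 /= => /(_ isT).
  rewrite QE mul_row_block tr_row_mx !mul0mx !mul1mx !addr0 mul_row_col trmx1 trmx0 mulmx1 mulmx0.
  by rewrite addr0 mxE eqxx mulr1n.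
pose S := Q' - q^-1 *: (r^T *m r).
have Q's : Q'^T = Q' by rewrite /Q' trmx_drsub Qs.
have [||D' D'u SE] := IH S.
- by rewrite /S linearB linearZ /= trmx_mul trmxK Q's.
- move=> v v0; have := Qp (row_mx (- q^-1 *: (v *m r^T)) v).
  rewrite row_mx_eq0 negb_and v0 orbT => /(_ isT).
  rewrite QE mul_row_block tr_row_mx mul_row_col.
  have -> : - q^-1 *: (v *m r^T) *m q%:M + v *m r^T = 0.
    by rewrite mul_mx_scalar scalerA mulrN divff ?gt_eqF // scaleN1r addNr.
  have -> : - q^-1 *: (v *m r^T) *m r + v *m Q' = v *m S.
    by rewrite /S mulmxBr -scalemxAr -scalemxAl mulmxA scaleNr addrC.
  by rewrite mul0mx add0r.
pose D := block_mx (Num.sqrt q)%:M ((Num.sqrt q)^-1 *: r) 0 D'.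
have sq0 : Num.sqrt q != 0 by rewrite gt_eqF // sqrtr_gt0.
exists D.
  by rewrite unitmxE det_ublock det_scalar1 unitrM unitfE sq0 -unitmxE.
rewrite /D tr_block_mx mulmx_block !tr_scalar_mx trmx0 !mul0mx !addr0 !mulmx0 !addr0.
rewrite -scalar_mxM -expr2 sqr_sqrtr ?ltW // mul_scalar_mx scalerA mulfV // scale1r.
rewrite linearZ /= mul_mx_scalar scalerA mulfV // scale1r -scalemxAl -scalemxAr scalerA -invfM.
by rewrite -expr2 sqr_sqrtr ?ltW // -SE /S addrC subrK -QE.
Qed.

Lemma mxtraceN (R : pzRingType) n (A : 'M[R]_n) : \tr (- A) = - \tr A.
Proof. exact: raddfN. Qed.

(** * The inner product of a Cartan involution, and critical forms *)

Section CartanInvolution.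
Variables (R : rcfType) (g : lieAlgType R) (theta : 'End(g)).
Hypothesis Ctheta : cartan_involution theta.
Local Notation n := (\dim {:g}).
Local Notation b := (vbasis {:g}).
Implicit Types (x y z w : g).

Lemma thetaK x : theta (theta x) = x.
Proof. by case: Ctheta => _ /lfunP/(_ x) + _; rewrite comp_lfunE id_lfunE. Qed.

Lemma theta_lie x y : theta (lie x y) = lie (theta x) (theta y).
Proof. by case: Ctheta => -[_ ->]. Qed.

Lemma theta_mxaut : mxaut (rmx theta).
Proof. by apply: lie_aut_mxaut; case: Ctheta. Qed.

Lemma killing_theta x y : killing (theta x) (theta y) = killing x y.
Proof. by have := mxaut_killing x y theta_mxaut; rewrite !rmxK. Qed.

Definition gram : 'M[R]_n := \matrix_(i, j) - killing b`_i (theta b`_j).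

Lemma gramE x y : ((cv x)^T *m gram *m cv y) 0 0 = - killing x (theta y).
Proof.
rewrite {2}(coord_vbasis (memvf x)) {2}(coord_vbasis (memvf y)).
rewrite mxE; under eq_bigr do rewrite mxE mulr_suml.
have suml (z : g) (F : 'I_n -> g) : killing (\sum_i F i) z = \sum_i killing (F i) z.
  by apply: (big_morph (fun u => killing u z)) => [u v|]; rewrite ?killingDl // -(scale0r 0) killingZl mul0r.
have sumr (z : g) (F : 'I_n -> g) : killing z (\sum_i F i) = \sum_i killing z (F i).
  by rewrite killingC suml; apply: eq_bigr => i _; rewrite killingC.
rewrite suml -sumrN exchange_big /=; apply: eq_bigr => i _.
rewrite linear_sum sumr -sumrN; apply: eq_bigr => j _.
rewrite linearZ /= killingZl killingZr [in LHS]mxE !cvE [gram _ _]mxE; ring.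
Qed.

Lemma bilinear_mx (M N : 'M[R]_n) :
  (forall x y, ((cv x)^T *m M *m cv y) 0 0 = ((cv x)^T *m N *m cv y) 0 0) -> M = N.
Proof.
move=> H; apply/matrixP=> i j; have := H (vc (delta_mx i 0)) (vc (delta_mx j 0)).
by rewrite !vcK trmx_delta -!rowE -!colE !mxE.
Qed.

Lemma gram_sym : gram^T = gram.
Proof.
apply/matrixP=> i j; rewrite !mxE; congr (- _).
by rewrite -killing_theta thetaK killingC.
Qed.

Lemma gram_pos x : x != 0 -> 0 < ((cv x)^T *m gram *m cv x) 0 0.
Proof. by rewrite gramE; case: Ctheta => _ _; apply. Qed.

Lemma gram_rpos (v : 'rV_n) : v != 0 -> 0 < (v *m gram *m v^T) 0 0.
Proof.
move=> v0; have := @gram_pos (vc v^T); rewrite vcK trmxK; apply.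
by rewrite -cv_eq0 vcK trmx_eq0.
Qed.

Lemma gram_Am x : (Am x)^T *m gram = - (gram *m Am (theta x)).
Proof.
apply: bilinear_mx => y z.
have -> : (cv y)^T *m ((Am x)^T *m gram) *m cv z = (cv (lie x y))^T *m gram *m cv z.
  by rewrite cv_lie trmx_mul !mulmxA.
rewrite gramE mulmxN mulNmx [RHS]mxE -[_ *m (_ *m _) *m _]mulmxA -[_ *m _ *m cv z]mulmxA -cv_lie.
by rewrite mulmxA gramE theta_lie thetaK opprK (lieC x y) killingNl opprK killing_lie.
Qed.

Lemma Am_eq0 x : Am x = 0 -> x = 0.
Proof.
move=> x0; apply/eqP/negPn/negP => /gram_pos; rewrite gramE killingE x0 mul0mx mxtrace0 oppr0.
by rewrite ltxx.
Qed.

(** With [S = B *m B^T] the trace is the sum of the squared norms of the columns of [U *m B]. So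
    [U *m B = 0], and definiteness of [S] kills the rows of [U]. *)
Lemma trace_gram_eq0 (U S : 'M[R]_n) : posdef S -> \tr (U^T *m gram *m U *m S) = 0 -> U = 0.
Proof.
move=> [[N [B SE]] Sd]; rewrite SE mulmxA mxtrace_mulC !mulmxA -trmx_mul.
rewrite -[_ *m gram *m U *m B]mulmxA => T0.
have UB : U *m B = 0.
  apply/matrixP=> i j; rewrite [RHS]mxE.
  have diagE k : ((U *m B)^T *m gram *m (U *m B)) k k =
      ((col k (U *m B))^T *m gram *m (col k (U *m B))) 0 0.
    rewrite tr_col -row_mul [LHS]mxE [RHS]mxE; apply: eq_bigr => l _.
    by rewrite [in RHS]mxE; congr (_ * _); rewrite [RHS]mxE.
  have ge0 k : 0 <= ((U *m B)^T *m gram *m (U *m B)) k k.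
    rewrite diagE.
    have [->|nz] := eqVneq (col k (U *m B)) 0; first by rewrite mulmx0 mxE.
    by have := @gram_rpos (col k (U *m B))^T; rewrite trmxK trmx_eq0 => /(_ nz)/ltW.
  have /psumr_eq0P/(_ T0 j isT) := fun k (_ : true) => ge0 k.
  rewrite diagE.
  have [E0 _|nz] := eqVneq (col j (U *m B)) 0; first by have /colP/(_ i) := E0; rewrite !mxE.
  by have := @gram_rpos (col j (U *m B))^T; rewrite trmxK trmx_eq0 => /(_ nz)/lt0r_neq0/eqP.
apply/row_matrixP=> i; rewrite row0; apply: Sd.
by rewrite SE mulmxA -row_mul UB row0 !mul0mx mxE.
Qed.

Section Critical.
Variable S : 'M[R]_n.
Hypothesis Spos : posdef S.
Hypothesis Scrit : forall y, \tr (gram *m Am y *m S) = 0.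

Let Ssym : S^T = S.
Proof. by case: Spos => -[N [B ->]] _; rewrite trmx_mul trmxK. Qed.

(* With [U := ad (w + eps *: theta w)], criticality at [lie w (theta w)] makes
   the square norm [\tr (U^T *m gram *m U *m S)] vanish. *)
Lemma theta_of_critical eps w : eps ^+ 2 = 1 ->
  Am w *m S = eps *: (S *m (Am w)^T) -> theta w = - (eps *: w).
Proof.
move=> e2 WS; set W := Am w in WS *; pose T := Am (theta w).
have WQ : W^T *m gram = - (gram *m T) by exact: gram_Am.
have TQ : T^T *m gram = - (gram *m W) by rewrite gram_Am thetaK.
pose U := W + eps *: T.
have trWW : \tr (gram *m W *m W *m S) = - eps * \tr (gram *m T *m W *m S).
  rewrite -[gram *m W *m W *m S]mulmxA WS -scalemxAr mxtraceZ mulmxA mxtrace_mulC.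
  by rewrite !mulmxA WQ !mulNmx mxtraceN mulrN mulNr.
have trTT : \tr (gram *m T *m T *m S) = \tr (gram *m W *m W *m S).
  rewrite -mxtrace_tr !trmx_mul Ssym gram_sym -!mulmxA TQ !mulmxN [T^T *m (_ *m _)]mulmxA TQ.
  by rewrite mulNmx mulmxN opprK mxtrace_mulC !mulmxA.
have UQ : U^T *m gram = - eps *: (gram *m U).
  rewrite linearD linearZ /= mulmxDl -scalemxAl WQ TQ mulmxDr scalerDr -scalemxAr scalerA.
  by rewrite mulNr -expr2 e2 !scaleNr scale1r scalerN addrC.
have U0 : U = 0.
  apply: (trace_gram_eq0 Spos); rewrite UQ -!scalemxAl mxtraceZ.
  have -> : gram *m U *m U *m S = gram *m W *m W *m S + eps *: (gram *m W *m T *m S) +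
      eps *: (gram *m T *m W *m S) + gram *m T *m T *m S.
    rewrite /U !(mulmxDr, mulmxDl) -!(scalemxAr, scalemxAl) scalerA -expr2 e2 scale1r.
    by rewrite [LHS]addrA; congr (_ + _); rewrite addrAC.
  rewrite !mxtraceD !mxtraceZ trTT trWW.
  have := Scrit (lie w (theta w)).
  rewrite Am_lie -/W -/T mulmxBr mulmxBl linearB /= !mulmxA => /eqP; rewrite subr_eq0 => /eqP ->.
  by ring.
have : Am (eps *: theta w + w) = 0 by rewrite linearD linearZ /= addrC.
move/Am_eq0/eqP; rewrite addr_eq0 => /eqP E.
by rewrite -[LHS]scale1r -e2 expr2 -scalerA E scalerN.
Qed.
End Critical.
End CartanInvolution.

(** * Weights of a split Cartan subalgebra *)

Lemma diag_mulmx_col (R : pzRingType) n (d : 'rV[R]_n) (v : 'cV_n) j :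
  (diag_mx d *m v) j 0 = d 0 j * v j 0.
Proof.
rewrite mxE (bigD1 j) //= mxE eqxx mulr1n big1 ?addr0 // => k kj.
by rewrite mxE eq_sym (negPf kj) mulr0n mul0r.
Qed.

Lemma conj_diag_tr (F : fieldType) n (Q A : 'M[F]_n) d : Q \in unitmx ->
  Q *m A^T = diag_mx d *m Q -> invmx Q^T *m A = diag_mx d *m invmx Q^T.
Proof.
rewrite -unitmx_tr => Qu /(congr1 trmx); rewrite !trmx_mul trmxK tr_diag_mx => E.
have -> : A = Q^T *m diag_mx d *m invmx Q^T by rewrite -E mulmxK.
by rewrite -mulmxA mulKmx.
Qed.

Lemma exists_nonroot (R : numDomainType) (p : {poly R}) : p != 0 -> exists t, ~~ root p t.
Proof.
move=> p0; pose rs := [seq i%:R : R | i <- iota 0 (size p)].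
have [/(max_poly_roots p0)|/allPn[t _ ?]] := boolP (all (root p) rs); last by exists t.
rewrite size_map size_iota ltnn => H; suff: false by [].
apply: H; rewrite map_inj_uniq ?iota_uniq // => i j /eqP.
by rewrite eqr_nat => /eqP.
Qed.

Lemma mem_lieprod (K : fieldType) (g : lieAlgType K) (U V : {vspace g}) u v :
  u \in U -> v \in V -> lie u v \in lieprod U V.
Proof.
move=> uU vV; rewrite (coord_vbasis uU) (coord_vbasis vV).
have lsum (z : g) n (F : 'I_n -> g) : lie (\sum_i F i) z = \sum_i lie (F i) z.
  by apply: (big_morph (fun u => lie u z)) => [a b|]; rewrite ?lieDl ?lie0l.
rewrite lsum; apply: memv_suml => i _; rewrite linear_sum /=; apply: memv_suml => j _.
rewrite lieZl linearZ /=; do 2!apply: memvZ.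
by apply/memv_span/allpairsP; exists ((vbasis U)`_i, (vbasis V)`_j); rewrite !mem_nth ?size_tuple.
Qed.

Lemma mem_grade (K : fieldType) (g : lieAlgType K) (phi : 'End(g)) i x :
  (x \in grade phi i) = (phi x == (-1) ^+ i *: x).
Proof.
by rewrite /grade memv_ker add_lfunE opp_lfunE scale_lfunE id_lfunE subr_eq0.
Qed.

Lemma mem_grade0 (K : fieldType) (g : lieAlgType K) (phi : 'End(g)) x :
  reflect (phi x = x) (x \in grade phi 0).
Proof. by rewrite mem_grade expr0 scale1r; exact: eqP. Qed.

Lemma mem_grade1 (K : fieldType) (g : lieAlgType K) (phi : 'End(g)) x :
  reflect (phi x = - x) (x \in grade phi 1).
Proof. by rewrite mem_grade expr1 scaleN1r; exact: eqP. Qed.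

Section WeightBasis.
Variables (R : rcfType) (g : lieAlgType R) (M h0 : {vspace g}).
Local Notation n := (\dim {:g}).
Implicit Types x y z : g.

Lemma diag_iter_lie (P : 'M[R]_n) d x y m : P *m Am x = diag_mx d *m P ->
  P *m cv (iter m (lie x) y) = \col_j (d 0 j ^+ m * (P *m cv y) j 0).
Proof.
move=> Px; elim: m => [|m IH]; first by apply/colP=> j; rewrite [RHS]mxE mul1r.
rewrite iterS cv_lie mulmxA Px -mulmxA IH; apply/colP=> j.
by rewrite diag_mulmx_col !mxE exprS mulrA.
Qed.

Lemma endmx_ad x : endmx (ad x) = (Am x)^T.
Proof. by rewrite trmxK. Qed.

Hypothesis h0_cartan : cartan_subalgebra M h0.
Hypothesis h0_split : split_subspace h0.

(** Nilpotency of [h0] makes some power of [ad x] kill [y]; as [ad x] is diagonalisable, its first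
    power does so already. *)
Lemma split_cartan_abelian x y : x \in h0 -> y \in h0 -> lie x y = 0.
Proof.
move=> xh yh; have [Q Qu /(diagonalizable_forPex)[d /(simmxP Qu) Qx]] := h0_split xh.
have Pu : invmx Q^T \in unitmx by rewrite unitmx_inv unitmx_tr.
rewrite endmx_ad in Qx; have {Qx} Px := conj_diag_tr Qu Qx.
have [_ _ [m nilm] _] := h0_cartan.
have it k : iter k (lie x) y \in iter k (lieprod h0) h0.
  by elim: k => //= k IH; apply: mem_lieprod.
have := it m; rewrite nilm memv0 => /eqP itm.
apply: cv_inj; rewrite raddf0; apply: (can_inj (mulKmx Pu)); rewrite mulmx0.
have := diag_iter_lie y m Px; rewrite itm raddf0 mulmx0 => /colP Em.
apply/colP=> j; have := diag_iter_lie y 1 Px => /= ->; rewrite !mxE expr1.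
have := Em j; rewrite !mxE => /esym/eqP; rewrite mulf_eq0 => /orP[|/eqP ->]; last by rewrite mulr0.
by rewrite expf_eq0 => /andP[_ /eqP ->]; rewrite mul0r.
Qed.

Lemma weight_basis : exists2 P : 'M[R]_n, P \in unitmx &
  forall x, x \in h0 -> is_diag_mx (P *m Am x *m invmx P).
Proof.
have /codiagonalizableP[P Pu /allP HP] : {in [seq endmx (ad x) | x <- vbasis h0] &, forall A B, comm_mx A B} /\
   {in [seq endmx (ad x) | x <- vbasis h0], forall A, diagonalizable A}.
  split=> [A B /mapP[x xb ->] /mapP[y yb ->]|A /mapP[x xb ->]]; last first.
    by apply: h0_split; apply: vbasis_mem.
  have E : Am x *m Am y = Am y *m Am x.
    apply/eqP; rewrite -subr_eq0 -Am_lie split_cartan_abelian ?vbasis_mem //.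
    by rewrite raddf0.
  by rewrite /comm_mx !endmx_ad -[LHS]trmx_mul -[RHS]trmx_mul; congr trmx; rewrite E.
have Qu : invmx P^T \in unitmx by rewrite unitmx_inv unitmx_tr.
exists (invmx P^T) => // x xh; rewrite (coord_vbasis xh) linear_sum mulmx_sumr mulmx_suml.
apply: (big_ind (@is_diag_mx _ _ _)) => [|A B /is_diag_mxP Ad /is_diag_mxP Bd|i _].
- by apply/is_diag_mxP => i j _; rewrite mxE.
- by apply/is_diag_mxP => i j ij; rewrite mxE Ad // Bd // addr0.
have /HP/= : endmx (ad (vbasis h0)`_i) \in [seq endmx (ad x) | x <- vbasis h0].
  by apply/mapP; exists (vbasis h0)`_i; rewrite ?mem_nth ?size_tuple.
case/diagonalizable_forPex=> d /(simmxP Pu); rewrite endmx_ad => Pd.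
apply/is_diag_mxP => k l kl; rewrite linearZ /= -scalemxAr -scalemxAl mxE.
rewrite (conj_diag_tr Pu Pd) -mulmxA mulmxV // mulmx1 mxE.
rewrite (_ : (k == l) = false) ?mulr0n ?mulr0 //; apply: negPf; exact: kl.
Qed.
End WeightBasis.

Section Weights.
Variables (R : rcfType) (g : lieAlgType R) (M h0 : {vspace g}).
Local Notation n := (\dim {:g}).
Implicit Types x y z s : g.
Variable P : 'M[R]_n.

Definition wt x : 'rV[R]_n := \row_j (P *m Am x *m invmx P) j j.

Lemma wt_linear : linear wt.
Proof.
move=> c x y; rewrite /wt; apply/rowP=> j; rewrite mxE linearP mulmxDr mulmxDl -scalemxAr -scalemxAl.
by rewrite [RHS]mxE [X in _ = X + _]mxE [in RHS]mxE [X in _ = _ + X]mxE mxE; congr (_ + _); rewrite mxE.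
Qed.
HB.instance Definition _ := GRing.isLinear.Build R g 'rV[R]_n _ wt wt_linear.

Hypothesis Pu : P \in unitmx.
Hypothesis Pdiag : forall x, x \in h0 -> is_diag_mx (P *m Am x *m invmx P).
Hypothesis h0_cartan : cartan_subalgebra M h0.

Lemma wtE x : x \in h0 -> P *m Am x *m invmx P = diag_mx (wt x).
Proof.
move/Pdiag/is_diag_mxP => D; apply/matrixP=> i j; rewrite [RHS]mxE.
by have [<-|ij] := eqVneq i j; [rewrite mulr1n [RHS]mxE | rewrite D // mulr0n].
Qed.

Lemma wt_mul x : x \in h0 -> P *m Am x = diag_mx (wt x) *m P.
Proof. by move=> xh; rewrite -wtE // mulmxKV. Qed.

Lemma lie_eigen x z c : x \in h0 ->
  lie x z = c *: z <-> forall j, (P *m cv z) j 0 != 0 -> wt x 0 j = c.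
Proof.
move=> xh; have E j : (P *m cv (lie x z)) j 0 = wt x 0 j * (P *m cv z) j 0.
  by rewrite cv_lie mulmxA wt_mul // -mulmxA diag_mulmx_col.
split=> [xz j nz|H].
  by apply: (mulIf nz); rewrite -E xz linearZ /= -scalemxAr mxE.
apply: cv_inj; apply: (can_inj (mulKmx Pu)); apply/colP=> j.
rewrite E linearZ /= -scalemxAr [RHS]mxE.
by have [->|/H ->] := eqVneq ((P *m cv z) j 0) 0; rewrite ?mulr0.
Qed.

Definition generic s := forall x, x \in h0 ->
  (forall i j, wt s 0 i = wt s 0 j -> wt x 0 i = wt x 0 j) /\
  (forall i, wt s 0 i = 0 -> wt x 0 i = 0).

(** The functionals [al q] are the weights and their differences. Along the curve [S t], with
    coordinates the powers of [t], each nonzero one becomes a nonzero polynomial [p q], and some [t]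
    is a root of none of these. *)
Lemma generic_exists : exists2 s, s \in h0 & generic s.
Proof.
pose al (q : 'I_n * option 'I_n) x := wt x 0 q.1 - oapp (wt x 0) 0 q.2.
have alD q c x y : al q (c *: x + y) = c * al q x + al q y.
  rewrite /al linearP !mxE; case: q.2 => [k|] /=; last by ring.
  by rewrite !mxE; ring.
have al0 q : al q 0 = 0.
  by apply: (addIr (al q 0)); have := alD q 1 0 0; rewrite mul1r scale1r !addr0 add0r => <-.
have alS q m (c : 'I_m -> R) (v : 'I_m -> g) :
    al q (\sum_k c k *: v k) = \sum_k c k * al q (v k).
  by apply: (big_rec2 (fun x a => al q x = a)) => [|k a x _ <-]; [exact: al0 | exact: alD].
pose b := vbasis h0; pose S t := \sum_(k < \dim h0) t ^+ k *: b`_k.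
pose p q : {poly R} := \sum_(k < \dim h0) (al q b`_k)%:P * 'X^k.
have pE q t : (p q).[t] = al q (S t).
  rewrite /p /S horner_sum alS; apply: eq_bigr => k _.
  by rewrite hornerM hornerC hornerXn mulrC.
pose bad q := [exists k : 'I_(\dim h0), al q b`_k != 0].
have [|t] := @exists_nonroot _ (\prod_(q | bad q) p q).
  apply/prodf_neq0 => q /existsP[k qk]; apply: contraNneq qk => /polyP/(_ k).
  rewrite coef0 /p coef_sum (bigD1 k) //= coefCM coefXn eqxx mulr1 big1 ?addr0 => [->//|l lk].
  by rewrite coefCM coefXn eq_sym (negPf lk : (l == k :> nat) = false) mulr0.
rewrite /root horner_prod => /prodf_neq0 tp.
have Sh : S t \in h0 by apply: memv_suml => k _; rewrite memvZ // vbasis_mem // mem_nth ?size_tuple.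
have key q : al q (S t) = 0 -> forall x, x \in h0 -> al q x = 0.
  move=> qS x xh; have [bq|] := boolP (bad q).
    by have := tp q bq; rewrite pE qS eqxx.
  rewrite negb_exists => /forallP H; rewrite (coord_vbasis xh).
  rewrite alS big1 // => k _; have := H k; rewrite negbK => /eqP ->; exact: mulr0.
exists (S t) => // x xh; split=> [i j|i] E.
  by apply/eqP; rewrite -subr_eq0; apply/eqP/(key (i, Some j)) => //; rewrite /al /= E subrr.
have := (key (i, None))^~ x; rewrite /al /= !subr0 => H; exact: H E xh.
Qed.

(** Where [z] has a nonzero coordinate the weight of [s] vanishes, hence by genericity so does that
    of every element of [h0]. Thus [z] centralises [h0], which is its own normaliser. *)
Lemma generic_centralizer s z : s \in h0 -> generic s -> z \in M -> lie s z = 0 -> z \in h0.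
Proof.
move=> sh gs zM sz; have [_ _ _ self] := h0_cartan; apply: self => // y yh.
suff -> : lie z y = 0 by exact: mem0v.
rewrite lieC; apply/eqP; rewrite oppr_eq0; apply/eqP.
rewrite -[RHS](scale0r z); apply/(lie_eigen _ _ yh) => j nz; apply: (gs y yh).2.
by move: j nz; apply/(lie_eigen _ _ sh); rewrite scale0r.
Qed.

Variable theta : 'End(g).
Hypothesis Ctheta : cartan_involution theta.
Hypothesis theta_h0 : (theta @: h0 <= h0)%VS.

(** The element [y = x + theta x] of [h0] is fixed by [theta], so [killing y y] is negative unless
    [y = 0]; but it is a sum of squares of real weights. *)
Lemma split_cartan_theta x : x \in h0 -> theta x = - x.
Proof.
move=> xh; pose y := x + theta x.
have yh : y \in h0 by rewrite memvD //; apply: (subvP theta_h0); apply: memv_img.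
have ty : theta y = y by rewrite /y linearD /= (thetaK Ctheta) addrC.
suff /eqP : y = 0 by rewrite /y addrC addr_eq0 => /eqP.
apply/eqP; apply: contraT => y0; case: Ctheta => _ _ /(_ y y0).
rewrite ty killingE; have -> : Am y = invmx P *m diag_mx (wt y) *m P.
  by rewrite -[RHS]mulmxA -wt_mul // mulKmx.
rewrite mxtrace_mulC !mulmxA mulmxK // mxtrace_mulC !mulmxA mulmxV // mul1mx mulmx_diag mxtrace_diag.
rewrite oppr_gt0 ltNge => /negP[]; apply: sumr_ge0 => j _.
by rewrite !mxE -expr2 sqr_ge0.
Qed.

End Weights.

(** * The complexified Lie algebra *)

Section ComplexCoordinates.
Variables (R : rcfType) (V : vectType R).
Local Notation n := (\dim {:V}).
Local Notation VC := (complexification V).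
Local Notation toC := (map_mx (real_complex R)).
Implicit Types (z w : VC) (u v : 'End(VC)) (x y : V).

Definition ccv z : 'cV[R[i]]_n := \col_i Complex (cv z.1 i 0) (cv z.2 i 0).

Lemma ccvE z i : ccv z i 0 = Complex (coord (vbasis {:V}) i z.1) (coord (vbasis {:V}) i z.2).
Proof. by rewrite mxE !cvE. Qed.

Lemma ccv_linear : linear ccv.
Proof.
move=> [a b] [x y] [x' y']; apply/colP=> j; rewrite ccvE [RHS]mxE [X in _ = X + _]mxE !ccvE /=.
by rewrite !linearD !linearN !linearZ /=.
Qed.
HB.instance Definition _ := GRing.isLinear.Build R[i] VC 'cV[R[i]]_n _ ccv ccv_linear.

Lemma ccv_inj : injective ccv.
Proof.
move=> [x y] [x' y'] /colP E; congr pair; apply: cv_inj; apply/colP=> j;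
by have := E j; rewrite !ccvE !cvE => -[].
Qed.

Definition vcc (c : 'cV[R[i]]_n) : VC :=
  (vc (map_mx (@complex.Re R) c), vc (map_mx (@complex.Im R) c)).

Lemma vccK : cancel vcc ccv.
Proof. by move=> c; apply/colP=> j; rewrite ccvE /vcc /= -!cvE !vcK !mxE; case: (c j 0). Qed.

Lemma ccv_cbasis (j : 'I_n) : ccv (cbasis V)`_j = delta_mx j 0.
Proof.
rewrite (nth_map 0) ?size_tuple //; apply/colP=> i; rewrite ccvE mxE /= linear0.
rewrite coord_free ?(basis_free (vbasisP _)) // andbT eq_sym. by case: (i == j).
Qed.

Lemma cbasis_sum z : z = \sum_i ccv z i 0 *: (cbasis V)`_i.
Proof.
apply: ccv_inj; rewrite linear_sum; apply/colP=> j; rewrite summxE (bigD1 j) //= big1.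
  by rewrite linearZ /= ccv_cbasis addr0; move: (ccv z j 0) => c; rewrite !mxE eqxx mulr1.
by move=> i ij; move: (ccv z i 0) => c; rewrite linearZ /= ccv_cbasis !mxE eq_sym (negPf ij) mulr0.
Qed.

Lemma cbasis_free : free (cbasis V).
Proof.
apply/freeP => k E i; have := congr1 ccv E; rewrite linear0 linear_sum.
move=> /colP/(_ i); rewrite summxE mxE (bigD1 i) //= big1 ?addr0.
  by rewrite linearZ /= ccv_cbasis !mxE eqxx mulr1.
by move=> j ji; rewrite linearZ /= ccv_cbasis !mxE eq_sym (negPf ji) mulr0.
Qed.

Lemma coord_cbasis i z : coord (cbasis V) i z = ccv z i 0.
Proof. by rewrite {1}[z]cbasis_sum coord_sum_free // cbasis_free. Qed.

Lemma cmxE u i j : cmx u i j = ccv (u (cbasis V)`_j) i 0.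
Proof. by rewrite mxE coord_cbasis -tnth_nth. Qed.

Lemma ccv_app u z : ccv (u z) = cmx u *m ccv z.
Proof.
rewrite {1}[z]cbasis_sum !linear_sum; apply/colP=> i; rewrite summxE mxE.
by apply: eq_bigr => j _; rewrite !linearZ /= mxE cmxE mulrC.
Qed.

Lemma cmx_inj : injective (@cmx R V).
Proof. by move=> u v E; apply/lfunP=> z; apply: ccv_inj; rewrite !ccv_app E. Qed.

Lemma eq_mxcv (A B : 'M[R[i]]_n) : (forall z, A *m ccv z = B *m ccv z) -> A = B.
Proof.
move=> E; apply/matrixP=> i j; have /colP/(_ i) := E (cbasis V)`_j.
by rewrite ccv_cbasis -!colE !mxE.
Qed.

Lemma cmx_linear : linear (@cmx R V).
Proof.
move=> c u v; apply: eq_mxcv => z; rewrite mulmxDl -scalemxAl -!ccv_app.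
by rewrite add_lfunE scale_lfunE linearP.
Qed.
HB.instance Definition _ := GRing.isLinear.Build R[i] 'End(VC) 'M[R[i]]_n _ (@cmx R V) cmx_linear.

Lemma cplx_end_linear (u : 'End(V)) : linear (fun z : VC => (u z.1, u z.2) : VC).
Proof.
move=> [a b] [x y] [x' y']; congr pair => /=; by rewrite !(linearD, linearN, linearZ).
Qed.

Lemma cplx_endE (u : 'End(V)) z : cplx_end u z = (u z.1, u z.2).
Proof.
pose U := GRing.isLinear.Build R[i] VC VC _ _ (cplx_end_linear u).
pose L : {linear VC -> VC} := HB.pack (fun z : VC => (u z.1, u z.2) : VC) U.
exact: (lfunE L z).
Qed.

Lemma ccv_cinj x : ccv (cinj x) = toC (cv x).
Proof. by apply/colP=> j; rewrite ccvE mxE cvE /= linear0. Qed.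

Lemma cbasisE (j : 'I_n) : (cbasis V)`_j = cinj (vbasis {:V})`_j.
Proof. by rewrite (nth_map 0) ?size_tuple. Qed.

Lemma cmx_cplx_end (u : 'End(V)) : cmx (cplx_end u) = toC (rmx u).
Proof.
apply/matrixP=> i j; rewrite cmxE cbasisE cplx_endE ccvE [RHS]mxE /= !linear0 -rmxE.
by [].
Qed.

Lemma mem_cplxv (U : {vspace V}) z : (z \in cplxv U) = (z.1 \in U) && (z.2 \in U).
Proof.
apply/idP/andP=> [|[]].
  move/coord_span => ->; elim/big_rec: _ => [|i w _ [w1 w2]]; first by rewrite !mem0v.
  set b := _`_i; have [x xU ->] : exists2 x, x \in U & b = cinj x.
    have iU : (i < size (vbasis U))%N.
      by rewrite size_tuple.
    exists (vbasis U)`_i; first by apply: vbasis_mem; rewrite mem_nth.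
    by rewrite /b (nth_map 0).
  by case: (coord _ _ _) => a c /=; split; rewrite memvD // ?memvB ?memvD // memvZ // mem0v.
case: z => x y /= xU yU.
have inj (v : V) : v \in U -> cinj v \in cplxv U.
  move=> vU; rewrite (coord_vbasis vU).
  have -> : cinj (\sum_i coord (vbasis U) i v *: (vbasis U)`_i) =
     \sum_i (real_complex R (coord (vbasis U) i v)) *: (cinj (vbasis U)`_i : VC).
    elim/big_rec2: _ => [//|i y1 y2 _ <-]; congr pair => /=.
      by rewrite scaler0 subr0.
    by rewrite !scaler0 scale0r !addr0.
  apply: memv_suml => i _; apply/memvZ/memv_span/map_f.
  by rewrite mem_nth ?size_tuple.
have -> : (x, y) = cinj x + (Complex 0 1 : R[i]) *: (cinj y : VC).
  by congr pair => /=; rewrite ?scale0r ?scaler0 ?subr0 ?addr0 ?add0r ?scale1r.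
by rewrite memvD ?memvZ ?inj.
Qed.

End ComplexCoordinates.

Section ComplexAd.
Variables (R : rcfType) (g : lieAlgType R).
Local Notation n := (\dim {:g}).
Local Notation gC := (complexification g).
Local Notation toC := (map_mx (real_complex R)).
Implicit Types (z w : gC) (x y : g).

Definition AC z : 'M[R[i]]_n := cmx (ad z).

Lemma AC_linear : linear AC.
Proof. by move=> c z w; rewrite /AC ad_linear linearP. Qed.
HB.instance Definition _ := GRing.isLinear.Build R[i] gC 'M[R[i]]_n _ AC AC_linear.

Lemma ccv_lie z w : ccv (lie z w) = AC z *m ccv w.
Proof. by rewrite -adE ccv_app. Qed.

Lemma AC_lie z w : AC (lie z w) = AC z *m AC w - AC w *m AC z.
Proof.
by apply: eq_mxcv => v; rewrite mulmxBl -!mulmxA -!ccv_lie lie_jacobi' linearB.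
Qed.

Lemma ACE z i j : AC z i j = Complex (Am z.1 i j) (Am z.2 i j).
Proof.
rewrite cmxE adE cbasisE ccvE /= !rmxE !adE.
by case: z => x y /=; rewrite !lie0r subr0 add0r.
Qed.

Lemma AC_cinj x : AC (cinj x) = toC (Am x).
Proof. by apply/matrixP=> i j; rewrite ACE /= linear0 [RHS]mxE [X in Complex _ X]mxE. Qed.

Lemma AC_conj (u : 'End(gC)) z : (forall x y : gC, u (lie x y) = lie (u x) (u y)) ->
  cmx u *m AC z = AC (u z) *m cmx u.
Proof.
move=> uL; apply: eq_mxcv => w; rewrite -!mulmxA -[AC z *m _]ccv_lie -!ccv_app. by rewrite adE uL.
Qed.
End ComplexAd.

(** * Weights on the kernel and image of a nilpotent element *)

Section WeightVectors.
Variables (R : rcfType) (n : nat).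
Local Notation C := R[i].
Local Notation rc := (real_complex R).
Variables (E F : 'M[C]_n) (x : 'rV[R]_n).
Local Notation H := (diag_mx (map_mx rc x)).
Implicit Types (r : R) (v w : 'cV[C]_n).

Definition wcol r v : 'cV[C]_n := \col_j (if x 0 j == r then v j 0 else 0).

Let wv r v := forall j, v j 0 != 0 -> x 0 j = r.

Let wcol_wv r v : wv r (wcol r v).
Proof. by move=> j; rewrite mxE; have [->|_] := eqVneq (x 0 j) r; rewrite ?eqxx. Qed.

Lemma wcol_homog (X : 'M[C]_n) d r v : homog x d X ->
  wcol r (X *m v) = X *m wcol (r - d) v.
Proof.
move=> hX; apply/colP=> j; rewrite !mxE.
case: eqVneq => [xr|xr]; [|symmetry; apply: big1 => k _]; last first.
  rewrite mxE; have [->|/hX Ejk] := eqVneq (X j k) 0; first by rewrite mul0r.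
  case: eqVneq => [xk|]; last by rewrite mulr0.
  by case/eqP: xr; rewrite -Ejk in xk; lra.
apply: eq_bigr => k _; rewrite mxE; have [->|/hX Ejk] := eqVneq (X j k) 0; first by rewrite !mul0r.
by rewrite -xr -Ejk opprB addrC subrK eqxx.
Qed.

Let wv_diag r v : wv r v -> H *m v = rc r *: v.
Proof.
move=> vr; apply/colP=> j; rewrite diag_mulmx_col [RHS]mxE mxE.
by have [->|/vr ->//] := eqVneq (v j 0) 0; rewrite !mulr0.
Qed.

Let wv_homog X d r v : homog x d X -> wv r v -> wv (r + d) (X *m v).
Proof.
move=> hX vr j; rewrite mxE; apply: contraNeq => xj; rewrite big1 // => k _.
have [->|/hX Xjk] := eqVneq (X j k) 0; first by rewrite mul0r.
have [->|/vr vk] := eqVneq (v k 0) 0; first by rewrite mulr0.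
by case/eqP: xj; rewrite -Xjk -vk; ring.
Qed.

Hypothesis Eh : homog x 2 E.
Hypothesis Fh : homog x (- 2) F.
Hypothesis EF : E *m F - F *m E = H.

Let EFv v : E *m (F *m v) = F *m (E *m v) + H *m v.
Proof. by rewrite -EF mulmxBl !mulmxA addrC subrK. Qed.

(** The vectors [f k], images of [v] under powers of [F], have distinct weights, so one of them
    vanishes. Since [E] sends [f m.+1] to [f m] times [m.+1 * (r - m)], which is nonzero for
    [r < 0], the vanishing descends to [v]. *)
Let negative_weight_eq0 r v : wv r v -> F *m (E *m v) = 0 -> r < 0 -> v = 0.
Proof.
move=> vr FEv r0; pose f k := iter k (mulmx F) v.
have fw k : wv (r - (2 * k)%:R) (f k).
  elim: k => [|k IH]; first by rewrite muln0 subr0.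
  have -> : r - (2 * k.+1)%:R = r - (2 * k)%:R + - 2 by rewrite mulnS natrD; ring.
  exact: wv_homog.
have [k fk] : exists k, f k = 0.
  have [/forallP H|] := boolP [forall k : 'I_n.+1, [exists j, f k j 0 != 0]]; last first.
    rewrite negb_forall => /existsP[k]; rewrite negb_exists => /forallP fk; exists k.
    by apply/colP=> j; rewrite mxE; have := fk j; rewrite negbK => /eqP.
  pose j k := xchoose (existsP (H k)).
  have jw k : x 0 (j k) = r - (2 * k)%:R by apply: fw; exact: (xchooseP (existsP (H k))).
  have /leq_card : injective j.
    move=> k l jkl; have := jw k; rewrite jkl jw => /addrI/oppr_inj/eqP.
    by rewrite eqr_nat eqn_pmul2l // => /eqP/val_inj.
  by rewrite !card_ord ltnn.
have Ef m : E *m f m.+1 = rc (m.+1%:R * (r - m%:R)) *: f m.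
  elim: m => [|m IH].
    by rewrite /f /= EFv FEv add0r (wv_diag vr) mul1r subr0.
  rewrite -[f m.+2]/(F *m f m.+1) EFv IH (wv_diag (fw m.+1)) -scalemxAr -[F *m f m]/(f m.+1).
  by rewrite -scalerDl -rmorphD; congr (rc _ *: _); rewrite natrM -!natr1; ring.
elim: k fk => // k IH fk; apply: IH; apply/eqP.
have := Ef k; rewrite fk mulmx0 => /esym/eqP; rewrite scaler_eq0 => /orP[|//].
rewrite fmorph_eq0 mulf_eq0 pnatr_eq0 /= subr_eq0 => /eqP rk.
by move: r0; rewrite rk ltrn0.
Qed.

(** Vectors killed by [E] have nonnegative weights, and those of weight zero are invariants, which
    are not in the image of [E]. *)
Lemma sl2_positive_weights v v' j : E *m v = 0 -> v = E *m v' -> v j 0 != 0 -> 0 < x 0 j.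
Proof.
move=> Ev vE vj; rewrite ltNge; apply: contra vj => xj; set r := x 0 j in xj *.
suff /colP/(_ j) : wcol r v = 0 by rewrite !mxE eqxx => ->.
have Ew : E *m wcol r v = 0.
  have <- : wcol (r + 2) (E *m v) = E *m wcol r v by rewrite (wcol_homog _ _ Eh) addrK.
  by rewrite Ev; apply/colP=> k; rewrite !mxE; case: eqP.
move: xj; rewrite le_eqVlt => /orP[/eqP r0|]; last first.
  by apply: negative_weight_eq0; [exact: wcol_wv | rewrite Ew mulmx0].
(* In weight zero, [F] kills the component, so its preimage of weight [- 2] satisfies the hypothesis
   of [negative_weight_eq0] and vanishes. *)
have wE : wcol r v = E *m wcol (- 2) v' by rewrite {1}vE (wcol_homog _ _ Eh) r0 sub0r.
have Fw : F *m wcol r v = 0.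
  apply: (negative_weight_eq0 (wv_homog Fh (@wcol_wv r v))); last by rewrite r0 add0r oppr_lt0.
  by rewrite EFv Ew mulmx0 add0r (wv_diag (@wcol_wv r v)) r0 rmorph0 scale0r mulmx0.
rewrite wE (negative_weight_eq0 (@wcol_wv (- 2) v')) ?mulmx0 ?oppr_lt0 //.
by rewrite -wE.
Qed.

End WeightVectors.

Section ComplexWeights.
Variables (R : rcfType) (g : lieAlgType R) (phi : 'End(g)) (h0 : {vspace g}).
Local Notation n := (\dim {:g}).
Local Notation gC := (complexification g).
Local Notation C := R[i].
Local Notation rc := (real_complex R).
Local Notation toC := (map_mx (real_complex R)).
Local Notation diagC x := (diag_mx (toC x)).
Variable P : 'M[R]_n.
Local Notation wt := (wt P).
Local Notation Pc := (toC P).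
Implicit Types (x y w s : g) (z : gC) (r : R) (X : 'M[C]_n).

Definition wad z : 'M[C]_n := Pc *m AC z *m invmx Pc.

Lemma wad_linear : linear wad.
Proof.
by move=> c z z'; rewrite /wad linearP mulmxDr mulmxDl -scalemxAr -scalemxAl.
Qed.
HB.instance Definition _ := GRing.isLinear.Build C gC 'M[C]_n _ wad wad_linear.

Hypothesis Pu : P \in unitmx.
Hypothesis Pdiag : forall x, x \in h0 -> is_diag_mx (P *m Am x *m invmx P).
Hypothesis Am_faithful : forall x, Am x = 0 -> x = 0.

Let Pcu : Pc \in unitmx. Proof. by rewrite map_unitmx. Qed.

Lemma wad_lie z z' : wad (lie z z') = wad z *m wad z' - wad z' *m wad z.
Proof. by rewrite /wad AC_lie mulmxBr mulmxBl !mulmxA !mulmxKV. Qed.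

Lemma wad_cinj x : x \in h0 -> wad (cinj x) = diagC (wt x).
Proof.
move=> xh; rewrite /wad AC_cinj -map_invmx -!map_mxM (wtE Pdiag xh).
by rewrite map_diag_mx.
Qed.

Lemma wadE z j k : wad z j k =
  Complex ((P *m Am z.1 *m invmx P) j k) ((P *m Am z.2 *m invmx P) j k).
Proof.
have AE : AC z = toC (Am z.1) + (Complex 0 1 : C) *: toC (Am z.2).
  apply/matrixP=> a b; rewrite ACE [RHS]mxE [X in _ = _ + X]mxE [X in _ = X + _]mxE [X in _ = _ + _ * X]mxE.
  by apply/eqP; rewrite eq_complex /= !(mul0r, mul1r, mulr0, addr0, add0r, subr0) !eqxx.
have -> : wad z = toC (P *m Am z.1 *m invmx P) +
    (Complex 0 1 : C) *: toC (P *m Am z.2 *m invmx P).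
  by rewrite /wad AE mulmxDr mulmxDl -scalemxAr -scalemxAl !map_mxM /= map_invmx.
rewrite [LHS]mxE [X in _ + X = _]mxE [X in X + _ = _]mxE [X in _ + _ * X = _]mxE.
by apply/eqP; rewrite eq_complex /= !(mul0r, mul1r, mulr0, addr0, add0r, subr0) !eqxx.
Qed.

Lemma diagC_homog (D : 'rV[R]_n) r X :
  diagC D *m X - X *m diagC D = rc r *: X <-> homog D r X.
Proof.
have E j k : (diagC D *m X - X *m diagC D) j k = rc (D 0 j - D 0 k) * X j k.
  by rewrite mul_diag_mx mul_mx_diag !mxE rmorphB mulrBl [X in _ - X]mulrC.
split=> [H j k nz|H].
  have /(mulIf nz)/(fmorph_inj rc) // : rc (D 0 j - D 0 k) * X j k = rc r * X j k.
  by rewrite -E H mxE.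
apply/matrixP=> j k; rewrite E mxE.
by have [->|/H ->] := eqVneq (X j k) 0; rewrite ?mulr0.
Qed.

Lemma wad_eq0 z : wad z = 0 -> z = 0.
Proof.
move=> /(congr1 (fun M => invmx Pc *m M *m Pc)).
rewrite /wad mulmx0 mul0mx !mulmxA mulVmx // mul1mx mulmxKV // => /matrixP z0.
case: z z0 => x y z0; congr pair; apply: Am_faithful; apply/matrixP=> i j;
by have := z0 i j; rewrite ACE !mxE => -[].
Qed.

Lemma wad_homog x r z : x \in h0 ->
  homog (wt x) r (wad z) <-> lie (cinj x) z = rc r *: z.
Proof.
move=> xh; rewrite -diagC_homog -wad_cinj // -wad_lie -linearZ; split=> [|-> //].
move=> H; apply/eqP; rewrite -subr_eq0; apply/eqP/wad_eq0.
by rewrite linearB /= H subrr.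
Qed.

Lemma clie_eigen x r z : x \in h0 ->
  lie (cinj x) z = rc r *: z <-> forall j, (Pc *m ccv z) j 0 != 0 -> wt x 0 j = r.
Proof.
move=> xh; have E j : (Pc *m ccv (lie (cinj x) z)) j 0 = rc (wt x 0 j) * (Pc *m ccv z) j 0.
  have -> : Pc *m ccv (lie (cinj x) z) = wad (cinj x) *m (Pc *m ccv z).
    by rewrite ccv_lie /wad !mulmxA mulmxKV.
  by rewrite wad_cinj // diag_mulmx_col [X in X * _]mxE.
split=> [xz j nz|H].
  apply: (fmorph_inj rc); apply: (mulIf nz).
  by rewrite -E xz linearZ /= -scalemxAr mxE.
apply: ccv_inj; apply: (can_inj (mulKmx Pcu)); apply/colP=> j.
rewrite E linearZ /= -scalemxAr [RHS]mxE.
by have [->|/H ->] := eqVneq ((Pc *m ccv z) j 0) 0; rewrite ?mulr0.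
Qed.

Definition wcomp x r z : gC := vcc (invmx Pc *m wcol (wt x) r (Pc *m ccv z)).

Lemma wcompE x r z : Pc *m ccv (wcomp x r z) = wcol (wt x) r (Pc *m ccv z).
Proof. by rewrite vccK mulKVmx. Qed.

Lemma wcomp_sum x z : z = \sum_(r <- undup [seq wt x 0 j | j : 'I_n]) wcomp x r z.
Proof.
apply: ccv_inj; apply: (can_inj (mulKmx Pcu)); rewrite linear_sum mulmx_sumr.
apply/colP=> j; rewrite summxE.
rewrite (eq_bigr (fun r => if wt x 0 j == r then (Pc *m ccv z) j 0 else 0)) => [|r _]; last first.
  by rewrite wcompE [wcol _ _ _ _ _]mxE.
move: ((Pc *m ccv z) j 0) => v; rewrite (bigD1_seq (wt x 0 j)) ?undup_uniq //=; last first.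
  by rewrite mem_undup; apply/mapP; exists j; rewrite ?mem_enum.
by rewrite eqxx big1 ?addr0 // => r /negPf rj; rewrite eq_sym rj.
Qed.

Lemma lie_wcomp x r z : x \in h0 -> lie (cinj x) (wcomp x r z) = rc r *: wcomp x r z.
Proof.
move=> xh; apply/clie_eigen => // j; rewrite wcompE [wcol _ _ _ _ _]mxE.
by have [|_] := eqVneq (wt x 0 j) r; rewrite ?eqxx.
Qed.

Lemma lie_wcomp_eigen x y c r z : x \in h0 -> lie (cinj x) z = rc r *: z ->
  lie (cinj x) (wcomp y c z) = rc r *: wcomp y c z.
Proof.
move=> xh /(clie_eigen _ _ xh) H; apply/clie_eigen => // j; rewrite wcompE [wcol _ _ _ _ _]mxE.
by case: ifP => [_|]; [exact: H | rewrite eqxx].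
Qed.

Lemma mem_cgrade0 z : z \in cplxv (grade phi 0) <-> toC (rmx phi) *m ccv z = ccv z.
Proof.
rewrite mem_cplxv -cmx_cplx_end -ccv_app cplx_endE; split=> [/andP[/mem_grade0 p1 /mem_grade0 p2]|].
  by rewrite p1 p2; case: z {p1 p2}.
by move/ccv_inj; case: z => a b [p1 p2]; apply/andP; split; apply/mem_grade0.
Qed.

(** As [phi] commutes with [ad x], its matrix in the weight basis has degree zero and commutes with
    the projections to weight spaces. *)
Lemma wcomp_grade0 x r z : x \in h0 -> rmx phi *m Am x = Am x *m rmx phi ->
  z \in cplxv (grade phi 0) -> wcomp x r z \in cplxv (grade phi 0).
Proof.
move=> xh px /mem_cgrade0 pz; apply/mem_cgrade0; apply: (can_inj (mulKmx Pcu)).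
pose M := Pc *m toC (rmx phi) *m invmx Pc.
have MP v : Pc *m (toC (rmx phi) *m v) = M *m (Pc *m v).
  by rewrite /M !mulmxA mulmxKV.
have Mh : homog (wt x) 0 M.
  apply/diagC_homog; rewrite rmorph0 scale0r -wad_cinj //.
  have -> : wad (cinj x) *m M = Pc *m (toC (Am x *m rmx phi)) *m invmx Pc.
    by rewrite /wad /M AC_cinj map_mxM !mulmxA mulmxKV.
  have -> : M *m wad (cinj x) = Pc *m (toC (rmx phi *m Am x)) *m invmx Pc.
    by rewrite /wad /M AC_cinj map_mxM !mulmxA mulmxKV.
  by rewrite px subrr.
have := wcol_homog r (Pc *m ccv z) Mh; rewrite subr0 -MP pz => E.
by rewrite MP wcompE -E.
Qed.

(** [wad] carries the bracket with [x] to the commutator with the diagonal matrix of its weights, so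
    it respects the decompositions into eigenvectors. With [wcomp_grade0], the image of [g_0^c] is
    closed under homogeneous components. *)
Lemma hcomp_wad x r z : x \in h0 -> hcomp (wt x) r (wad z) = wad (wcomp x r z).
Proof.
move=> xh; apply/matrixP=> j k; rewrite mxE {1}[z](wcomp_sum x) linear_sum summxE.
have H c : (wad (wcomp x c z) j k != 0) -> wt x 0 j - wt x 0 k = c.
  by move=> nz; have /(wad_homog c (wcomp x c z) xh) := lie_wcomp c z xh; apply.
case: eqP => [jk|jk]; last first.
  by symmetry; apply/eqP; apply: contra_notT jk; exact: H.
set rs := undup _; have urs : uniq rs by rewrite undup_uniq.
have z0 c : c != r -> wad (wcomp x c z) j k = 0.
  by move=> cr; apply/eqP; apply: contraNT cr => /H <-; apply/eqP.
have [rin|rout] := boolP (r \in rs).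
  by rewrite (bigD1_seq r) //= big1 ?addr0.
rewrite big1_seq => [|c /andP[_ crs]].
  have -> : wcomp x r z = 0; last by rewrite linear0 mxE.
  apply: ccv_inj; apply: (can_inj (mulKmx Pcu)); rewrite wcompE linear0 mulmx0.
  apply/colP=> l; rewrite [wcol _ _ _ _ _]mxE [RHS]mxE; case: eqP => // lr; case/negP: rout.
  by rewrite mem_undup -lr; apply/mapP; exists l; rewrite ?mem_enum.
by apply: z0; apply: contraNneq rout => <-.
Qed.

End ComplexWeights.

Lemma adjoint_group_lie_aut (R : rcfType) (g : lieAlgType R) (u : 'End(complexification g)) :
  adjoint_group u -> lie_aut u.
Proof. by case=> B [BG _ _ /BG [v va /cmx_inj ->]]. Qed.

Lemma sumr_neq0 (V : nmodType) (I : Type) (r : seq I) (F : I -> V) :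
  \sum_(i <- r) F i != 0 -> exists i, F i != 0.
Proof.
elim: r => [|i r IH]; first by rewrite big_nil eqxx.
by rewrite big_cons; have [->|Fi _] := eqVneq (F i) 0; [rewrite add0r | exists i].
Qed.

(** * Uniqueness of the dominant characteristic *)

Section Compare.
Variables (R : rcfType) (g : lieAlgType R) (phi : 'End(g)) (h0 : {vspace g}).
Local Notation n := (\dim {:g}).
Local Notation gC := (complexification g).
Local Notation C := R[i].
Local Notation rc := (real_complex R).
Local Notation toC := (map_mx (real_complex R)).
Local Notation diagC x := (diag_mx (toC x)).
Variables (P : 'M[R]_n) (s : g) (G0c : 'End(gC) -> Prop).
Local Notation wt := (wt P).
Local Notation Pc := (toC P).
Local Notation wad := (wad P).
Implicit Types (x y w : g) (z : gC) (r : R) (X : 'M[C]_n).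

Hypothesis phi_aut : lie_aut phi.
Hypothesis Am_faithful : forall x, Am x = 0 -> x = 0.
Hypothesis h0_cartan : cartan_subalgebra (grade phi 0) h0.
Hypothesis Pu : P \in unitmx.
Hypothesis Pdiag : forall x, x \in h0 -> is_diag_mx (P *m Am x *m invmx P).
Hypothesis sh : s \in h0.
Hypothesis s_gen : generic h0 P s.
Hypothesis HG : is_G0c phi G0c.

(** Dominance for the roots of [g_0] positive on [s]. Roots enter only through common eigenvectors
    [E] of [s] and [x], with eigenvalues [r] and [c]. *)
Definition dominant x := forall r c E, phi E = E -> lie s E = r *: E -> 0 < r ->
  lie x E = c *: E -> E != 0 -> 0 <= c.

Let l X := exists2 z, z \in cplxv (grade phi 0) & X = wad z.

Let Pcu : Pc \in unitmx. Proof. by rewrite map_unitmx. Qed.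

Let h0_grade x : x \in h0 -> x \in grade phi 0.
Proof. by case: h0_cartan => /subvP + _ _ _; apply. Qed.

Let h0_comm x : x \in h0 -> rmx phi *m Am x = Am x *m rmx phi.
Proof.
move=> xh; rewrite (mxaut_Am _ (lie_aut_mxaut phi_aut)) rmxK.
by move/h0_grade/mem_grade0: xh => ->.
Qed.

Let lie_cinjE x z r : lie (cinj x) z = rc r *: z <->
  lie x z.1 = r *: z.1 /\ lie x z.2 = r *: z.2.
Proof.
case: z => a b; split=> [|[/= Ea Eb]].
  by case=> /=; rewrite !lie0l subr0 addr0 !scale0r subr0 addr0.
by congr pair; rewrite /= !lie0l ?subr0 ?addr0 !scale0r ?subr0 ?addr0.
Qed.

Let l_comm X Y : l X -> l Y -> l (X *m Y - Y *m X).
Proof.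
case=> z zg -> [w wg ->]; exists (lie z w); last by rewrite wad_lie.
move: zg wg; rewrite !mem_cplxv => /andP[/mem_grade0 z1 /mem_grade0 z2] /andP[/mem_grade0 w1 /mem_grade0 w2].
by apply/andP; split; apply/mem_grade0; rewrite /= ?linearB ?linearD /= !phi_aut.2 z1 z2 w1 w2.
Qed.

Let l_hcomp r X : l X -> l (hcomp (wt s) r X).
Proof.
case=> z zg ->; exists (wcomp P s r z); last by rewrite (hcomp_wad Pu Pdiag Am_faithful).
by apply: (wcomp_grade0 Pu Pdiag); rewrite ?h0_comm.
Qed.

Let l_homog0 X : l X -> homog (wt s) 0 X -> is_diag_mx X.
Proof.
case=> z zg -> /(wad_homog Pu Pdiag Am_faithful _ _ sh)/lie_cinjE[]; rewrite !scale0r => s1 s2.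
move: zg; rewrite mem_cplxv => /andP[z1 z2].
have /Pdiag/is_diag_mxP d1 := generic_centralizer Pu Pdiag h0_cartan sh s_gen z1 s1.
have /Pdiag/is_diag_mxP d2 := generic_centralizer Pu Pdiag h0_cartan sh s_gen z2 s2.
by apply/is_diag_mxP => j k jk; rewrite wadE d1 // d2.
Qed.

(** A nonzero entry of [X] is seen by some [x]-weight component [zc] of [z], which is still an
    eigenvector of [s]. Its real or imaginary part is a nonzero eigenvector in [g_0], to which
    dominance applies. *)
Let l_dom x : x \in h0 -> dominant x -> forall r X, l X -> homog (wt s) r X -> 0 < r ->
  forall j k, X j k != 0 -> wt x 0 k <= wt x 0 j.
Proof.
move=> xh xd r X [z zg ->] /(wad_homog Pu Pdiag Am_faithful _ _ sh) sz r0 j k.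
have xs c : homog (wt x) c (wad (wcomp P x c z)).
  exact: (wad_homog Pu Pdiag Am_faithful _ _ xh).2 (lie_wcomp Pu Pdiag c z xh).
rewrite {1}(wcomp_sum Pu x z) linear_sum summxE => /sumr_neq0[c cnz].
set zc := wcomp P x c z in cnz.
rewrite -subr_ge0 (xs c _ _ cnz).
have zc0 : zc != 0 by apply: contraNneq cnz => ->; rewrite linear0 mxE.
have /lie_cinjE[x1 x2] := lie_wcomp Pu Pdiag c z xh.
have /lie_cinjE[s1 s2] := lie_wcomp_eigen Pu Pdiag x c sh sz.
have : zc \in cplxv (grade phi 0) by apply: (wcomp_grade0 Pu Pdiag); rewrite ?h0_comm.
rewrite mem_cplxv => /andP[/mem_grade0 p1 /mem_grade0 p2].
have [z1|z1] := eqVneq zc.1 0; last exact: (xd r c zc.1).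
apply: (xd r c zc.2) => //; apply: contraNneq zc0 => z2.
by rewrite [zc]surjective_pairing z1 z2.
Qed.

Let Gl A X : mxset G0c A -> l X ->
  l (Pc *m (invmx A *m (invmx Pc *m X *m Pc) *m A) *m invmx Pc).
Proof.
case: HG => _ Galg _ Glie GA [z zg ->].
have lz : group_lie_algebra (mxset G0c) (AC z) by apply/Glie; exists z.
have /Glie[z' z'g E] := group_lie_algebra_conj Galg GA lz.
exists z'; first exact: z'g.
rewrite /wad; have -> : AC z' = invmx A *m AC z *m A by exact: esym E.
by rewrite !mulmxA !(mulmxKV Pcu).
Qed.

(** Let [w] be the preimage of [y] under [u]. Then [w] and [x] have the same bracket with [ex], and
    both are brackets of [ex] with something. So [z = w - x] lies in the kernel and in the image of
    [ad ex], and [sl2_positive_weights] applies to it. *)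
Lemma weight_le x y (ex fx ey fy : gC) u : x \in h0 -> y \in h0 -> dominant x ->
  lie (cinj x) ex = 2%:R *: ex -> lie (cinj x) fx = - (2%:R *: fx) -> lie ex fx = cinj x ->
  lie (cinj y) ey = 2%:R *: ey -> lie ey fy = cinj y ->
  G0c u -> u ex = ey ->
  forall c, \sum_(j | c <= wt s 0 j) wt y 0 j <= \sum_(j | c <= wt s 0 j) wt x 0 j.
Proof.
move=> xh yh xd xex xfx exfx yey eyfy Gu uex c.
have [Gad [Gun G1 GM GV _] Gcon Glie] := HG.
have uL := (adjoint_group_lie_aut (Gad _ Gu)).2.
have Uu : cmx u \in unitmx by apply: Gun; exists u.
have [uV uVK] : exists uV : gC -> gC, forall z, u (uV z) = z.
  exists (fun z => vcc (invmx (cmx u) *m ccv z)) => z.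
  by apply: ccv_inj; rewrite ccv_app vccK mulKVmx.
have u_inj : injective u.
  move=> z1 z2 /(congr1 (@ccv R g)); rewrite !ccv_app => E; apply: ccv_inj.
  exact: (can_inj (mulKmx Uu) E).
pose w := uV (cinj y); pose z := w - cinj x.
have wex : lie w ex = 2%:R *: ex by apply: u_inj; rewrite uL uVK uex yey linearZ /= uex.
have exf : lie ex (uV fy) = w.
  apply: u_inj; apply: etrans (uL _ _) _; rewrite uex (uVK fy) eyfy.
  exact: esym (uVK (cinj y)).
have exz : lie ex z = 0.
  by rewrite lieC /z lieDl lieNl wex xex subrr oppr0.
have zE : z = lie ex (uV fy - fx) by rewrite lieDr lieNr exf exfx.
have zpos j k : wad z j k != 0 -> wt x 0 k < wt x 0 j.
  rewrite {1}(wcomp_sum Pu x z) linear_sum summxE => /sumr_neq0[r rnz].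
  have xr := (wad_homog Pu Pdiag Am_faithful _ _ xh).2 (lie_wcomp Pu Pdiag r z xh).
  rewrite -subr_gt0 (xr _ _ rnz).
  have [i nz] : exists i, (Pc *m ccv (wcomp P x r z)) i 0 != 0.
    apply/existsP; move: rnz; apply: contraNT; rewrite negb_exists => /forallP H.
    suff -> : wcomp P x r z = 0 by rewrite linear0 mxE.
    apply: ccv_inj.
    apply: (can_inj (mulKmx Pcu)); rewrite linear0 mulmx0; apply/colP=> i; rewrite [RHS]mxE.
    by have := H i; rewrite negbK => /eqP.
  move: nz; rewrite (wcompE Pu) [wcol _ _ _ _ _]mxE; case: ifP => [/eqP <- vi|_]; last by rewrite eqxx.
  have wadv z1 z2 : wad z1 *m (Pc *m ccv z2) = Pc *m ccv (lie z1 z2).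
    by rewrite ccv_lie /wad !mulmxA mulmxKV.
  apply: (sl2_positive_weights (E := wad ex) (F := wad fx) _ _ _ (v := Pc *m ccv z)
    (v' := Pc *m ccv (uV fy - fx))) vi.
  - by apply/(wad_homog Pu Pdiag Am_faithful _ _ xh); rewrite xex rmorph_nat.
  - by apply/(wad_homog Pu Pdiag Am_faithful _ _ xh); rewrite xfx rmorphN rmorph_nat scaleNr.
  - by rewrite -wad_lie // exfx (wad_cinj Pdiag).
  - by rewrite wadv exz linear0 mulmx0.
  by rewrite wadv -zE.
have ly : l (diagC (wt y)).
  by exists (cinj y); rewrite ?(wad_cinj Pdiag) // mem_cplxv h0_grade //= mem0v.
apply: (weight_sum_le l_comm l_hcomp l_homog0 (l_dom xh xd) Pcu Gcon G1 Gun Gl ly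
  (u := cmx u) (Z := wad z)) => //; first by exists u.
have -> : invmx Pc *m diagC (wt y) *m Pc = AC (cinj y).
  by rewrite -(wad_cinj Pdiag) // /wad !mulmxA mulVmx // mul1mx mulmxKV.
have -> : invmx (cmx u) *m AC (cinj y) *m cmx u = AC w.
  by rewrite -[cinj y]uVK -mulmxA -AC_conj // mulKmx.
by rewrite -(wad_cinj Pdiag) // -linearD /z addrC subrK.
Qed.

(* [weight_le] in both directions equates the partial sums of the weights of [x]
   and [y] taken along decreasing values of [s], which determine the weights. *)
Lemma dominant_characteristic_unique x y (ex fx ey fy : gC) u :
  x \in h0 -> y \in h0 -> dominant x -> dominant y ->
  lie (cinj x) ex = 2%:R *: ex -> lie (cinj x) fx = - (2%:R *: fx) -> lie ex fx = cinj x ->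
  lie (cinj y) ey = 2%:R *: ey -> lie (cinj y) fy = - (2%:R *: fy) -> lie ey fy = cinj y ->
  G0c u -> u ex = ey -> x = y.
Proof.
move=> xh yh xd yd xex xfx exfx yey yfy eyfy Gu uex.
have [v Gv vey] : exists2 v, G0c v & v ey = ex.
  have [_ [Gun _ _ GV _] _ _] := HG; have GU : mxset G0c (cmx u) by exists u.
  have [v Gv vE] := GV _ GU; exists v => //; apply: ccv_inj.
  by rewrite -uex !ccv_app -vE mulKmx // Gun.
have lam c : \sum_(j | c <= wt s 0 j) wt x 0 j = \sum_(j | c <= wt s 0 j) wt y 0 j.
  apply/eqP; rewrite eq_le; apply/andP; split.
    exact: (weight_le yh xh yd yey yfy eyfy xex exfx Gv vey).
  exact: (weight_le xh yh xd xex xfx exfx yey eyfy Gu uex).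
have wxy : wt x = wt y.
  (* Induction on the number of indices with larger [s]-weight. Those terms cancel in [lam]; on the
     level of [i] both weights are constant since [s] is generic, which leaves equal positive
     multiples of the two weights at [i]. *)
  apply/rowP=> i; have [m] := ubnP #|[set j | wt s 0 i < wt s 0 j]|.
  elim: m i => // m IH i; rewrite ltnS => im.
  have := lam (wt s 0 i).
  rewrite [LHS](bigID (fun j => wt s 0 j == wt s 0 i)) [RHS](bigID (fun j => wt s 0 j == wt s 0 i)) /=.
  rewrite [X in _ + X = _](eq_bigr (fun j => wt y 0 j)); last first.
    move=> j /andP[sij sji]; apply: IH; apply: leq_trans im; apply/proper_card/properP.
    have lij : wt s 0 i < wt s 0 j by rewrite lt_neqAle eq_sym sji.
    split; last by exists j; rewrite !inE ?ltxx.
    by apply/subsetP=> k; rewrite !inE; apply: lt_trans.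
  move/addIr; have cst w : w \in h0 ->
     \sum_(j | (wt s 0 i <= wt s 0 j) && (wt s 0 j == wt s 0 i)) wt w 0 j =
     wt w 0 i *+ #|[pred j | (wt s 0 i <= wt s 0 j) && (wt s 0 j == wt s 0 i)]|.
    move=> wh; rewrite -sumr_const; apply: eq_big => // j /andP[_ /eqP].
    by apply: (s_gen wh).1.
  rewrite !cst //; apply: pmulrnI.
  by apply/card_gt0P; exists i; rewrite !inE lexx eqxx.
have AE w : w \in h0 -> Am w = invmx P *m diag_mx (wt w) *m P.
  by move=> wh; rewrite -(wtE Pdiag wh) !mulmxA mulVmx // mul1mx mulmxKV.
have Axy : Am x = Am y by rewrite (AE _ xh) (AE _ yh) wxy.
by apply/eqP; rewrite -subr_eq0; apply/eqP/Am_faithful; rewrite linearB /= Axy subrr.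
Qed.
End Compare.

(** * Real points *)

Section RealPoints.
Import mpoly.
Variable R : rcfType.
Local Notation C := R[i].
Local Notation toC := (map_mx (real_complex R)).
Local Notation conj := (map_mx (@Num.conj C)).

Lemma mxev_conj n (A : 'M[C]_n) p : p \is a mpolyOver (n * n) Num.real ->
  mxev (conj A) p = Num.conj (mxev A p).
Proof.
move/mpolyOverP => pr; rewrite /mxev !mevalE rmorph_sum; apply: eq_bigr => m _.
rewrite rmorphM /= rmorph_prod; congr (_ * _); first by rewrite conj_Creal ?pr.
by apply: eq_bigr => i _; rewrite rmorphXn -map_mxvec mxE.
Qed.

(** The vanishing ideal of [G] has real generators, and a real polynomial that vanishes at [A]
    vanishes at its conjugate. *)
Lemma conj_group n (G : 'M[C]_n -> Prop) A : algebraic_group G -> defined_over Num.real G ->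
  G A -> G (conj A).
Proof.
case=> Gu _ _ _ [S GS] Gr GA; have Au := Gu _ GA.
apply/GS; first by rewrite map_unitmx.
move=> p Sp; have pG : vanishes_on p G by move=> B GB; apply: (GS _ (Gu _ GB)).1.
have [s sr ->] := Gr p pG; rewrite mxevE rmorph_sum big1_seq // => u /andP[_ /sr[ur u0]].
by rewrite rmorphM /= [X in _ * X]mxev_conj // -[mxev A _]mxevE u0 // rmorph0 mulr0.
Qed.

Lemma regular_map_conj k n (G : 'M[C]_k -> Prop) (F : 'M[C]_k -> 'M[C]_n) A :
  regular_map_over Num.real G F -> G A -> G (conj A) -> F (conj A) = conj (F A).
Proof.
case=> P [N [Pr FE]] GA GcA; apply/matrixP=> i j.
rewrite [RHS]mxE !FE // !mxevE mxev_conj // det_map_mx fmorph_div.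
by rewrite rmorphXn.
Qed.

(** The preimage and its conjugate have the same image, because [F] has real coefficients and
    [toC a] is real; injectivity makes the preimage real. *)
Lemma real_preimage k n (G : 'M[C]_k -> Prop) (H : 'M[C]_n -> Prop) F (a : 'M[R]_n) :
  algebraic_group G -> defined_over Num.real G ->
  algebraic_group_iso_over Num.real G H F -> H (toC a) ->
  exists2 A, G A /\ A \is a mxOver Num.real & F A = toC a.
Proof.
move=> Galg Gr [_ Freg [F' [_ GF HF']]] Ha; have [GA FA] := HF' _ Ha.
exists (F' (toC a)) => //; split=> //; set A := F' (toC a) in GA FA *.
have GcA := conj_group Galg Gr GA.
have FcA : F (conj A) = F A.
  rewrite (regular_map_conj Freg GA GcA) FA -map_mx_comp; apply: eq_map_mx => r /=.
  by rewrite conj_Creal // complex_real.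
have cA : conj A = A by rewrite -[RHS](GF A GA).2 -FcA (GF _ GcA).2.
by apply/mxOverP=> i j; apply/CrealP; rewrite -{2}cA mxE.
Qed.
End RealPoints.

From mathcomp Require Import all_classical all_reals all_analysis.

Import numFieldNormedType.Exports.

Local Open Scope classical_set_scope.
Local Open Scope ring_scope.

(** * The matrix exponential *)

Lemma cvgn_sum (R : realType) (I : Type) (r : seq I) (f : I -> R^nat) (a : I -> R) :
  (forall i, f i @ \oo --> a i) ->
  (fun m => \sum_(i <- r) f i m) @ \oo --> \sum_(i <- r) a i.
Proof.
move=> fa; elim: r => [|i r IH].
  rewrite big_nil (_ : (fun _ => _) = cst 0); first exact: cvg_cst.
  by apply/funext => m; rewrite big_nil.
rewrite big_cons (_ : (fun _ => _) = f i + (fun m => \sum_(i <- r) f i m)).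
  exact: cvgD.
by apply/funext => m; rewrite big_cons.
Qed.

Section MatrixExponential.
Variables (R : realType) (n : nat).
Implicit Types (A B Y : 'M[R]_n).

Definition mxsum A : R := \sum_i \sum_j `|A i j|.

Lemma mxsum_ge0 A : 0 <= mxsum A.
Proof. by do 2!apply: sumr_ge0 => ? _. Qed.

Lemma mxsum_row A i : \sum_j `|A i j| <= mxsum A.
Proof. by rewrite /mxsum [leRHS](bigD1 i) //= lerDl sumr_ge0 // => k _; rewrite sumr_ge0. Qed.

Lemma mxsum_ge A i j : `|A i j| <= mxsum A.
Proof.
by rewrite (le_trans _ (mxsum_row A i)) // [leRHS](bigD1 j) //= lerDl sumr_ge0.
Qed.

Lemma ler_mxsum_exp A Y k i j : `|(A *m Y ^+ k) i j| <= mxsum A * mxsum Y ^+ k.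
Proof.
elim: k => [|k IH] in A i j *; first by rewrite expr0 mulmx1 expr0 mulr1 mxsum_ge.
rewrite exprSr -mulmxE mulmxA mxE (le_trans (ler_norm_sum _ _ _)) //.
have : \sum_l `|(A *m Y ^+ k) i l * Y l j| <= \sum_l (mxsum A * mxsum Y ^+ k) * `|Y l j|.
  by apply: ler_sum => l _; rewrite normrM ler_wpM2r.
move/le_trans; apply; rewrite -mulr_sumr exprSr mulrA ler_wpM2l //.
  by rewrite mulr_ge0 ?exprn_ge0 ?mxsum_ge0.
rewrite /mxsum [leRHS]exchange_big [leRHS](bigD1 j) //= lerDl sumr_ge0 // => k' _; exact: sumr_ge0.
Qed.

Definition expcoef A Y i j (k : nat) : R := (A *m Y ^+ k) i j / k`!%:R.

Lemma cvg_expcoef A Y i j x : cvgn (pseries (expcoef A Y i j) x).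
Proof.
apply: normed_cvg.
apply: (@series_le_cvg _ _ (fun k => mxsum A * exp_coeff (mxsum Y * `|x|) k)).
- by move=> k /=.
- move=> k; rewrite mulr_ge0 ?mxsum_ge0 // exp_coeff_ge0 // mulr_ge0 ?mxsum_ge0 //.
- move=> k; rewrite /= /expcoef /exp_coeff /= !normrM normfV normr_nat normrX exprMn.
  rewrite [X in _ <= X](_ : _ = (mxsum A * mxsum Y ^+ k) * (`|x| ^+ k / k`!%:R)); last by ring.
  by rewrite -mulrA [_^-1 * _]mulrC ler_wpM2r ?ler_mxsum_exp // mulr_ge0 ?exprn_ge0 ?invr_ge0.
by apply: is_cvg_seriesZ; exact: is_cvg_series_exp_coeff.
Qed.

Definition mxexp Y t : 'M[R]_n := \matrix_(i, j) limn (pseries (expcoef 1%:M Y i j) t).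

Lemma mulmx_mxexp A Y t i j : (A *m mxexp Y t) i j = limn (pseries (expcoef A Y i j) t).
Proof.
rewrite mxE; apply/esym/cvg_lim => //.
rewrite (_ : pseries _ _ = fun m => \sum_l A i l * pseries (expcoef 1%:M Y l j) t m); last first.
  apply/funext => m; rewrite /pseries /series /=.
  under [RHS]eq_bigr do rewrite mulr_sumr.
  rewrite exchange_big /=; apply: eq_bigr => k _.
  rewrite /expcoef mxE !mulr_suml; apply: eq_bigr => l _; rewrite mul1mx; ring.
apply: cvgn_sum => l; apply: cvgM; first exact: cvg_cst.
rewrite mxE; exact: cvg_expcoef.
Qed.

Lemma mxexp_mulmx A Y t i j : (mxexp Y t *m A) i j =
  limn (pseries (fun k => (Y ^+ k *m A) i j / k`!%:R) t).
Proof.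
rewrite mxE; apply/esym/cvg_lim => //.
rewrite (_ : pseries _ _ = fun m => \sum_l pseries (expcoef 1%:M Y i l) t m * A l j); last first.
  apply/funext => m; rewrite /pseries /series /=.
  under [RHS]eq_bigr do rewrite mulr_suml.
  rewrite exchange_big /=; apply: eq_bigr => k _.
  rewrite /expcoef mxE !mulr_suml; apply: eq_bigr => l _; rewrite mul1mx; ring.
apply: cvgn_sum => l; apply: cvgM; last exact: cvg_cst.
rewrite mxE; exact: cvg_expcoef.
Qed.

Lemma mxexp_comm A Y t : A *m Y = Y *m A -> A *m mxexp Y t = mxexp Y t *m A.
Proof.
move=> AY; have AYk k : A *m Y ^+ k = Y ^+ k *m A.
  elim: k => [|k IH]; first by rewrite expr0 mulmx1 mul1mx.
  by rewrite exprSr -mulmxE mulmxA IH -mulmxA AY mulmxA.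
apply/matrixP=> i j; rewrite mulmx_mxexp mxexp_mulmx; congr (limn (pseries _ _)).
by apply/funext => k; rewrite /expcoef AYk.
Qed.

Lemma mxexp0 Y : mxexp Y 0 = 1%:M.
Proof.
apply/matrixP=> i j; rewrite mxE; apply/cvg_lim => //.
apply: cvg_near_cst; near=> m.
have m0 : (0 < m)%N by near: m; exists 1%N.
rewrite /pseries /series /= -(prednK m0) big_nat_recl //= big1 => [|k _].
  by rewrite /expcoef !expr0 mulmx1 fact0 divr1 mulr1 addr0.
by rewrite expr0n /= mulr0.
Unshelve. all: by end_near. Qed.

(** Termwise differentiation of the power series: it turns the coefficients attached to [A] into
    those attached to [A *m Y]. *)
Lemma is_derive_mxexp Y (t : R) i j :
  is_derive t 1 (fun t => mxexp Y t i j) ((Y *m mxexp Y t) i j).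
Proof.
have dE A : pseries_diffs (expcoef A Y i j) = expcoef (A *m Y) Y i j.
  apply/funext => k; rewrite /pseries_diffs /expcoef factS natrM invfM -mulmxA mulmxE -exprS.
  set a := (A *m _) i j; have k0 : k.+1%:R != 0 :> R by rewrite pnatr_eq0.
  by rewrite mulrCA mulVKf.
rewrite mulmx_mxexp -[Y in limn (pseries (expcoef Y _ _ _) _)]mul1mx -dE.
rewrite (_ : (fun _ => _) = fun t => limn (pseries (expcoef 1%:M Y i j) t)); last first.
  by apply/funext => x; rewrite mxE.
apply: (@pseries_snd_diffs _ _ (`|t| + 1)); rewrite ?dE; try exact: cvg_expcoef.
by rewrite [ltRHS]ger0_norm // ?ltrDl // addr_ge0.
Qed.
End MatrixExponential.

Section MatrixDerivative.
Variable R : realType.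

Definition mxderiv m n (F : R -> 'M[R]_(m, n)) (t : R) (dF : 'M[R]_(m, n)) :=
  forall i j, is_derive t 1 (fun t => F t i j) (dF i j).

Lemma is_derive_bigsum n (h : 'I_n -> R -> R) (t : R) (dh : 'I_n -> R) :
  (forall i, is_derive t 1 (h i) (dh i)) ->
  is_derive t 1 (fun t => \sum_i h i t) (\sum_i dh i).
Proof.
move=> H; rewrite (_ : (fun _ => _) = \sum_i h i); first exact: is_derive_sum.
by apply/funext => x; rewrite fct_sumE.
Qed.

Lemma mxderiv_cst m n (A : 'M[R]_(m, n)) t : mxderiv (fun=> A) t 0.
Proof. by move=> i j; rewrite mxE; exact: is_derive_cst. Qed.

Lemma mxderivM m n p (F : R -> 'M[R]_(m, n)) (G : R -> 'M[R]_(n, p)) t dF dG :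
  mxderiv F t dF -> mxderiv G t dG ->
  mxderiv (fun t => F t *m G t) t (dF *m G t + F t *m dG).
Proof.
move=> HF HG i j; rewrite (_ : (fun _ => _) = fun t => \sum_l F t i l * G t l j); last first.
  by apply/funext => x; rewrite mxE.
rewrite !mxE -big_split /=; apply: is_derive_bigsum => l.
apply: is_derive_eq; first exact: (is_deriveM (HF i l) (HG l j)).
by rewrite addrC; congr (_ + _); exact: mulrC.
Qed.

Lemma mxderiv0_cst m n (F : R -> 'M[R]_(m, n)) x y : (forall t, mxderiv F t 0) -> F x = F y.
Proof.
move=> H; apply/matrixP=> i j; apply: (@is_derive_0_is_cst _ (fun t => F t i j)) => t.
by have := H t i j; rewrite mxE.
Qed.

Lemma mxderiv_mxexp n (Y : 'M[R]_n) t : mxderiv (mxexp Y) t (Y *m mxexp Y t).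
Proof. by move=> i j; exact: is_derive_mxexp. Qed.

Lemma mxexp_mulVmx n (Y : 'M[R]_n) t : mxexp (- Y) t *m mxexp Y t = 1%:M.
Proof.
rewrite -[RHS](mulmx1 1%:M) -{2}(mxexp0 Y) -(mxexp0 (- Y)).
apply: (@mxderiv0_cst _ _ (fun t => mxexp (- Y) t *m mxexp Y t)) => s.
have := mxderivM (mxderiv_mxexp (- Y) s) (mxderiv_mxexp Y s).
rewrite (_ : - Y *m _ = mxexp (- Y) s *m - Y); last by apply: mxexp_comm.
by rewrite mulmxA -mulmxDl mulmxN addNr mul0mx.
Qed.

Lemma mxexp_unit n (Y : 'M[R]_n) t : mxexp Y t \in unitmx.
Proof. by case: (mulmx1_unit (mxexp_mulVmx Y t)). Qed.

(** The product [mxexp (- C) t *m F t] has zero derivative. *)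
Lemma linear_ode_unique r (C : 'M[R]_r) (F : R -> 'cV[R]_r) :
  (forall t, mxderiv F t (C *m F t)) -> F 0 = 0 -> forall t, F t = 0.
Proof.
move=> HF F0 t; have [_ CFu] := mulmx1_unit (mxexp_mulVmx C t).
have CNu := mxexp_unit (- C) t.
apply: (can_inj (mulKmx CNu)); rewrite mulmx0.
have <- : mxexp (- C) 0 *m F 0 = 0 by rewrite F0 mulmx0.
apply: (@mxderiv0_cst _ _ (fun t => mxexp (- C) t *m F t)) => s.
have := mxderivM (mxderiv_mxexp (- C) s) (HF s).
rewrite (_ : - C *m _ = mxexp (- C) s *m - C); last by apply: mxexp_comm.
by rewrite mulmxA -mulmxDl mulmxN addNr mul0mx.
Qed.

Variables (n : nat) (Y : 'M[R]_n).

Lemma is_derive_mxev (t : R) p :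
  is_derive t 1 (fun t => mxev (mxexp Y t) p) (mxev (mxexp Y t) (mxder Y p)).
Proof.
rewrite mxev_der -(mxexp_comm _ (erefl (Y *m Y))).
elim/mpoly_ring_ind: p => [c|k|p q IHp IHq|p q IHp IHq].
- rewrite mxdirC (_ : (fun _ => _) = cst c); first exact: is_derive_cst.
  by apply/funext => x; rewrite /mxev mpoly.mevalC.
- rewrite mxdirXU; case/mxvec_indexP: k => i j; rewrite mxvecE.
  rewrite (_ : (fun _ => _) = fun t => mxexp Y t i j); first exact: is_derive_mxexp.
  by apply/funext => x; rewrite mxevXU mxvecE.
- rewrite mxdirD (_ : (fun _ => _) = (fun t => mxev (mxexp Y t) p) + (fun t => mxev (mxexp Y t) q)).
    exact: is_deriveD.
  by apply/funext => x; rewrite rmorphD.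
rewrite mxdirM (_ : (fun _ => _) = fun t => mxev (mxexp Y t) p * mxev (mxexp Y t) q).
  refine (is_derive_eq (is_deriveM IHp IHq) _).
  by rewrite addrC; congr (_ + _); exact: mulrC.
by apply/funext => x; rewrite rmorphM.
Qed.

(** By [mxder_recurrence] the values along [mxexp Y t] of the first iterates form a solution of a
    linear system with companion matrix [C]. It starts at zero, hence stays zero. *)
Lemma mxev_mxexp0 p :
  (forall k, mxev 1%:M (iter k (mxder Y) p) = 0) -> forall t, mxev (mxexp Y t) p = 0.
Proof.
move=> p0 t; have [[|r] [c rec]] := mxder_recurrence Y p.
  by move: rec; rewrite big_ord0 /= => ->; rewrite rmorph0.
pose F t : 'cV[R]_r.+1 := \col_i mxev (mxexp Y t) (iter i (mxder Y) p).
pose C : 'M[R]_r.+1 := \matrix_(i, j)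
  (if i.+1 == r.+1 then c j else (j == i.+1 :> nat)%:R).
have F0 : F 0 = 0 by apply/colP=> i; rewrite !mxE mxexp0 p0.
have dF s : mxderiv F s (C *m F s).
  move=> i j; rewrite ord1 {j}.
  rewrite (_ : (fun _ => _) = fun t => mxev (mxexp Y t) (iter i (mxder Y) p)); last first.
    by apply/funext => x; rewrite mxE.
  apply: is_derive_eq; first exact: is_derive_mxev.
  rewrite -iterS mxE; have [ir|ir] := eqVneq i.+1 r.+1.
    rewrite ir rec rmorph_sum; apply: eq_bigr => j _.
    by apply: (etrans (mxevZ _ _ _)); rewrite !mxE ir eqxx.
  have ltir : (i.+1 < r.+1)%N by rewrite ltn_neqAle ir ltn_ord.
  rewrite (bigD1 (Ordinal ltir)) //= big1 ?addr0 => [|j /negPf jn].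
    by rewrite !mxE (negPf ir) eqxx mul1r.
  by rewrite !mxE (negPf ir) -[_ == _ :> nat]/(j == Ordinal ltir) jn mul0r.
by have /colP/(_ ord0) := linear_ode_unique dF F0 t; rewrite !mxE.
Qed.

End MatrixDerivative.

Section ExpInGroup.
Variables (R : realType) (n : nat) (G : 'M[R[i]]_n -> Prop).
Hypothesis Galg : algebraic_group G.
Local Notation toC := (map_mx (real_complex R)).

(** All iterated derivatives along [Y] of an equation of [G] vanish on [G], in particular at the
    identity, so the equation holds along the exponential. Real and imaginary parts are treated
    separately, through [key]. *)
Lemma mxexp_in_group (Y : 'M[R]_n) t :
  group_lie_algebra G (toC Y) -> G (toC (mxexp Y t)).
Proof.
move=> lY; case: (Galg) => Gu G1 _ _ [S GS].
have Eu : toC (mxexp Y t) \in unitmx by rewrite map_unitmx mxexp_unit.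
have [_ Gin] := GS _ Eu; apply: Gin => p Sp.
have pG : vanishes_on p G.
  by move=> A GA; have [/(_ GA)/(_ p Sp)] := GS A (Gu _ GA).
have key (f : {additive R[i] -> R}) : (forall a r, f (a * real_complex R r) = f a * r) ->
    f (mxev (toC (mxexp Y t)) p) = 0.
  move=> fR; rewrite -(mxev_mpart fR); apply: mxev_mxexp0 => k.
  rewrite (iter_mpart_der fR) mxev_mpart // map_mx1 -mxevE.
  by rewrite (iter_mxder_vanishes Galg k lY pG G1) raddf0.
rewrite mxevE; apply/eqP; rewrite eq_complex.
have -> : complex.Re (mxev (toC (mxexp Y t)) p) = 0.
  by apply: (key (@complex.Re R)) => [[a b] r] /=; rewrite mulr0 subr0.
have -> : complex.Im (mxev (toC (mxexp Y t)) p) = 0.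
  by apply: (key (@complex.Im R)) => [[a b] r] /=; rewrite mulr0 add0r mulrC.
by rewrite !eqxx.
Qed.
End ExpInGroup.

(** * Minimisation over closed groups of matrices *)

Section MatrixExtrema.
Variables (R : realType) (n : nat).
Implicit Types (a : 'M[R]_n) (f g : 'M[R]_n -> R).

(** Read through [vec_mx] because the compactness and extreme value results are applied to row
    vectors. *)
Definition mxcont f := continuous (fun v : 'rV[R]_(n * n) => f (vec_mx v)).

Lemma mxcont_cst c : mxcont (fun=> c).
Proof. by move=> x; exact: cst_continuous. Qed.

Lemma mxcont_entry i j : mxcont (fun a => a i j).
Proof.
rewrite /mxcont (_ : (fun _ => _) = fun v : 'rV[R]_(n * n) => v 0 (mxvec_index i j)).
  exact: coord_continuous.
by apply/funext => v; rewrite mxE.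
Qed.

Lemma mxcontD f g : mxcont f -> mxcont g -> mxcont (fun a => f a + g a).
Proof. by move=> cf cg x; exact: (cvgD (cf x) (cg x)). Qed.

Lemma mxcontM f g : mxcont f -> mxcont g -> mxcont (fun a => f a * g a).
Proof. by move=> cf cg x; exact: (cvgM (cf x) (cg x)). Qed.

Lemma mxcont_sum (I : Type) (r : seq I) (f : I -> 'M[R]_n -> R) :
  (forall i, mxcont (f i)) -> mxcont (fun a => \sum_(i <- r) f i a).
Proof.
move=> cf; elim: r => [|i r IH].
  rewrite /mxcont (_ : (fun _ => _) = fun=> 0); first exact: (@mxcont_cst 0).
  by apply/funext => v; rewrite big_nil.
rewrite /mxcont (_ : (fun _ => _) = fun v : 'rV[R]_(n * n) => f i (vec_mx v) +
    \sum_(i <- r) f i (vec_mx v)); first exact: (mxcontD (cf i) IH).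
by apply/funext => v; rewrite big_cons.
Qed.

Lemma mxcont_mulmx m p q (F : 'M[R]_n -> 'M[R]_(m, p)) (G : 'M[R]_n -> 'M[R]_(p, q)) :
  (forall i j, mxcont (fun a => F a i j)) -> (forall i j, mxcont (fun a => G a i j)) ->
  forall i j, mxcont (fun a => (F a *m G a) i j).
Proof.
move=> cF cG i j; rewrite /mxcont (_ : (fun _ => _) = fun v : 'rV[R]_(n * n) =>
    \sum_l F (vec_mx v) i l * G (vec_mx v) l j).
  exact: (@mxcont_sum _ _ (fun l a => F a i l * G a l j) (fun l => mxcontM (cF i l) (cG l j))).
by apply/funext => v; rewrite mxE.
Qed.

Lemma mxcont_tr m p (F : 'M[R]_n -> 'M[R]_(m, p)) :
  (forall i j, mxcont (fun a => F a i j)) -> forall i j, mxcont (fun a => (F a)^T i j).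
Proof.
move=> cF i j; rewrite /mxcont (_ : (fun _ => _) = fun v => F (vec_mx v) j i); first exact: (cF j i).
by apply/funext => v; rewrite mxE.
Qed.

Lemma mxcont_mxev p : mxcont (fun a => mxev a p).
Proof.
elim/mpoly_ring_ind: p => [c|k|p q IHp IHq|p q IHp IHq].
- rewrite /mxcont (_ : (fun _ => _) = fun=> c); first exact: (@mxcont_cst c).
  by apply/funext => x; rewrite /mxev mpoly.mevalC.
- case/mxvec_indexP: k => i j.
  rewrite /mxcont (_ : (fun _ => _) = fun v => vec_mx v i j); first exact: (@mxcont_entry i j).
  by apply/funext => x; rewrite mxevXU mxvecE.
- rewrite /mxcont (_ : (fun _ => _) = fun v => mxev (vec_mx v) p + mxev (vec_mx v) q).
    exact: (mxcontD IHp IHq).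
  by apply/funext => x; rewrite rmorphD.
rewrite /mxcont (_ : (fun _ => _) = fun v => mxev (vec_mx v) p * mxev (vec_mx v) q).
  exact: (mxcontM IHp IHq).
by apply/funext => x; rewrite rmorphM.
Qed.

Variable S : ('M[R]_n -> R) -> Prop.
Hypothesis S_cont : forall g, S g -> mxcont g.
Let Z a := forall g, S g -> g a = 0.

(** Only the sublevel set of [f a0] has to be bounded; it is closed, hence compact, and a minimum
    there is a minimum on all of [Z]. *)
Lemma mx_min_attained f a0 B : mxcont f -> Z a0 ->
  (forall a, Z a -> f a <= f a0 -> forall i j, `|a i j| <= B) ->
  exists2 a, Z a & forall b, Z b -> f a <= f b.
Proof.
move=> cf Za0 bdd.
pose D : set 'rV[R]_(n * n) := [set v | Z (vec_mx v) /\ f (vec_mx v) <= f a0].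
have D0 : D (mxvec a0) by rewrite /D /= mxvecK.
have Dclosed : closed D.
  rewrite (_ : D = (\bigcap_(g in S) [set v | g (vec_mx v) = 0]) `&`
      [set v | f (vec_mx v) <= f a0]).
    apply: closedI.
      apply: closed_bigI => g Sg.
      rewrite (_ : [set _ | _] = (fun v => g (vec_mx v)) @^-1` [set 0]) //.
      by apply: preimage_closed => [x _|]; [exact: (S_cont Sg) | exact: closed_eq].
    rewrite (_ : [set _ | _] = (fun v => f (vec_mx v)) @^-1` [set x | x <= f a0]) //.
    by apply: preimage_closed => [x _|]; [exact: cf | exact: closed_le].
  by apply/seteqP; split=> v.
have Dbdd : bounded_set D.
  exists (Num.max 0 B); split=> [|M BM v [Zv fv]]; first exact: num_real.
  have BM' : B <= M by rewrite (le_trans _ (ltW BM)) // le_max lexx orbT.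
  change (`|v| <= M); rewrite [leLHS]/Num.norm /= mx_normrE; apply/bigmax_leP; split=> /=.
    by rewrite (le_trans _ (ltW BM)) // le_max lexx.
  move=> [i j] _ /=; rewrite ord1 {i}; case/mxvec_indexP: j => i j.
  by rewrite (le_trans _ BM') //; have := bdd _ Zv fv i j; rewrite mxE.
have [v vD vmin] : exists2 v, v \in D & forall t, t \in D -> f (vec_mx v) <= f (vec_mx t).
  apply: (@EVT_min_rV _ _ (fun v => f (vec_mx v))); first by exists (mxvec a0).
    exact: bounded_closed_compact.
  exact: continuous_subspaceT.
move: vD; rewrite inE => -[Zv fv]; exists (vec_mx v) => // b Zb.
have [fb|fb] := leP (f b) (f a0); last exact: le_trans fv (ltW fb).
by have := vmin (mxvec b); rewrite mxvecK; apply; rewrite inE /D /= mxvecK.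
Qed.

End MatrixExtrema.

Section CriticalPoints.
Variable R : realType.

Lemma is_derive_max0 (f f1 : R -> R) :
  (forall t : R, is_derive t 1 f (f1 t)) -> (forall t, f t <= f 0) -> f1 0 = 0.
Proof.
move=> df fmax; have d0 : is_derive (0 : R) 1 f 0.
  apply: (@derive1_at_max _ f (-1) 1 0) => //.
  by rewrite in_itv /= ltrN10 ltr01.
by rewrite -(@derive_val _ _ _ _ _ _ _ (df 0)) (@derive_val _ _ _ _ _ _ _ d0).
Qed.

Lemma is_derive_min0 (f f1 : R -> R) :
  (forall t : R, is_derive t 1 f (f1 t)) -> (forall t, f 0 <= f t) -> f1 0 = 0.
Proof.
move=> df fmin; apply: oppr_inj; rewrite oppr0.
apply: (@is_derive_max0 (- f) (- f1) (fun t => is_deriveN (df t))) => t.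
by rewrite lerN2.
Qed.

(** Were [f2] positive, [f1] would be positive just to the right of zero, where it vanishes, and the
    mean value theorem would make [f] exceed [f 0]. *)
Lemma second_derive_max (f f1 : R -> R) (f2 : R) :
  (forall t : R, is_derive t 1 f (f1 t)) -> is_derive (0 : R) 1 f1 f2 ->
  (forall t, f t <= f 0) -> f2 <= 0.
Proof.
move=> df df1 fmax; rewrite leNgt; apply/negP => f2pos.
have f10 := is_derive_max0 df fmax.
have : h^-1 *: ((f1 \o shift 0) (h *: 1) - f1 0) @[h --> 0^'] --> f2.
  by rewrite -(@derive_val _ _ _ _ _ _ _ df1); case: df1 => + _.
move/cvgr_gt => /(_ 0 f2pos) [e /= e0 He].
have f1pos t : 0 < t -> t < e -> 0 < f1 t.
  move=> t0 te; have := He t; rewrite /= /shift /= f10 subr0 addr0 /GRing.scale /= mulr1.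
  rewrite /ball_ /= sub0r normrN gtr0_norm // => /(_ te (lt0r_neq0 t0)).
  by rewrite pmulr_rgt0 ?invr_gt0.
have e2 : 0 < e / 2 by rewrite divr_gt0.
have [|c] := @MVT _ f f1 0 (e / 2) e2 (fun x _ => df x).
  apply: derivable_within_continuous => x _.
  by case: (df x).
rewrite in_itv /= subr0 => /andP[c0 ce] E.
have : 0 < f1 c * (e / 2).
  rewrite mulr_gt0 ?f1pos // (lt_trans ce) // ltr_pdivrMr // mulr_natr mulr2n ltrDl //.
by rewrite -E subr_gt0 ltNge fmax.
Qed.
End CriticalPoints.

Lemma mulmx_entry_bound (R : realDomainType) m n p q (A : 'M[R]_(m, n)) (B : 'M[R]_(p, q)) :
  exists K, forall (M : 'M[R]_(n, p)) c, (forall i j, `|M i j| <= c) ->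
    forall i j, `|(A *m M *m B) i j| <= K * c.
Proof.
exists ((\sum_i \sum_j `|A i j|) * (\sum_i \sum_j `|B i j|)) => M c Mc i j.
have c0 (k : 'I_n) (l : 'I_p) : 0 <= c by rewrite (le_trans _ (Mc k l)).
rewrite mxE (le_trans (ler_norm_sum _ _ _)) //.
rewrite (@le_trans _ _ (\sum_k (\sum_l `|A i l| * c) * `|B k j|)) //.
  apply: ler_sum => k _; rewrite normrM ler_wpM2r // mxE (le_trans (ler_norm_sum _ _ _)) //.
  by apply: ler_sum => l _; rewrite normrM ler_wpM2l.
have -> : \sum_k (\sum_l `|A i l| * c) * `|B k j| =
    \sum_k \sum_l c * (`|A i l| * `|B k j|).
  by apply: eq_bigr => k _; rewrite mulr_suml; apply: eq_bigr => l _; ring.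
rewrite [leRHS]mulrC [leRHS]mulrA [c * _]mulrC -[leRHS]mulrA.
have -> : (\sum_i \sum_j `|A i j|) * (c * \sum_i \sum_j `|B i j|) =
   \sum_k \sum_k' \sum_i' \sum_l c * (`|A i' l| * `|B k k'|).
  rewrite mulrCA mulr_sumr mulr_sumr; apply: eq_bigr => k _.
  rewrite !mulr_sumr; apply: eq_bigr => k' _.
  rewrite mulr_suml mulr_sumr; apply: eq_bigr => i' _.
  by rewrite mulr_suml mulr_sumr.
apply: ler_sum => k _.
have pos k' i' : 0 <= \sum_l c * (`|A i' l| * `|B k k'|).
  by apply: sumr_ge0 => l _; rewrite mulr_ge0 ?(c0 l k) ?mulr_ge0.
rewrite [leRHS](bigD1 j) //= [X in _ <= X + _](bigD1 i) //= -addrA lerDl.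
by rewrite addr_ge0 ?sumr_ge0 // => k' _; rewrite sumr_ge0.
Qed.

(** * Conjugation by a closed group of real automorphisms *)

Section RealGroup.
Variables (R : realType) (g : lieAlgType R) (phi theta : 'End(g)).
Local Notation n := (\dim {:g}).
Variable Gamma : 'M[R]_n -> Prop.
Implicit Types (a : 'M[R]_n) (x y : g).

Hypothesis Ctheta : cartan_involution theta.
Hypothesis phi_aut : lie_aut phi.
Hypothesis phi2 : (phi \o phi)%VF = \1%VF.
Hypothesis phi_theta : (theta \o phi)%VF = (phi \o theta)%VF.
Hypothesis Gamma1 : Gamma 1%:M.
Hypothesis GammaM : forall a c, Gamma a -> Gamma c -> Gamma (a *m c).
Hypothesis Gamma_aut : forall a, Gamma a -> mxaut a.
Hypothesis Gamma_exp : forall y t, phi y = y -> Gamma (mxexp (Am y) t).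
Hypothesis Gamma_closed : exists2 S : ('M[R]_n -> R) -> Prop,
  forall f, S f -> mxcont f & forall a, Gamma a <-> forall f, S f -> f a = 0.

Local Notation Phi := (rmx phi).
Local Notation Theta := (rmx theta).
Local Notation Q := (gram theta).

Lemma phiK x : phi (phi x) = x.
Proof. by have /lfunP/(_ x) := phi2; rewrite comp_lfunE id_lfunE. Qed.

Lemma PhiPhi : Phi *m Phi = 1%:M.
Proof. by rewrite -rmx_comp phi2 rmx1. Qed.

Lemma Phi_mxaut : mxaut Phi. Proof. exact: lie_aut_mxaut. Qed.

Lemma Phi_Am y : Phi *m Am y = Am (phi y) *m Phi.
Proof. by rewrite (mxaut_Am _ Phi_mxaut) rmxK. Qed.

Lemma theta_phi x : theta (phi x) = phi (theta x).
Proof. by have /lfunP/(_ x) := phi_theta; rewrite !comp_lfunE. Qed.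

Lemma Phi_gram : Phi^T *m Q *m Phi = Q.
Proof.
apply: bilinear_mx => x y.
have -> : (cv x)^T *m (Phi^T *m Q *m Phi) *m cv y = (cv (phi x))^T *m Q *m cv (phi y).
  by rewrite !cv_app trmx_mul !mulmxA.
rewrite !gramE theta_phi; have := mxaut_killing x (theta y) Phi_mxaut.
by rewrite !rmxK => ->.
Qed.

Lemma mxcont_trace (F : 'M[R]_n -> 'M[R]_n) :
  (forall i j, mxcont (fun a => F a i j)) -> mxcont (fun a => \tr (F a)).
Proof. by move=> cF; apply: (@mxcont_sum _ _ _ _ (fun i a => F a i i)). Qed.

Definition commuting (L : seq 'M[R]_n) a := forall c, c \in L -> a *m c = c *m a.

(** Commutation with the matrices of [L] is a family of linear equations, added to those of
    [Gamma]. *)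
Lemma commuting_min (L : seq 'M[R]_n) (F : 'M[R]_n -> R) B : mxcont F ->
  (forall a, Gamma a -> commuting L a -> F a <= F 1%:M -> forall i j, `|a i j| <= B) ->
  exists a, [/\ Gamma a, commuting L a &
    forall c, Gamma c -> commuting L c -> F a <= F c].
Proof.
move=> cF bdd; have [S S_cont GS] := Gamma_closed.
pose S' (f : 'M[R]_n -> R) := S f \/
  exists c i j, c \in L /\ f = (fun a => (a *m c) i j - (c *m a) i j).
have S'P a : (forall f, S' f -> f a = 0) <-> Gamma a /\ commuting L a.
  split=> [H|[/GS Ga ca] f [/Ga//|[c [i [j [cL ->]]]]]]; last by rewrite ca ?subrr.
  split; first by apply/GS => f Sf; apply: H; left.
  move=> c cL; apply/matrixP=> i j; apply/eqP; rewrite -subr_eq0; apply/eqP.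
  by apply: (H (fun a => (a *m c) i j - (c *m a) i j)); right; exists c, i, j.
have [|||a /S'P[Ga ca] amin] := @mx_min_attained R n S' _ F 1%:M B cF.
- move=> f [/S_cont//|[c [i [j [_ ->]]]]].
  have c1 : mxcont (fun a => (a *m c) i j).
    by apply: mxcont_mulmx => k l; [exact: mxcont_entry | exact: mxcont_cst].
  have c2 : mxcont (fun a => - 1 * (c *m a) i j).
    apply: mxcontM; first exact: mxcont_cst.
    by apply: mxcont_mulmx => k l; [exact: mxcont_cst | exact: mxcont_entry].
  rewrite (_ : (fun _ => _) = fun a => (a *m c) i j + - 1 * (c *m a) i j); first exact: mxcontD.
  by apply/funext => a; rewrite mulN1r.
- apply/S'P; split=> // c _; by rewrite mul1mx mulmx1.
- by move=> a /S'P[Ga ca]; exact: bdd.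
by exists a; split=> // c Gc cc; apply: amin; apply/S'P.
Qed.

Section Cayley.
Variables (h e f : g).
Hypothesis he : lie h e = 2%:R *: e.
Hypothesis hf : lie h f = - (2%:R *: f).
Hypothesis ef : lie e f = h.
Hypothesis phie : phi e = - e.
Hypothesis phif : phi f = - f.

Let rel : sl2_relations (Am e) (Am f) (Am h).
Proof.
split; rewrite -!mulmxE -Am_lie; first by rewrite he linearZ.
  by rewrite hf linearN linearZ.
by rewrite ef.
Qed.

(* Kempf-Ness: with [T] a form for which [e] and [f] are adjoint, minimise
   [\tr (gram *m a *m T *m a^T)] over the elements [a] of [Gamma] commuting
   with [Phi]. At a minimum the vanishing derivative is the hypothesis of
   [theta_of_critical], applied to [a (e + f)] and [a (e - f)]. *)
Lemma real_cayley_conj : exists a,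
  [/\ Gamma a, a *m Phi = Phi *m a & theta (mxr a e) = - mxr a f].
Proof.
have [|||T Tpos [eT phiT]] := sl2_contravariant_form (phi := Phi) rel.
- by rewrite -!mulmxE Phi_Am phie linearN mulNmx.
- by rewrite -!mulmxE Phi_Am phif linearN mulNmx.
- exact: PhiPhi.
rewrite -!mulmxE in eT phiT.
pose F a := \tr (Q *m a *m T *m a^T).
have cF : mxcont F.
  by apply: mxcont_trace; do 3?[apply: mxcont_mulmx]; try (move=> i j; exact: mxcont_cst);
    try exact: mxcont_entry; apply: mxcont_tr; exact: mxcont_entry.
have [D Du QE] := posdef_factor (gram_sym Ctheta) (gram_rpos Ctheta).
have Tsym : T^T = T by case: Tpos => -[N [B ->]] _; rewrite trmx_mul trmxK.
have Td := Tpos.2.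
have [v v0|B Bu TE] := posdef_factor Tsym.
  rewrite lt_neqAle psd_ge0 ?andbT; last exact: Tpos.1.
  by apply: contraNneq v0 => /esym/Td ->.
(* Cholesky factors of the two forms turn [F] into a Euclidean norm of [D *m a *m B^T], so its
   sublevel sets are bounded. The constant [1 + F 1%:M] bounds [|r|] whenever [r ^+ 2 <= F 1%:M]. *)
have FE a : F a = \sum_i \sum_j (D *m a *m B^T) i j ^+ 2.
  have -> : F a = \tr ((D *m a *m B^T) *m (D *m a *m B^T)^T).
    by rewrite /F QE TE !trmx_mul trmxK !mulmxA [RHS]mxtrace_mulC !mulmxA.
  move: (D *m a *m B^T) => M; apply: eq_bigr => i _; rewrite mxE; apply: eq_bigr => j _.
  by rewrite [in LHS]mxE expr2.
have [K HK] := mulmx_entry_bound (invmx D) (invmx B^T).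
have [|a [Ga ca amin]] := @commuting_min [:: Phi] F (K * (1 + F 1%:M)) cF.
  move=> a _ _ Fa; have -> : a = invmx D *m (D *m a *m B^T) *m invmx B^T.
    by rewrite -mulmxA mulmxK ?unitmx_tr // mulKmx.
  apply: HK => i j; have : (D *m a *m B^T) i j ^+ 2 <= F 1%:M.
    apply: le_trans Fa; rewrite FE (bigD1 i) //= (bigD1 j) //= -addrA lerDl.
    by rewrite addr_ge0 ?sumr_ge0 // => k _; rewrite ?sumr_ge0 // => *; rewrite sqr_ge0.
  move: ((D *m a *m B^T) i j) => r; rewrite -real_normK ?num_real // => r2.
  by have := normr_ge0 r; move: r2; move: `|r| (F _) => u w; nra.
have caP : a *m Phi = Phi *m a by apply: ca; rewrite inE.
exists a; split=> //.
have aA := Gamma_aut Ga; have au := aA.1.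
pose S := a *m T *m a^T.
have Spos : posdef S.
  split; first exact: (psd_conj _ Tpos.1).
  move=> w; rewrite /S !mulmxA -[_ *m a^T *m w^T]mulmxA -trmx_mul => /Td wa.
  by rewrite -[w](mulmxK au) wa mul0mx.
have Ssym : S^T = S by case: Spos => -[N' [B' ->]] _; rewrite trmx_mul trmxK.
have phiS : Phi *m S *m Phi^T = S.
  rewrite /S !mulmxA -caP -[_ *m a^T *m _]mulmxA -trmx_mul -caP trmx_mul.
  by rewrite -[a *m Phi *m T]mulmxA !mulmxA -[a *m Phi *m T]mulmxA -[a *m _ *m Phi^T]mulmxA phiT.
have trQ W : \tr (Q *m (W *m S + S *m W^T)) = 2 * \tr (Q *m W *m S).
  rewrite mulmxDr mxtraceD -[X in _ + X]mxtrace_tr trmx_mul trmx_mul trmxK Ssym (gram_sym Ctheta).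
  by rewrite [X in _ + X]mxtrace_mulC !mulmxA mulr_natl mulr2n.
have crit0 y : phi y = y -> \tr (Q *m Am y *m S) = 0.
  move=> phiy; pose E t := mxexp (Am y) t.
  have Et0 t : F a <= F (E t *m a).
    apply: amin; first by apply: GammaM Ga; exact: Gamma_exp.
    move=> c; rewrite inE => /eqP ->; rewrite -mulmxA caP !mulmxA; congr (_ *m _).
    by symmetry; apply: mxexp_comm; rewrite Phi_Am phiy.
  pose dE t := Q *m (Am y *m E t *m S *m (E t)^T + E t *m S *m (Am y *m E t)^T).
  have dF t : is_derive (t : R) 1 (fun t => F (E t *m a)) (\tr (dE t)).
    rewrite (_ : (fun _ => _) = fun t => \tr (Q *m (E t *m S *m (E t)^T))); last first.
      by apply/funext => s; rewrite /F /S trmx_mul !mulmxA.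
    have mE : mxderiv E t (Am y *m E t) by exact: mxderiv_mxexp.
    have mEt : mxderiv (fun t => (E t)^T) t (Am y *m E t)^T.
      move=> i j; rewrite mxE (_ : (fun _ => _) = fun t => E t j i) //.
      by apply/funext => s; rewrite mxE.
    have := mxderivM (mxderiv_cst Q t) (mxderivM (mxderivM mE (mxderiv_cst S t)) mEt).
    rewrite mul0mx add0r mulmx0 addr0 => H.
    by apply: (@is_derive_bigsum _ _ (fun i t => (Q *m (E t *m S *m (E t)^T)) i i)) => i; exact: H.
  have := is_derive_min0 dF; rewrite /dE /E mxexp0 mul1mx trmx1 !mulmx1 mul1mx.
  rewrite trQ => H; have /eqP := H Et0.
  by rewrite mulf_eq0 pnatr_eq0 /= => /eqP.
(* Only [y] fixed by [phi] gives a one-parameter group inside [Gamma]. Both [Q] and [S] are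
   invariant under [phi], so a general [y] reduces to [y + phi y]. *)
have crit y : \tr (Q *m Am y *m S) = 0.
  have E : \tr (Q *m Am (phi y) *m S) = \tr (Q *m Am y *m S).
    rewrite -[in LHS]phiS !mulmxA.
    rewrite -[Q *m Am (phi y) *m Phi]mulmxA -Phi_Am [LHS]mxtrace_mulC !mulmxA.
    by rewrite Phi_gram.
  have : \tr (Q *m Am (y + phi y) *m S) = 0 by apply: crit0; rewrite linearD /= phiK addrC.
  rewrite linearD mulmxDr mulmxDl mxtraceD E => /eqP.
  by rewrite -mulr2n mulrn_eq0 => /eqP.
have AmS : Am (mxr a e) *m S = S *m (Am (mxr a f))^T.
  rewrite !mxaut_AmV // /S !mulmxA mulmxKV // -[a *m Am e *m T]mulmxA eT !trmx_mul !mulmxA.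
  by rewrite -[_ *m a^T *m _]mulmxA -trmx_mul mulVmx // trmx1 mulmx1.
have AmS' : Am (mxr a f) *m S = S *m (Am (mxr a e))^T.
  by rewrite -[LHS]trmxK trmx_mul Ssym -AmS [LHS]trmx_mul Ssym.
have t1 : theta (mxr a e + mxr a f) = - (mxr a e + mxr a f).
  rewrite (theta_of_critical Ctheta Spos crit (eps := 1)) ?scale1r ?expr1n //.
  by rewrite linearD mulmxDl AmS AmS' linearD mulmxDr addrC.
have t2 : theta (mxr a e - mxr a f) = mxr a e - mxr a f.
  rewrite (theta_of_critical Ctheta Spos crit (eps := -1)) ?sqrrN ?expr1n //.
    by rewrite scaleN1r opprK.
  by rewrite linearB mulmxBl AmS AmS' linearB mulmxBr scaleN1r opprB.
have t12 := congr2 +%R t1 t2; move: t12; rewrite !linearD linearN /=.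
set te := theta _; set tf := theta _ => t12.
have : te *+ 2 = - mxr a f *+ 2.
  have -> : te *+ 2 = te + tf + (te - tf) by rewrite addrACA subrr addr0.
  by rewrite t12 addrACA addNr add0r mulr2n.
move/eqP; rewrite -subr_eq0 -mulrnBl -scaler_nat scaler_eq0 pnatr_eq0 /= subr_eq0 => /eqP ->.
by [].
Qed.

End Cayley.

Lemma mxaut_gram a : mxaut a -> a *m Theta = Theta *m a -> a^T *m Q *m a = Q.
Proof.
move=> aA aT; apply: bilinear_mx => x y.
have -> : (cv x)^T *m (a^T *m Q *m a) *m cv y = (cv (mxr a x))^T *m Q *m cv (mxr a y).
  by rewrite !cv_mxr trmx_mul !mulmxA.
have E : theta (mxr a y) = mxr a (theta y).
  by apply: cv_inj; rewrite [LHS]cv_app !cv_mxr cv_app !mulmxA aT.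
by rewrite !gramE E mxaut_killing.
Qed.

Lemma Theta_Am y : Theta *m Am y = Am (theta y) *m Theta.
Proof. by rewrite (mxaut_Am _ (theta_mxaut Ctheta)) rmxK. Qed.

Variables (h0 : {vspace g}) (P : 'M[R]_n) (s : g).
Hypothesis h0_cartan : cartan_subalgebra (grade phi 0) h0.
Hypothesis Pu : P \in unitmx.
Hypothesis Pdiag : forall x, x \in h0 -> is_diag_mx (P *m Am x *m invmx P).
Hypothesis theta_h0 : forall x, x \in h0 -> theta x = - x.
Hypothesis sh : s \in h0.
Hypothesis s_gen : generic h0 P s.

(* Maximise [- killing (a h) (theta s)] over the elements [a] of [Gamma] that
   commute with [Phi] and [Theta]. The first variation puts [a h] into the
   centraliser of [s]; the second variation along [E + theta E] gives the signs. *)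
Lemma dominant_conj h : phi h = h -> theta h = - h -> exists a,
  [/\ Gamma a, a *m Phi = Phi *m a, a *m Theta = Theta *m a, mxr a h \in h0 &
   forall r c E, phi E = E -> lie s E = r *: E -> 0 < r -> lie (mxr a h) E = c *: E ->
     E != 0 -> 0 <= c].
Proof.
move=> phih thh; pose F a := - ((cv s)^T *m Q *m a *m cv h) 0 0.
have cF : mxcont F.
  rewrite (_ : F = fun a => (- 1) * ((cv s)^T *m Q *m a *m cv h) 0 0); last first.
    by apply/funext => a; rewrite mulN1r.
  apply: mxcontM; first exact: mxcont_cst.
  apply: mxcont_mulmx; last by move=> i j; exact: mxcont_cst.
  by apply: mxcont_mulmx => i j; [exact: mxcont_cst | exact: mxcont_entry].
have [D Du QE] := posdef_factor (gram_sym Ctheta) (gram_rpos Ctheta).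
have [K HK] := mulmx_entry_bound (invmx D) D.
have [|a [Ga ca amin]] := @commuting_min [:: Phi; Theta] F (K * 1) cF.
  move=> a Ga ca _; have aA := Gamma_aut Ga.
  have aT : a *m Theta = Theta *m a by apply: ca; rewrite !inE eqxx orbT.
  have := mxaut_gram aA aT; rewrite QE => aQ.
  have -> : a = invmx D *m (D *m a *m invmx D) *m D by rewrite -!mulmxA mulKmx // mulVmx // mulmx1.
  (* An automorphism commuting with [theta] preserves the inner product [Q], so [O] is orthogonal
     and its entries are at most 1 in absolute value. *)
  apply: HK => i j; set O := D *m a *m invmx D.
  have OO : O^T *m O = 1%:M.
    have -> : O^T *m O = (invmx D)^T *m (a^T *m (D^T *m D) *m a) *m invmx D.
      by rewrite /O !trmx_mul !mulmxA.
    by rewrite aQ mulmxA -trmx_mul mulmxV // trmx1 mul1mx mulmxV.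
  have : \sum_k O k j ^+ 2 = 1.
    have /matrixP/(_ j j) := OO; rewrite [LHS]mxE [RHS]mxE eqxx mulr1n => <-.
    by apply: eq_bigr => k _; rewrite [in RHS]mxE expr2.
  rewrite (bigD1 i) //= => Oij; rewrite -(@ler_pXn2r _ 2) ?nnegrE // expr1n.
  by rewrite real_normK ?num_real // -Oij lerDl sumr_ge0 // => k _; exact: sqr_ge0.
have aP : a *m Phi = Phi *m a by apply: ca; rewrite !inE eqxx.
have aT : a *m Theta = Theta *m a by apply: ca; rewrite !inE eqxx orbT.
pose h' := mxr a h.
have phih' : phi h' = h' by rewrite /h' -{1}[phi]rmxK -mxrM -aP mxrM rmxK phih.
have thh' : theta h' = - h' by rewrite /h' -{1}[theta]rmxK -mxrM -aT mxrM rmxK thh linearN.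
have [_ _ positive] := Ctheta.
have phis : phi s = s by apply/mem_grade0; case: h0_cartan => /subvP + _ _ _; apply.
have crit Y : phi Y = Y -> theta Y = Y ->
    killing (lie Y h') s = 0 /\ killing (lie Y (lie Y h')) s <= 0.
  move=> phiY thY; pose f (t : R) := ((cv s)^T *m Q *m mxexp (Am Y) t *m cv h') 0 0.
  have fmax t : f t <= f 0.
    have := amin (mxexp (Am Y) t *m a); rewrite /F lerN2.
    rewrite /f mxexp0 mulmx1 /h' cv_mxr !mulmxA; apply; first exact: GammaM (Gamma_exp _ phiY) Ga.
    move=> c; rewrite !inE => /orP[] /eqP ->.
      rewrite -mulmxA aP !mulmxA; congr (_ *m _).
      by symmetry; apply: mxexp_comm; rewrite Phi_Am phiY.
    rewrite -mulmxA aT !mulmxA; congr (_ *m _).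
    by symmetry; apply: mxexp_comm; rewrite Theta_Am thY.
  have dG (B : 'M[R]_n) (t : R) : is_derive t 1
      (fun t => ((cv s)^T *m Q *m (B *m mxexp (Am Y) t) *m cv h') 0 0)
      (((cv s)^T *m Q *m (B *m Am Y *m mxexp (Am Y) t) *m cv h') 0 0).
    have := mxderivM (mxderivM (mxderiv_cst ((cv s)^T *m Q) t)
      (mxderivM (mxderiv_cst B t) (mxderiv_mxexp (Am Y) t))) (mxderiv_cst (cv h') t).
    by rewrite !mul0mx !add0r mulmx0 addr0 !mulmxA => /(_ 0 0).
  have df t : is_derive (t : R) 1 f (((cv s)^T *m Q *m (Am Y *m mxexp (Am Y) t) *m cv h') 0 0).
    have := dG 1%:M t; rewrite mul1mx.
    by rewrite (_ : (fun _ => _) = f) //; apply/funext => u; rewrite /f mul1mx.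
  have gr x : ((cv s)^T *m Q *m cv x) 0 0 = killing x s.
    rewrite gramE -(killing_theta Ctheta s) (thetaK Ctheta) theta_h0 // killingNl opprK.
    exact: killingC.
  split.
    by have := is_derive_max0 df fmax; rewrite mxexp0 !mulmx1 -!mulmxA -cv_lie mulmxA gr.
  have := second_derive_max df (dG (Am Y) 0) fmax.
  by rewrite mxexp0 !mulmx1 -!mulmxA -!cv_lie mulmxA gr.
have h'h : h' \in h0.
  apply: (generic_centralizer Pu Pdiag h0_cartan sh s_gen); first exact/mem_grade0.
  (* Along [Y = z] the first variation is [killing z z] up to sign. As [theta z = z], its vanishing
     forces [z = 0], so [h'] centralises [s]. *)
  pose z := lie s h'; have phiz : phi z = z by rewrite /z phi_aut.2 phis phih'.
  have thz : theta z = z by rewrite /z (theta_lie Ctheta) thh' theta_h0 // lieNl lieNr opprK.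
  have [+ _] := crit z phiz thz; rewrite killing_lie lieC -/z killingNr => /eqP kz.
  apply/eqP; apply: contraTT kz => /(positive z).
  by rewrite thz => /gt_eqF ->.
exists a; split=> // r c E phiE sE r0 h'E E0.
(* Here [Y] brackets [h'] to [- c *: W] and [s] to [- r *: W], so the second variation is
   [- (c * r) * killing W W] with [killing W W > 0]. Its sign gives [0 <= c]. *)
pose W := E - theta E; pose Y := E + theta E.
have thh'E : lie h' (theta E) = - c *: theta E.
  by have := theta_lie Ctheta h' E; rewrite h'E thh' lieNl linearZ scaleNr /= => ->; rewrite opprK.
have thsE : lie s (theta E) = - r *: theta E.
  have := theta_lie Ctheta s E; rewrite sE (theta_h0 sh) lieNl linearZ scaleNr /= => ->; rewrite opprK //.
have thW : theta W = - W by rewrite linearB /= (thetaK Ctheta) opprB.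
have Yh' : lie Y h' = - c *: W.
  by rewrite lieC lieDr h'E thh'E scaleNr -scalerBr scaleNr.
have Ys : lie Y s = - r *: W.
  by rewrite lieC lieDr sE thsE scaleNr -scalerBr scaleNr.
have W0 : W != 0.
  apply: contra E0; rewrite subr_eq0 => /eqP EE.
  have : r *: E + r *: E = 0 by rewrite -{1}sE {1}EE thsE -EE scaleNr addNr.
  by rewrite -scalerDl => /eqP; rewrite scaler_eq0 -mulr2n mulrn_eq0 (gt_eqF r0).
have := positive W W0; rewrite thW killingNr opprK => Wpos.
have [||_] := crit Y.
- by rewrite /Y linearD /= phiE -theta_phi phiE.
- by rewrite /Y linearD /= (thetaK Ctheta) addrC.
rewrite [lie Y (lie Y h')]lieC killingNl killing_lie Yh' Ys killingZl killingZr !mulNr opprK.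
rewrite mulrN oppr_le0 => H.
by move: H; rewrite mulrA pmulr_lge0 // pmulr_lge0.
Qed.
End RealGroup.

(** * The theorem *)

Section RealForm.
Variables (R : realType) (g : lieAlgType R) (phi theta : 'End(g)).
Local Notation n := (\dim {:g}).
Local Notation gC := (complexification g).
Local Notation toC := (map_mx (real_complex R)).
Variable G0c : 'End(gC) -> Prop.
Implicit Types (a c : 'M[R]_n) (x y z : g).
Hypothesis Ctheta : cartan_involution theta.
Hypothesis HG : is_G0c phi G0c.

Local Notation Q := (gram theta).
Local Notation Theta := (rmx theta).
Let Gamma a := mxset G0c (toC a).
Let Galg : algebraic_group (mxset G0c). Proof. by case: HG. Qed.

Lemma real_G0c1 : Gamma 1%:M.
Proof. by rewrite /Gamma map_mx1; case: Galg. Qed.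

Lemma real_G0cM a c : Gamma a -> Gamma c -> Gamma (a *m c).
Proof. by rewrite /Gamma map_mxM; case: Galg => _ _ + _ _; apply. Qed.

Lemma real_G0cV a : Gamma a -> Gamma (invmx a).
Proof. by rewrite /Gamma map_invmx; case: Galg => _ _ _ + _; apply. Qed.

Lemma cmx_real_app (u : 'End(gC)) a x : toC a = cmx u -> u (cinj x) = cinj (mxr a x).
Proof. by move=> E; apply: ccv_inj; rewrite ccv_app -E !ccv_cinj cv_mxr map_mxM. Qed.

Lemma real_G0c_aut a : Gamma a -> mxaut a.
Proof.
move=> Ga; case: (Ga) => u Gu uE; have [_ uL] := adjoint_group_lie_aut (let: And4 H _ _ _ := HG in H _ Gu).
split; first by have := Ga; case: Galg => + _ _ _ _ => /[apply]; rewrite map_unitmx.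
move=> x y; have cl x' y' : lie (cinj x') (cinj y') = cinj (lie x' y').
  by congr pair; rewrite /= ?lie0l ?lie0r ?subr0 ?addr0.
have : cinj (mxr a (lie x y)) = cinj (lie (mxr a x) (mxr a y)).
  by rewrite -cl -!(cmx_real_app _ uE) -uL cl.
by case.
Qed.

Lemma real_G0c_exp y t : phi y = y -> Gamma (mxexp (Am y) t).
Proof.
move=> phiy; apply: mxexp_in_group => //; case: HG => _ _ _ H; apply/H.
exists (cinj y); last by rewrite -AC_cinj.
by rewrite mem_cplxv /= mem0v andbT; apply/mem_grade0.
Qed.

(** The equations of [G0c] describe it only among invertible matrices. Adding those that preserve
    the Killing form, whose matrix is [K] up to sign, forces invertibility, so the real points are
    closed among all matrices. *)
Lemma real_G0c_closed : exists2 S : ('M[R]_n -> R) -> Prop,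
  forall f, S f -> mxcont f & forall a, Gamma a <-> forall f, S f -> f a = 0.
Proof.
have [Gu _ _ _ [S GS]] := Galg.
pose K := Q *m Theta.
have Ku : K \in unitmx.
  have [D Du QE] := posdef_factor (gram_sym Ctheta) (gram_rpos Ctheta).
  by rewrite /K QE !unitmx_mul unitmx_tr Du; case: (theta_mxaut Ctheta).
have KE x y : ((cv x)^T *m K *m cv y) 0 0 = - killing x y.
  by rewrite /K !mulmxA -mulmxA -cv_app gramE (thetaK Ctheta).
have autK a : mxaut a -> a^T *m K *m a = K.
  move=> aA; apply: bilinear_mx => x y; rewrite KE -(mxaut_killing x y aA) -KE.
  by rewrite !cv_mxr trmx_mul !mulmxA.
have ReR (z : R[i]) r : complex.Re (z * real_complex R r) = complex.Re z * r.
  by case: z => z1 z2 /=; rewrite mulr0 subr0.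
have ImR (z : R[i]) r : complex.Im (z * real_complex R r) = complex.Im z * r.
  by case: z => z1 z2 /=; rewrite mulr0 add0r.
pose S' (f : 'M[R]_n -> R) :=
  (exists2 p, S p & f = (fun a => mxev a (mpart (@complex.Re R) p)) \/
                    f = (fun a => mxev a (mpart (@complex.Im R) p))) \/
  exists i j, f = fun a => (a^T *m K *m a) i j + - K i j.
exists S'.
  move=> f [[p Sp [->|->]]|[i [j ->]]]; try exact: mxcont_mxev.
  apply: mxcontD; last exact: mxcont_cst.
  apply: mxcont_mulmx; last exact: mxcont_entry.
  apply: mxcont_mulmx; last by move=> *; exact: mxcont_cst.
  by apply: mxcont_tr; exact: mxcont_entry.
move=> a; split=> [Ga f|H].
  move=> [[p Sp]|[i [j ->]]]; last by rewrite autK ?subrr //; exact: real_G0c_aut.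
  have /GS/(_ p Sp) := Ga; rewrite mxevE => /(_ (Gu _ Ga)) p0.
  by case=> ->; rewrite mxev_mpart // p0.
have aK : a^T *m K *m a = K.
  apply/matrixP=> i j; apply/eqP; rewrite -subr_eq0; apply/eqP.
  by apply: (H (fun a => (a^T *m K *m a) i j + - K i j)); right; exists i, j.
have au : a \in unitmx.
  have := Ku; rewrite -aK unitmx_mul; by case/andP.
apply/GS; first by rewrite map_unitmx.
move=> p Sp; rewrite mxevE.
have Re0 : mxev a (mpart (@complex.Re R) p) = 0.
  by apply: (H (fun a => mxev a (mpart (@complex.Re R) p))); left; exists p => //; left.
have Im0 : mxev a (mpart (@complex.Im R) p) = 0.
  by apply: (H (fun a => mxev a (mpart (@complex.Im R) p))); left; exists p => //; right.
move: Re0 Im0; rewrite !mxev_mpart //; case: (mxev _ p) => p1 p2 /= -> -> //.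
Qed.

End RealForm.

Lemma ad_nilpotent_cinj (R : rcfType) (g : lieAlgType R) (h e : g) :
  lie h e = 2%:R *: e -> ad_nilpotent (cinj e : complexification g).
Proof.
move=> he; have [|m em] := @nilp_of_sl2 R _ (Am e) (Am h) 2%:R (lt0r_neq0 (ltr0n R 2)).
  by rewrite -!mulmxE -Am_lie he linearZ.
have iterE x : iter m (lie e) x = 0.
  have it k : cv (iter k (lie e) x) = Am e ^+ k *m cv x.
    by elim: k => [|k IH]; rewrite ?expr0 ?mul1mx // iterS cv_lie IH mulmxA exprS.
  by apply: cv_inj; rewrite it em mul0mx linear0.
exists m => -[x y].
have -> k : iter k (lie (cinj e : complexification g)) (x, y) = (iter k (lie e) x, iter k (lie e) y).
  by elim: k => //= k ->; congr pair; rewrite /= lie0l ?subr0 ?addr0.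
by rewrite !iterE.
Qed.

Lemma rmx_app_comm (R : rcfType) (g : lieAlgType R) (a : 'M[R]_(\dim {:g})) (u : 'End(g)) x :
  a *m rmx u = rmx u *m a -> u (mxr a x) = mxr a (u x).
Proof. by move=> au; apply: cv_inj; rewrite [LHS]cv_app !cv_mxr cv_app !mulmxA au. Qed.

Theorem proposition6 (R : realType) (g : lieAlgType R)
    (phi theta : 'End(g)) (h0 : {vspace g})
    (G0c : 'End(complexification g) -> Prop)
    (k : nat) (Gt : 'M[R[i]]_k -> Prop)
    (Rc : 'M[R[i]]_k -> 'End(complexification g))
    (t : nat) (hs : 'I_t -> g) (es fs : 'I_t -> complexification g)
    (h e f : g) :
  semisimple g ->
  split_lie_algebra g ->
  lie_involution phi ->
  cartan_involution theta ->
  (theta \o phi)%VF = (phi \o theta)%VF ->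
  is_G0c phi G0c ->
  algebraic_group Gt ->
  zconnected Gt ->
  defined_over Num.real Gt ->
  algebraic_group_iso_over Num.real Gt (mxset G0c)
    (fun A => cmx (Rc A)) ->
  cartan_subalgebra (grade phi 0) h0 ->
  split_subspace h0 ->
  (theta @: h0 <= h0)%VS ->
  (exists hg : {vspace g},
    [/\ (h0 <= hg)%VS, cartan_subalgebra {:g} hg, split_subspace hg
      & (theta @: hg <= hg)%VS]) ->
  nilpotent_orbit_reps G0c (cplxv (grade phi 1)) es ->
  (forall i, homogeneous_triple (cplxv (grade phi 0)) (cplxv (grade phi 1))
    (cinj (hs i)) (es i) (fs i)) ->
  (forall i, hs i \in h0) ->
  homogeneous_triple (grade phi 0) (grade phi 1) h e f ->
  exists (a : 'End(g)) (i : 'I_t),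
    [/\ real_points_image Gt Rc a, a h = hs i
      & real_cayley_triple phi theta (a h) (a e) (a f)].
Proof.
move=> _ _ [phi_aut phi2 _] Ctheta phi_theta HG Galg _ Gtr iso h0_cartan h0_split th_h0 _.
move=> [es1 es_orb] hs_triple hs_h0 [[he hf ef e0] h_grade e_grade f_grade].
have [phih phie phif] : [/\ phi h = h, phi e = - e & phi f = - f].
  by split; [exact/mem_grade0 | exact/mem_grade1 | exact/mem_grade1].
pose Gamma a := mxset G0c (map_mx (real_complex R) a).
have G1 : Gamma 1%:M := real_G0c1 HG.
have GM a c : Gamma a -> Gamma c -> Gamma (a *m c) := @real_G0cM _ _ _ _ HG a c.
have GV a : Gamma a -> Gamma (invmx a) := @real_G0cV _ _ _ _ HG a.
have GA a : Gamma a -> mxaut a := @real_G0c_aut _ _ _ _ HG a.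
have Gexp y s : phi y = y -> Gamma (mxexp (Am y) s) := @real_G0c_exp _ _ _ _ HG y s.
have Gcl := real_G0c_closed Ctheta HG.
have h0_abel := split_cartan_abelian h0_cartan h0_split.
have [P Pu Pdiag] := weight_basis h0_cartan h0_split.
have th_h0N x : x \in h0 -> theta x = - x.
  exact: (split_cartan_theta Pu Pdiag Ctheta th_h0).
have [s sh s_gen] := generic_exists h0 P.
have AmI := Am_eq0 Ctheta.
have phi_h0 x : x \in h0 -> phi x = x.
  by move=> xh; apply/mem_grade0; case: h0_cartan => /subvP + _ _ _; apply.
have [a1 [Ga1 a1P th1]] :=
  real_cayley_conj Ctheta phi_aut phi2 phi_theta G1 GM GA Gexp Gcl he hf ef phie phif.
have dom := dominant_conj Ctheta phi_aut phi_theta G1 GM GA Gexp Gcl h0_cartan Pu Pdiag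
  th_h0N sh s_gen.
pose h1 := mxr a1 h; pose e1 := mxr a1 e; pose f1 := mxr a1 f.
have a1L := (GA _ Ga1).2.
have th1f : theta f1 = - e1 by rewrite -[e1](thetaK Ctheta) th1 linearN opprK.
have phih1 : phi h1 = h1 by rewrite /h1 (rmx_app_comm _ a1P) phih.
have th1h : theta h1 = - h1.
  by rewrite /h1 -ef a1L (theta_lie Ctheta) th1 th1f lieNl lieNr opprK lieC.
have [k1 [Gk1 k1P k1T yh ydom]] := dom h1 phih1 th1h.
have k1L := (GA _ Gk1).2.
pose y := mxr k1 h1; pose e2 := mxr k1 e1; pose f2 := mxr k1 f1.
have mxr_inj a : Gamma a -> injective (mxr a).
  move=> /GA[au _] x z E; apply: cv_inj; apply: (can_inj (mulKmx au)).
  by rewrite -!cv_mxr E.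
have mxr0 a : mxr a (0 : g) = 0 by rewrite linear0.
have e20 : e2 != 0.
  apply: contra_neq e0 => E; apply: (mxr_inj _ Ga1); apply: (mxr_inj _ Gk1).
  by rewrite -/e1 -/e2 E !mxr0.
have ye2 : lie y e2 = 2%:R *: e2 by rewrite -k1L -a1L he !linearZ.
have yf2 : lie y f2 = - (2%:R *: f2) by rewrite -k1L -a1L hf !linearN !linearZ.
have ef2 : lie e2 f2 = y by rewrite -k1L -a1L ef.
have the2 : theta e2 = - f2 by rewrite (rmx_app_comm _ k1T) th1 linearN.
have phie2 : phi e2 = - e2 by rewrite !(rmx_app_comm _ k1P) (rmx_app_comm _ a1P) phie !linearN.
have phif2 : phi f2 = - f2 by rewrite !(rmx_app_comm _ k1P) (rmx_app_comm _ a1P) phif !linearN.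
have cl x' y' : lie (cinj x') (cinj y') = cinj (lie x' y') :> complexification g.
  by congr pair; rewrite /= ?lie0l ?lie0r ?subr0 ?addr0.
have cinjZ r x' : cinj (r *: x') = real_complex R r *: cinj x' :> complexification g.
  by congr pair; rewrite /= ?scaler0 ?scale0r ?subr0 ?addr0.
have [||| i [[u Gu uE] _]] := es_orb (cinj e2).
- by rewrite mem_cplxv /= mem0v andbT; apply/mem_grade1.
- by apply: contra_neq e20; case.
- exact: ad_nilpotent_cinj ye2.
have [[hsE hsF EF _] _ _ _] := hs_triple i.
(* Lying in [h0], the element [hs i] is real, fixed by [phi] and negated by [theta], which is all
   that [dom] asks, even though [es i] and [fs i] may be complex. *)
have [k2 [Gk2 k2P k2T xh xdom]] := dom _ (phi_h0 _ (hs_h0 i)) (th_h0N _ (hs_h0 i)).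
pose x := mxr k2 (hs i).
have [v Gv vE] := Gk2.
have vL : forall z w, v (lie z w) = lie (v z) (v w).
  by case: HG => /(_ _ Gv)/adjoint_group_lie_aut[].
have vhs : v (cinj (hs i)) = cinj x := cmx_real_app _ vE.
have [_ [Gun _ GcM GcV _] _ _] := HG.
(* [w] undoes [v] and then applies [u], so it maps [v (es i)] to [u (es i)], that is, to
   [cinj e2]. *)
have [w Gw wE] : mxset G0c (cmx u *m invmx (cmx v)).
  by apply: GcM; [exists u | apply: GcV; exists v].
have wvE z : w (v z) = u z.
  by apply: ccv_inj; rewrite !ccv_app -wE mulmxA mulmxKV // Gun //; exists v.
have xy : x = y.
  apply: (@dominant_characteristic_unique _ _ _ _ _ _ _ phi_aut AmI h0_cartan Pu Pdiag sh s_gen HG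
    x y (v (es i)) (v (fs i)) (cinj e2) (cinj f2) w) => //.
  - by rewrite -vhs -vL hsE linearZ.
  - by rewrite -vhs -vL hsF linearN linearZ.
  - by rewrite -vL EF vhs.
  - by rewrite cl ye2 cinjZ rmorph_nat.
  - by rewrite cl yf2 -scaleNr cinjZ rmorphN rmorph_nat scaleNr.
  - by rewrite cl ef2.
  by rewrite wvE.
(* Undoing [k2] brings the common dominant characteristic [x = y] back to [hs i]. As [k2] commutes
   with [theta] and [phi], the triple remains a real Cayley triple. *)
pose b := invmx k2; have Gb : Gamma b := GV _ Gk2; have bL := (GA _ Gb).2.
have k2u := (GA _ Gk2).1.
have b_comm M : k2 *m M = M *m k2 -> b *m M = M *m b.
  move=> E; apply: (can_inj (mulKmx k2u)); rewrite mulKVmx // mulmxA E -mulmxA mulmxV //.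
  by rewrite mulmx1.
have bP := b_comm _ k2P; have bT := b_comm _ k2T.
have aE z : mxr (b *m k1 *m a1) z = mxr b (mxr k1 (mxr a1 z)) by rewrite !mxrM.
have Ga : Gamma (b *m k1 *m a1) by exact: (GM _ _ (GM _ _ Gb Gk1) Ga1).
exists (mxr (b *m k1 *m a1)), i.
have ah : mxr (b *m k1 *m a1) h = hs i.
  by rewrite aE -/h1 -/y -xy -mxrM mulVmx // mxr1.
split=> //.
  have [|A [GtA Areal] FA] := real_preimage Galg Gtr iso (a := b *m k1 *m a1) => //.
  by exists A => //; apply: cmx_inj; rewrite FA cmx_cplx_end mxrK.
split; last by rewrite !aE (rmx_app_comm _ bT) the2 linearN.
have e3 : mxr b e2 != 0.
  by apply: contra_neq e20 => E; apply: (mxr_inj _ Gb); rewrite E mxr0.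
rewrite !aE; split.
- by split=> //; rewrite -bL ?ye2 ?yf2 ?ef2 ?linearN ?linearZ.
- by apply/mem_grade0; rewrite (rmx_app_comm _ bP) !(rmx_app_comm _ k1P) phih1.
- by apply/mem_grade1; rewrite (rmx_app_comm _ bP) phie2 linearN.
by apply/mem_grade1; rewrite (rmx_app_comm _ bP) phif2 linearN.
Qed.
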